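(* Let $n\ge 3$, let $K$ be an oriented $(n-1)$-dimensional pseudo-manifold, and let $P_t\colon K\to\mathbb{E}^n$, $t\in(a,b)$, be a non-trivial flexion of a flexible polyhedron with non-degenerate faces in Euclidean space $\mathbb{E}^n$. Then the Dehn invariant $\Delta(P_t)\in\mathbb{R}\otimes_{\mathbb{Z}}(\mathbb{R}/\pi\mathbb{Z})$ is constant, i.e., independent of $t\in(a,b)$.
   Context: A $k$-dimensional pseudo-manifold is a finite simplicial complex $K$ such that (1) every simplex of $K$ is contained in a $k$-dimensional simplex; (2) every $(k-1)$-dimensional simplex of $K$ is contained in exactly two $k$-dimensional simplices; (3) $K$ is strongly connected, i.e., the complement of the $(k-2)$-skeleton in $K$ is connected. It is oriented if its $k$-dimensional simplices are endowed with compatible orientations. $\mathbf{F}_k(K)$ denotes the set of $k$-dimensional simplices of $K$. A polyhedron of combinatorial type $K$ in $\mathbb{E}^n$, where $K$ is an $(n-1)$-dimensional pseudo-manifold, is a map $P\colon K\to\mathbb{E}^n$ whose restriction to every simplex of $K$ is affine linear (it need not be an embedding). It has non-degenerate faces if for every simplex $[v_0\ldots v_k]$ of $K$ the points $P(v_0),\ldots,P(v_k)$ are affinely independent. A flexion is a continuous family of polyhedra $P_t\colon K\to\mathbb{E}^n$, $t\in(a,b)$, such that for any $t_1,t_2\in(a,b)$ every face of $P_{t_1}$ is congruent to the corresponding face of $P_{t_2}$. It is non-trivial if $P_{t_1}$ cannot be obtained from $P_{t_2}$ by an isometry of $\mathbb{E}^n$ for any distinct sufficiently close $t_1,t_2$.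 A polyhedron is flexible if it admits a non-trivial flexion. Oriented dihedral angles. Fix an orientation of $\mathbb{E}^n$. Let $P\colon K\to\mathbb{E}^n$ be a polyhedron with non-degenerate faces, let $\sigma\in\mathbf{F}_{n-2}(K)$, and let $\tau_1,\tau_2$ be the two $(n-1)$-dimensional simplices containing $\sigma$. Take a point $\mathbf{x}\in P(\sigma)$. Let $\mathbf{n}_i$ be the unit vector tangent to $P(\tau_i)$ at $\mathbf{x}$, orthogonal to $P(\sigma)$ and pointing inside $P(\tau_i)$. Let $\mathbf{m}_i$ be the unit vector at $\mathbf{x}$ orthogonal to $P(\tau_i)$ such that the direction of $\mathbf{m}_i$ followed by the positive orientation of $P(\tau_i)$ yields the positive orientation of $\mathbb{E}^n$. The positive direction of rotation around $P(\sigma)$ is from $\mathbf{m}_1$ to $\mathbf{n}_1$, and $\varphi_\sigma(P)\in\mathbb{R}/2\pi\mathbb{Z}$ is the angle from $\mathbf{n}_1$ to $\mathbf{n}_2$ in this positive direction. It does not depend on the choice of $\mathbf{x}$ or on the order of $\tau_1,\tau_2$. The Dehn invariant of $P$ is $$\Delta(P)=\sum_{\sigma\in\mathbf{F}_{n-2}(K)}\mathrm{vol}_{n-2}(P(\sigma))\otimes\varphi_\sigma(P)\in\mathbb{R}\otimes_{\mathbb{Z}}(\mathbb{R}/\pi\mathbb{Z}),$$ where $\varphi_\sigma(P)$ is reduced modulo $\pi$. *)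

(* Defs.v *)
From HB Require Import structures.
From mathcomp Require Import all_boot all_order all_algebra all_fingroup.
From mathcomp Require Import generic_quotient ring_quotient freeg.
From mathcomp Require Import all_classical all_reals all_analysis.

Set Implicit Arguments.
Unset Strict Implicit.
Unset Printing Implicit Defensive.

Import Order.TTheory GRing.Theory Num.Theory.
Import numFieldNormedType.Exports.

Local Open Scope classical_set_scope.
Local Open Scope ring_scope.
Local Open Scope quotient_scope.

Section Tensor.

Definition subgroup_gen (V : zmodType) (S : set V) : {pred V} := fun x =>
  `[< forall H : {pred V}, zmod_closed H -> (forall y, S y -> y \in H) ->
      x \in H >].

Lemma subgroup_gen_closed (V : zmodType) (S : set V) :
  zmod_closed (subgroup_gen S).
Proof.
split=> [|x y /asboolP Sx /asboolP Sy]; apply/asboolP => H HH SH.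
  by case: HH.
by case: (HH) => _ HB; apply: HB; [exact: Sx | exact: Sy].
Qed.

HB.instance Definition _ (V : zmodType) (S : set V) :=
  GRing.isZmodClosed.Build V (subgroup_gen S) (@subgroup_gen_closed V S).

Variables A B : zmodType.

(* {freeg T} is the free abelian group on T, and << x >> the generator x. *)
Definition bilinear_relators : set {freeg (A * B)} :=
  [set z | (exists a1 a2 b,
              z = << (a1 + a2, b) >> - (<< (a1, b) >> + << (a2, b) >>)) \/
           (exists a b1 b2,
              z = << (a, b1 + b2) >> - (<< (a, b1) >> + << (a, b2) >>))].

Definition tensorZ : zmodType := Quotient.quot (subgroup_gen bilinear_relators).

Definition tens (a : A) (b : B) : tensorZ :=
  \pi_(Quotient.quot (subgroup_gen bilinear_relators)) << (a, b) >>.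

End Tensor.

Section Circle.
Variable R : realType.

Definition zmultiples (c : R) : {pred R} :=
  fun x => `[< exists k : int, x = c *~ k >].

Lemma zmultiples_closed (c : R) : zmod_closed (zmultiples c).
Proof.
split=> [|x y /asboolP[k ->] /asboolP[l ->]]; apply/asboolP.
  by exists 0; rewrite mulr0z.
by exists (k - l); rewrite mulrzBr.
Qed.

HB.instance Definition _ (c : R) :=
  GRing.isZmodClosed.Build R (zmultiples c) (zmultiples_closed c).

Definition circle (c : R) : zmodType := Quotient.quot (zmultiples c).

Definition to_circle (c x : R) : circle c := \pi_(Quotient.quot (zmultiples c)) x.

(* Independent of the representative, since 2piZ is contained in piZ. *)
Definition mod_pi (phi : circle (2 * pi)) : circle pi :=
  to_circle pi (repr (phi : Quotient.quot (zmultiples (2 * pi)))).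

End Circle.

Section EuclideanSpace.
Variables (R : realType) (n : nat).
Implicit Types u v : 'rV[R]_n.

Definition dotp u v : R := \sum_j u 0 j * v 0 j.

(* The norm `|u| of the library on matrices is the sup norm. *)
Definition enorm u : R := Num.sqrt (dotp u u).

Definition euclidean_isometry (g : 'rV[R]_n -> 'rV[R]_n) : Prop :=
  forall u v, enorm (g u - g v) = enorm (u - v).

(* m-dimensional volume of the simplex with vertices p_0, ..., p_m: the Gram
   determinant of its edge vectors p_i - p_0 is the square of the volume of the
   parallelepiped they span. *)
Definition simplex_vol (p : seq 'rV[R]_n) : R :=
  let m := (size p).-1 in
  let D : 'M[R]_(m, n) := \matrix_(i < m) (p`_i.+1 - p`_0) in
  Num.sqrt (\det (D *m D^T)) / (m`!)%:R.

End EuclideanSpace.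

Section Complex.
Variables (V : finType).
Implicit Types (K : {set {set V}}) (s : {set V}).

Definition simplicial_complex K : Prop :=
  (forall s, s \in K -> (0 < #|s|)%N) /\
  (forall s t, t \in K -> s \subset t -> (0 < #|s|)%N -> s \in K).

Definition faces (k : nat) K : {set {set V}} := [set s in K | #|s| == k.+1].

(* Points of the geometric realization are given by their barycentric
   coordinates, in R^V with the product topology. *)
Definition geom_simplex (R : realType) s : set {ptws V -> R} :=
  [set x | [/\ forall v, 0 <= x v, \sum_v x v = 1
             & forall v, v \notin s -> x v = 0]].

Definition realization (R : realType) K : set {ptws V -> R} :=
  [set x | exists2 s, s \in K & geom_simplex s x].

Definition vertex (R : realType) (v : V) : {ptws V -> R} :=
  fun w => (w == v)%:R.

(* The simplices of dimension at most k - 2; with the shift #|s| = dim s + 1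
   this also makes sense for k < 2, where the skeleton is empty. *)
Definition codim2_skeleton (k : nat) K : {set {set V}} :=
  [set s in K | (#|s| < k)%N].

Definition pseudo_manifold (R : realType) (k : nat) K : Prop :=
  [/\ simplicial_complex K,
      forall s, s \in K -> exists2 t, t \in faces k K & s \subset t,
      forall s, s \in K -> #|s| = k ->
        #|[set t in faces k K | s \subset t]| = 2%N
    & connected (realization K `\` realization (codim2_skeleton k K)
                 : set {ptws V -> R})].

(* An orientation of the k-simplices is given by the set of their positive
   vertex orderings. The k-simplex (v, s_1, ..., s_k) induces the orientation
   (s_1, ..., s_k) on its face opposite to v; two adjacent k-simplices are
   compatibly oriented when they induce opposite orientations on their common
   face. *)
Definition orientation (k : nat) K (o : pred (k.+1.-tuple V)) : Prop :=
  (forall (t : k.+1.-tuple V) (p : 'S_k.+1), [set v in t] \in faces k K ->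
     o [tuple tnth t (p i) | i < k.+1] = o t (+) odd_perm p) /\
  (forall (s : k.-tuple V) (v w : V), v != w ->
     [set u in v :: s] \in faces k K -> [set u in w :: s] \in faces k K ->
     o [tuple of v :: s] = ~~ o [tuple of w :: s]).

End Complex.

(* Maps K -> E^n are represented by functions on R^V, of which only the values
   on the realization of K matter. *)
Section Polyhedra.
Variables (R : realType) (V : finType) (n : nat) (K : {set {set V}}).
Implicit Types P : {ptws V -> R} -> 'rV[R]_n.

Definition polyhedron P : Prop :=
  forall s, s \in K -> forall x y, geom_simplex s x -> geom_simplex s y ->
  forall l : R, 0 <= l <= 1 ->
    P (fun v => l * x v + (1 - l) * y v) = l *: P x + (1 - l) *: P y.

Definition nondegenerate_faces P : Prop :=
  forall s, s \in K -> forall c : V -> R,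
    \sum_(v in s) c v = 0 -> \sum_(v in s) c v *: P (vertex R v) = 0 ->
    forall v, v \in s -> c v = 0.

Definition congruent_faces P Q : Prop :=
  forall s, s \in K -> exists2 g, euclidean_isometry g &
    forall x, geom_simplex s x -> P x = g (Q x).

Definition isometric P Q : Prop :=
  exists2 g, euclidean_isometry g & forall x, realization K x -> P x = g (Q x).

Definition flexion (a b : R) (P : R -> {ptws V -> R} -> 'rV[R]_n) : Prop :=
  [/\ {in `]a, b[, forall t, polyhedron (P t)},
      forall x, realization K x -> {in `]a, b[, continuous (fun t => P t x)}
    & {in `]a, b[ &, forall t1 t2, congruent_faces (P t1) (P t2)}].

Definition nontrivial_flexion (a b : R) (P : R -> {ptws V -> R} -> 'rV[R]_n) :
    Prop :=
  flexion a b P /\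
  exists2 e : R, 0 < e & {in `]a, b[ &, forall t1 t2,
    t1 != t2 -> `|t1 - t2| < e -> ~ isometric (P t1) (P t2)}.

End Polyhedra.

(* Here n = d + 1, and d = n - 1 is the dimension of K. The space
   E^n = 'rV[R]_d.+1 carries its standard orientation. *)
Section DehnInvariant.
Variables (R : realType) (V : finType) (d : nat).
Variables (K : {set {set V}}) (o : pred (d.+1.-tuple V)).
Variable P : {ptws V -> R} -> 'rV[R]_d.+1.

Definition orthogonal_to (s : {set V}) (u : 'rV[R]_d.+1) : Prop :=
  forall x y, geom_simplex s x -> geom_simplex s y -> dotp u (P x - P y) = 0.

(* A vector orthogonal to P(s) is tangent to P(t) and points inside P(t) iff
   some small positive multiple of it leads from some point of P(s) to a point
   of P(t); at a boundary point of P(s) this segment may leave P(t), whence the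
   existential quantifier on x. *)
Definition inner_normal (s t : {set V}) (u : 'rV[R]_d.+1) : Prop :=
  [/\ enorm u = 1, orthogonal_to s u
    & exists x y (e : R), [/\ geom_simplex s x, geom_simplex t y, 0 < e
                            & P x + e *: u = P y]].

Definition edge_matrix (w : d.+1.-tuple V) : 'M[R]_(d, d.+1) :=
  \matrix_(i < d) (P (vertex R (tnth w (fintype.lift ord0 i)))
                   - P (vertex R (tnth w ord0))).

Definition positive_normal (t : {set V}) (m : 'rV[R]_d.+1) : Prop :=
  [/\ enorm m = 1, orthogonal_to t m
    & forall w : d.+1.-tuple V, [set v in w] = t -> o w ->
        0 < \det (col_mx m (edge_matrix w) : 'M[R]_d.+1)].

(* The quarter turn in the positive direction maps m1 to n1, hence n1 to - m1,
   so the rotation by theta maps n1 to cos theta n1 - sin theta m1. *)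
Definition dihedral_angle_spec (s : {set V}) (theta : R) : Prop :=
  exists t1 t2 : {set V}, exists n1 n2 m1 : 'rV[R]_d.+1,
    [/\ [/\ t1 \in faces d K, t2 \in faces d K, t1 != t2,
            s \subset t1 & s \subset t2],
        inner_normal s t1 n1, inner_normal s t2 n2, positive_normal t1 m1
      & n2 = cos theta *: n1 - sin theta *: m1].

Definition dihedral_angle (s : {set V}) : circle (2 * pi : R) :=
  xget 0 [set to_circle (2 * pi) theta | theta in dihedral_angle_spec s].

Definition dehn_invariant : tensorZ R (circle (pi : R)) :=
  \sum_(s in faces d.-1 K)
    tens (simplex_vol [seq P (vertex R v) | v <- enum s] : R)
         (mod_pi (dihedral_angle s)).

End DehnInvariant.

(* Main.v *)
From HB Require Import structures.
Require Import Defs.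
From mathcomp Require Import all_boot all_order all_algebra all_fingroup.
From mathcomp Require Import generic_quotient ring_quotient complex.
From mathcomp Require Import all_classical all_reals all_analysis.
From mathcomp Require Import ring lra.

Set Implicit Arguments.
Unset Strict Implicit.
Unset Printing Implicit Defensive.

Import Order.TTheory GRing.Theory Num.Theory.
Import numFieldNormedType.Exports.

Local Open Scope classical_set_scope.
Local Open Scope ring_scope.
Local Open Scope quotient_scope.

(** Write the volumes of the ridges, which do not depend on t, as integral
combinations vol s = sum_j l_j c_sj of reals l_j that are linearly independent
over the integers ([integral_basis]). By bilinearity the Dehn invariant is the
sum over j of the tensors of l_j with sum_s c_sj phi_s ([dehn_invariant_basis]),
so it is enough that U_j = prod_s exp (i phi_s)^c_sj is constant for each j. The
cosine and the sine of phi_s are continuous in t ([hinge_continuous]), hence it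
is enough that U_j takes only finitely many values ([finite_values]).

Suppose that U_j takes infinitely many values. Then there is an ultrapower F of
the complex numbers, indexed by the parameter t, in which the class u of U_j is
transcendental ([transcendental_limit]). The coordinates of the unit normals
n_st of the ridges s in the facets t, those of the unit normals m_t of the
facets, and the cosines c_s and sines s_s of the angles become elements of F
that satisfy the same polynomial identities as for each t.

For any derivation D that kills the volumes, these identities imply Schlaefli's
formula sum_s vol s (c_s D s_s - s_s D c_s) = 0 ([schlafli]). Indeed
c_s D s_s - s_s D c_s, the derivative of the angle, is the sum of the products
of D n_st with m_t over the two facets t that contain s ([angle_derivative]),
and the sum of vol s n_st over the ridges s of a facet t vanishes
([minkowski]), so its derivative is orthogonal to m_t. In terms of
z_s = c_s + i s_s the formula reads sum_s vol s (D z_s / z_s) = 0.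

It remains to choose D. Adjoining the elements above to C(u) one at a time
yields a field with a derivation D over C and a C-linear residue into C that
takes integral values on all logarithmic derivatives D x / x and a nonzero value
on D u / u ([residue_tower]); it plays the part of a place at which u has a
zero or a pole. The residues w_s of D z_s / z_s are then integers with
sum_s vol s w_s = 0, whence sum_s c_sj w_s = 0 because the l_j are independent.
But u is the product of the z_s^c_sj, so this sum is the residue of D u / u, a
contradiction. *)

(** * Derivations and extensions of a field by one element *)

Section AdditiveMaps.
Variables (U W : zmodType) (f : U -> W).
Hypothesis fD : {morph f : x y / x + y}.
Lemma add_map0 : f 0 = 0.
Proof. by apply: (addrI (f 0)); rewrite -fD !addr0. Qed.
Lemma add_mapN x : f (- x) = - f x.
Proof. by apply/eqP; rewrite -addr_eq0 -fD addNr add_map0. Qed.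
Lemma add_mapMz x (k : int) : f (x *~ k) = f x *~ k.
Proof.
have nat n : f (x *+ n) = f x *+ n.
  by elim: n => [|n IH]; rewrite ?add_map0// !mulrS fD IH.
case: k => n; first exact: nat.
by rewrite NegzE !mulrNz add_mapN; congr (- _); exact: nat.
Qed.
Lemma add_map_sum (I : Type) (r : seq I) (Q : pred I) (g : I -> U) :
  f (\sum_(i <- r | Q i) g i) = \sum_(i <- r | Q i) f (g i).
Proof. exact: (big_morph f fD add_map0). Qed.
End AdditiveMaps.

Section Adjunction.
Variables (E F : fieldType) (i : {rmorphism E -> F}) (y : F).
Implicit Types p q : {poly E}.

Definition peval p : F := (map_poly i p).[y].

Lemma pevalD p q : peval (p + q) = peval p + peval q.
Proof. by rewrite /peval rmorphD hornerD. Qed.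
Lemma pevalB p q : peval (p - q) = peval p - peval q.
Proof. by rewrite /peval rmorphB hornerD hornerN. Qed.
Lemma pevalM p q : peval (p * q) = peval p * peval q.
Proof. by rewrite /peval rmorphM hornerM. Qed.
Lemma pevalMn p n : peval (p *+ n) = peval p *+ n.
Proof. by rewrite /peval rmorphMn hornerMn. Qed.
Lemma pevalC a : peval a%:P = i a.
Proof. by rewrite /peval map_polyC hornerC. Qed.
Lemma pevalX : peval 'X = y.
Proof. by rewrite /peval map_polyX hornerX. Qed.
Lemma peval0 : peval 0 = 0.
Proof. by rewrite -[0]polyC0 pevalC rmorph0. Qed.
Lemma peval1 : peval 1 = 1.
Proof. by rewrite -[1]polyC1 pevalC rmorph1. Qed.

(** The subfield i(E)(y) of F, first as a set and then as a type, so that there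
are polynomials and matrices over it. *)
Definition adjoined : {pred F} := fun x =>
  `[< exists p q, peval q != 0 /\ x = peval p / peval q >].

Lemma adjoinedP x :
  reflect (exists p q, peval q != 0 /\ x = peval p / peval q) (x \in adjoined).
Proof. exact: asboolP. Qed.

Lemma adjoined_closed : divring_closed adjoined.
Proof.
split.
- by apply/adjoinedP; exists 1, 1; rewrite peval1 oner_eq0 divr1.
- move=> _ _ /adjoinedP[p1 [q1 [q1N ->]]] /adjoinedP[p2 [q2 [q2N ->]]].
  apply/adjoinedP; exists (p1 * q2 - p2 * q1), (q1 * q2).
  by rewrite pevalB !pevalM mulf_neq0//; split=> //; field; rewrite q1N q2N.
move=> _ _ /adjoinedP[p1 [q1 [q1N ->]]] /adjoinedP[p2 [q2 [q2N ->]]].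
have [p20|p2N] := eqVneq (peval p2) 0.
  apply/adjoinedP; exists 0, 1; rewrite p20 peval0 peval1 oner_eq0 !mul0r.
  by rewrite invr0 mulr0.
apply/adjoinedP; exists (p1 * q2), (q1 * p2).
by rewrite !pevalM mulf_neq0//; split=> //; field; rewrite q1N q2N p2N.
Qed.

HB.instance Definition _ := GRing.isDivringClosed.Build F adjoined adjoined_closed.

Record adjunction := Adjunction { adj_val : F; adj_valP : adj_val \in adjoined }.

HB.instance Definition _ := [isSub for adj_val].
HB.instance Definition _ := [Choice of adjunction by <:].
HB.instance Definition _ := [SubChoice_isSubIntegralDomain of adjunction by <:].
HB.instance Definition _ := [SubIntegralDomain_isSubField of adjunction by <:].
End Adjunction.

Definition derivation (E : nzRingType) (D : E -> E) : Prop :=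
  {morph D : x y / x + y} /\ forall x y, D (x * y) = D x * y + x * D y.

Section DerivationTheory.
Variables (E : fieldType) (D : E -> E).
Hypothesis HD : derivation D.

Lemma drvD x y : D (x + y) = D x + D y. Proof. exact: HD.1. Qed.
Lemma drvM x y : D (x * y) = D x * y + x * D y. Proof. exact: HD.2. Qed.
Lemma drv0 : D 0 = 0. Proof. exact: add_map0 HD.1. Qed.
Lemma drvN x : D (- x) = - D x. Proof. exact: (add_mapN HD.1). Qed.
Lemma drvB x y : D (x - y) = D x - D y. Proof. by rewrite drvD drvN. Qed.
Lemma drv_sum (I : Type) (r : seq I) (P : pred I) (f : I -> E) :
  D (\sum_(i <- r | P i) f i) = \sum_(i <- r | P i) D (f i).
Proof. exact: (add_map_sum HD.1). Qed.
Lemma drv1 : D 1 = 0.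
Proof.
by apply: (addrI (D 1)); have := drvM 1 1; rewrite !mulr1 mul1r addr0 => <-.
Qed.
Definition dlog x := D x / x.

Lemma dlogM x y : x != 0 -> y != 0 -> dlog (x * y) = dlog x + dlog y.
Proof. by move=> x0 y0; rewrite /dlog drvM; field; rewrite x0 y0. Qed.
Lemma dlog1 : dlog 1 = 0. Proof. by rewrite /dlog drv1 mul0r. Qed.
Lemma dlogV x : x != 0 -> dlog x^-1 = - dlog x.
Proof.
move=> x0; apply/eqP; rewrite -addr_eq0 -dlogM ?invr_eq0// mulVf//.
by rewrite dlog1.
Qed.
Lemma dlogX x n : x != 0 -> dlog (x ^+ n) = dlog x *+ n.
Proof.
move=> x0; elim: n => [|n IH]; first by rewrite expr0 dlog1.
by rewrite exprS dlogM ?expf_neq0// IH mulrS.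
Qed.
Lemma dlogXz x (n : int) : x != 0 -> dlog (x ^ n) = dlog x *~ n.
Proof.
move=> x0; case: n => n; first exact: dlogX.
by rewrite [x ^ _]/(x ^- n.+1) dlogV ?expf_neq0// dlogX.
Qed.
Lemma dlog_prod (I : finType) (P : pred I) (f : I -> E) (n : I -> int) :
  (forall i, P i -> f i != 0) ->
  dlog (\prod_(i | P i) f i ^ n i) = \sum_(i | P i) dlog (f i) *~ n i.
Proof.
move=> f0; suff [] : \prod_(i | P i) f i ^ n i != 0 /\
  dlog (\prod_(i | P i) f i ^ n i) = \sum_(i | P i) dlog (f i) *~ n i by [].
elim/big_rec2: _ => [|i s x Pi [x0 <-]]; first by rewrite oner_eq0 dlog1.
by rewrite mulf_neq0 ?dlogM ?dlogXz ?expfz_neq0 ?f0.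
Qed.

Lemma drv_prod n (f : 'I_n -> E) :
  D (\prod_i f i) = \sum_i \prod_j (if j == i then D (f j) else f j).
Proof.
elim: n f => [|n IH] f; first by rewrite !big_ord0 drv1.
rewrite big_ord_recl drvM IH big_ord_recl mulr_sumr; congr (_ + _).
  by rewrite big_ord_recl eqxx; congr (_ * _); apply: eq_bigr.
apply: eq_bigr => i _; rewrite big_ord_recl; congr (_ * _).
Qed.

(** Jacobi's formula. By the Leibniz rule the derivative of the determinant is the
sum over i of the determinants of A with row i differentiated, and each of these
is expanded along row i. *)
Lemma drv_det n (A : 'M[E]_n) : D (\det A) = \tr (map_mx D A *m \adj A).
Proof.
pose B i : 'M[E]_n := \matrix_(k, j) if k == i then D (A k j) else A k j.
have -> : D (\det A) = \sum_i \det (B i).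
  rewrite {1}/determinant drv_sum exchange_big /=; apply: eq_bigr => s _.
  have -> : D ((-1) ^+ s * \prod_i A i (s i)) = (-1) ^+ s * D (\prod_i A i (s i)).
    by case: (s : bool); rewrite ?expr0 ?expr1 ?mul1r ?mulN1r ?drvN.
  rewrite drv_prod mulr_sumr; apply: eq_bigr => i _; congr (_ * _).
  by apply: eq_bigr => j _; rewrite mxE.
apply: eq_bigr => i _; rewrite (expand_det_row _ i) mxE; apply: eq_bigr => j _.
rewrite !mxE eqxx; congr (_ * _); rewrite /cofactor; congr (_ * \det _).
by apply/matrixP=> k l; rewrite !mxE eq_sym (negbTE (neq_lift _ _)).
Qed.

Lemma dlog_det n (A : 'M[E]_n) : \det A != 0 ->
  dlog (\det A) = \tr (map_mx D A *m invmx A).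
Proof.
move=> A0; rewrite /dlog drv_det /invmx unitmxE unitfE A0.
by rewrite -scalemxAr mxtraceZ mulrC.
Qed.

End DerivationTheory.

Section DerivationExtension.
Variables (E F : fieldType) (i : {rmorphism E -> F}) (y : F).
Variables (D : E -> E) (HD : derivation D) (w : F).
Hypothesis w_adj : w \in adjoined i y.
Implicit Types p q : {poly E}.
Local Notation peval := (peval i y).

Lemma coef_mapD p j : (map_poly D p)`_j = D p`_j.
Proof. by rewrite coef_map_id0// (drv0 HD). Qed.

(** The value at p(y) of the derivation that extends D and maps y to w. *)
Definition dpeval p : F := peval (map_poly D p) + peval p^`() * w.

Lemma dpevalD p q : dpeval (p + q) = dpeval p + dpeval q.
Proof.
rewrite /dpeval derivD !pevalD.
have -> : map_poly D (p + q) = map_poly D p + map_poly D q.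
  by apply/polyP=> j; rewrite coefD !coef_mapD coefD (drvD HD).
by rewrite pevalD; ring.
Qed.

Lemma dpevalN p : dpeval (- p) = - dpeval p.
Proof.
apply/eqP; rewrite -addr_eq0 -dpevalD addNr /dpeval map_poly0 linear0 !peval0.
by rewrite mul0r addr0.
Qed.

Lemma dpevalM p q : dpeval (p * q) = dpeval p * peval q + peval p * dpeval q.
Proof.
rewrite /dpeval derivM pevalD !pevalM.
have -> : map_poly D (p * q) = map_poly D p * q + p * map_poly D q.
  apply/polyP=> j; rewrite coefD !coef_mapD !coefM (drv_sum HD) -big_split/=.
  by apply: eq_bigr => k _; rewrite !coef_mapD (drvM HD).
by rewrite pevalD !pevalM; ring.
Qed.

Lemma dpevalC a : dpeval a%:P = i (D a).
Proof.
rewrite /dpeval derivC peval0 mul0r addr0.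
have -> : map_poly D a%:P = (D a)%:P; last exact: pevalC.
by apply/polyP=> j; rewrite coef_mapD !coefC; case: ifP; rewrite ?(drv0 HD).
Qed.

Hypothesis dpeval_wd : forall p, peval p = 0 -> dpeval p = 0.

Lemma dpeval_frac p1 q1 p2 q2 : peval q1 != 0 -> peval q2 != 0 ->
  peval p1 / peval q1 = peval p2 / peval q2 ->
  (dpeval p1 - peval p1 / peval q1 * dpeval q1) / peval q1 =
  (dpeval p2 - peval p2 / peval q2 * dpeval q2) / peval q2.
Proof.
move=> q10 q20 e; set x := peval p1 / peval q1 in e *; rewrite -e.
have e1 : peval p1 = x * peval q1 by rewrite /x divfK.
have e2 : peval p2 = x * peval q2 by rewrite e divfK.
have /dpeval_wd : peval (p1 * q2 - p2 * q1) = 0.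
  by rewrite pevalB !pevalM e1 e2; ring.
rewrite dpevalD dpevalN !dpevalM e1 e2 => e3.
apply/eqP; rewrite eqr_div// -subr_eq0; apply/eqP; rewrite -[RHS]e3; ring.
Qed.

Lemma dpeval_adj p : dpeval p \in adjoined i y.
Proof.
rewrite rpredD ?rpredM//; apply/adjoinedP.
  by exists (map_poly D p), 1; rewrite peval1 oner_eq0 divr1.
by exists p^`(), 1; rewrite peval1 oner_eq0 divr1.
Qed.

Lemma peval_adj p : peval p \in adjoined i y.
Proof. by apply/adjoinedP; exists p, 1; rewrite peval1 oner_eq0 divr1. Qed.

(** The value w may be prescribed at y as soon as it respects the algebraic relations
of y over E; the quotient rule then defines the derivation on all fractions. *)
Lemma derivation_extension : exists2 D' : adjunction i y -> adjunction i y,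
  derivation D' & forall x p q, peval q != 0 -> val x = peval p / peval q ->
    val (D' x) = (dpeval p - peval p / peval q * dpeval q) / peval q.
Proof.
have ex (x : adjunction i y) : exists x' : adjunction i y,
    forall p q, peval q != 0 -> val x = peval p / peval q ->
    val x' = (dpeval p - peval p / peval q * dpeval q) / peval q.
  have /adjoinedP[p0 [q0 [q00 e0]]] := valP x.
  have dx : (dpeval p0 - peval p0 / peval q0 * dpeval q0) / peval q0 \in adjoined i y.
    by rewrite rpred_div ?rpredB ?rpredM ?rpredV ?peval_adj ?dpeval_adj.
  exists (Adjunction dx) => p q q0' e.
  by apply: dpeval_frac; rewrite -?e0 -?e.
have [D' HD'] := choice ex; exists D' => //; split=> x z.
  have /adjoinedP[p1 [q1 [q10 e1]]] := valP x.
  have /adjoinedP[p2 [q2 [q20 e2]]] := valP z.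
  apply: val_inj; rewrite /= (HD' _ _ _ q10 e1) (HD' _ _ _ q20 e2).
  have q12 : peval (q1 * q2) != 0 by rewrite pevalM mulf_neq0.
  rewrite (HD' _ (p1 * q2 + p2 * q1) _ q12); last first.
    by rewrite /= e1 e2 pevalD !pevalM; field; rewrite q10 q20.
  by rewrite dpevalD !dpevalM pevalD !pevalM; field; rewrite q10 q20.
have /adjoinedP[p1 [q1 [q10 e1]]] := valP x.
have /adjoinedP[p2 [q2 [q20 e2]]] := valP z.
apply: val_inj; rewrite /= (HD' _ _ _ q10 e1) (HD' _ _ _ q20 e2).
have q12 : peval (q1 * q2) != 0 by rewrite pevalM mulf_neq0.
rewrite (HD' _ (p1 * p2) _ q12); last first.
  by rewrite /= e1 e2 !pevalM; field; rewrite q10 q20.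
by rewrite !dpevalM !pevalM e1 e2; field; rewrite q10 q20.
Qed.
End DerivationExtension.

Section TraceForm.
Variables (E L : fieldType) (j : {rmorphism E -> L}) (D : E -> E) (D' : L -> L).
Hypotheses (HD : derivation D) (HD' : derivation D').
Hypothesis D'j : forall a, D' (j a) = j (D a).
Variables (m : nat) (Y : 'cV[L]_m).
Hypothesis span : forall x : L, exists r : 'rV[E]_m, x = (map_mx j r *m Y) 0 0.
Hypothesis inj : forall a (A B : 'M[E]_(a, m)),
  map_mx j A *m Y = map_mx j B *m Y -> A = B.

(** Here M x is the matrix of the multiplication by x in the basis Y of L over E.
Differentiating x Y shows that M (D' x) differs from the matrix of derivatives
of the entries of M x by a commutator of M x with the matrix of D' on Y. Hence
the trace of D' x / x is the logarithmic derivative of the norm of x. *)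
Lemma trace_form : exists M : L -> 'M[E]_m,
  [/\ {morph M : x y / x + y}, forall a x, M (j a * x) = a *: M x,
      forall x, x != 0 -> exists2 e, e != 0 & \tr (M (dlog D' x)) = dlog D e
    & forall a, M (j a) = a%:M].
Proof.
have spanc (Z : 'cV[L]_m) : exists A : 'M[E]_m, Z = map_mx j A *m Y.
  have /choice[f fE] : forall i, exists r : 'rV[E]_m, Z i 0 = (map_mx j r *m Y) 0 0.
    by move=> i; exact: span.
  exists (\matrix_i f i); apply/colP => i; rewrite fE !mxE; apply: eq_bigr => l _.
  by rewrite !mxE.
have /choice[M ME] : forall x : L, exists A : 'M[E]_m, x *: Y = map_mx j A *m Y.
  by move=> x; exact: spanc.
have [T TE] := spanc (map_mx D' Y).
have MC a : M (j a) = a%:M.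
  by apply: inj; rewrite -ME map_scalar_mx mul_scalar_mx.
have MD : {morph M : x y / x + y}.
  by move=> x y; apply: inj; rewrite -ME map_mxD mulmxDl -!ME scalerDl.
have MM x y : M (x * y) = M y *m M x.
  apply: inj; rewrite -ME map_mxM -mulmxA -ME -scalemxAr -ME scalerA.
  by [].
exists M; split=> //.
  by move=> a x; rewrite mulrC MM MC mul_scalar_mx.
move=> x x0.
have MxV : M x *m M x^-1 = 1%:M by rewrite -MM mulVf// -(rmorph1 j) MC.
have [Mu MVu] := mulmx1_unit MxV.
have MVE : M x^-1 = invmx (M x) by rewrite -[RHS]mulmx1 -MxV mulKmx.
have DE (A : 'M[E]_m) : map_mx D' (map_mx j A *m Y) =
    map_mx j (map_mx D A + A *m T) *m Y.
  rewrite map_mxD mulmxDl map_mxM -mulmxA -TE; apply/colP => i; rewrite !mxE.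
  rewrite (drv_sum HD') -big_split/=; apply: eq_bigr => l _.
  by rewrite !mxE (drvM HD') D'j.
have key : M (D' x) + T *m M x = map_mx D (M x) + M x *m T.
  apply: inj; rewrite -DE -ME map_mxD mulmxDl -ME map_mxM -mulmxA -ME -scalemxAr.
  by rewrite -TE; apply/colP => i; rewrite !mxE (drvM HD').
exists (\det (M x)); first by rewrite -unitfE -unitmxE.
rewrite (dlog_det HD) -?unitfE -?unitmxE// /dlog mulrC MM MVE.
move/(canRL (addrK _)): key => ->.
rewrite mulmxBl mulmxDl !raddfB /= !raddfD /=.
rewrite [\tr (M x *m T *m _)]mxtrace_mulC mulmxA mulVmx// mul1mx.
by rewrite mulmxK// addrK.
Qed.
End TraceForm.

(** * Fields with a derivation and a residue *)

(** The model is a field of algebraic functions of one variable over k with a place: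
the residue of D x / x at a place is the order of x there, an integer. The
record keeps the part of this structure that is easily transported along field
extensions, namely by coefficient extraction and by the trace. *)
Record logres (k F : fieldType) (c : {rmorphism k -> F}) := LogRes {
  lr_field :> fieldType;
  lr_in : {rmorphism lr_field -> F};
  lr_cst : {rmorphism k -> lr_field};
  lr_D : lr_field -> lr_field;
  lr_res : lr_field -> k;
  lr_in_cst : forall a, lr_in (lr_cst a) = c a;
  lr_derivation : derivation lr_D;
  lr_Dcst : forall a, lr_D (lr_cst a) = 0;
  lr_resD : {morph lr_res : x y / x + y};
  lr_resZ : forall a x, lr_res (lr_cst a * x) = a * lr_res x;
  lr_res_int : forall x, x != 0 -> exists z : int, lr_res (dlog lr_D x) = z%:~R
}.

Section LogRes.
Variables (k F : fieldType) (c : {rmorphism k -> F}).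
Implicit Types L : logres c.

(** In an algebraic extension the factor m is the degree, since the trace of an element of
the smaller field is m times this element. *)
Definition lr_extends L L' := forall x : L, exists2 x' : L',
  lr_in L' x' = lr_in L x & exists2 m : nat, m != 0 & x != 0 ->
  lr_res (dlog (lr_D (l:=L')) x') = lr_res (dlog (lr_D (l:=L)) x) *+ m.

Section Adjoin.
Variables (L : logres c) (y : F).
Local Notation D := (@lr_D _ _ _ L).
Local Notation res := (@lr_res _ _ _ L).
Local Notation i := (lr_in L).
Local Notation peval := (peval i y).
Local Notation L' := (adjunction i y).
Let HD : derivation D := @lr_derivation _ _ _ L.
Implicit Types p q : {poly L}.

Lemma lr_res0 : res 0 = 0. Proof. exact: add_map0 (@lr_resD _ _ _ L). Qed.
Lemma lr_res_intr x (n : int) : res (x *~ n) = res x *~ n.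
Proof. exact: (add_mapMz (@lr_resD _ _ _ L)). Qed.
Lemma lr_res_natr x n : res (x *+ n) = res x *+ n. Proof. exact: (lr_res_intr x n). Qed.

Definition adj_poly p : L' := Adjunction (peval_adj i y p).

Definition adj_const (a : L) : L' := adj_poly a%:P.
Fact adj_const_zmod_morphism : {morph adj_const : x y / x - y}.
Proof. by move=> a b; apply: val_inj; rewrite /= !pevalC !rmorphB. Qed.
Fact adj_const_monoid_morphism : (adj_const 1 = 1) * {morph adj_const : x y / x * y}.
Proof. by split=> [|a b]; apply: val_inj; rewrite /= !pevalC ?rmorphM ?rmorph1. Qed.
HB.instance Definition _ :=
  GRing.isZmodMorphism.Build _ _ adj_const adj_const_zmod_morphism.
HB.instance Definition _ :=
  GRing.isMonoidMorphism.Build _ _ adj_const adj_const_monoid_morphism.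

Lemma adjoin_data (D' : L' -> L') (res' : L' -> k) : derivation D' ->
  (forall a, D' (adj_const (lr_cst L a)) = 0) ->
  {morph res' : x y / x + y} ->
  (forall a x, res' (adj_const (lr_cst L a) * x) = a * res' x) ->
  (forall x, x != 0 -> exists z : int, res' (dlog D' x) = z%:~R) ->
  (forall x : L, exists2 m : nat, m != 0 & x != 0 ->
     res' (dlog D' (adj_const x)) = res (dlog D x) *+ m) ->
  exists2 L1 : logres c, lr_extends L L1 & exists2 y' : L1, lr_in L1 y' = y &
    lr_res (dlog (lr_D (l:=L1)) y') = res' (dlog D' (adj_poly 'X)).
Proof.
move=> dD' D'c res'D res'Z res'int ext.
pose emb : {rmorphism k -> L'} := adj_const \o lr_cst L.
unshelve eexists (@LogRes _ _ c L' (val : {rmorphism L' -> F}) emb D' res' _ dD' _ res'D _ _) => //.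
- by move=> a; rewrite /= pevalC lr_in_cst.
- by move=> x; exists (adj_poly x%:P); [rewrite /= pevalC | exact: ext].
by exists (adj_poly 'X) => //=; rewrite pevalX.
Qed.

Lemma adj_polyD p q : adj_poly (p + q) = adj_poly p + adj_poly q.
Proof. by apply: val_inj; rewrite /= pevalD. Qed.
Lemma adj_polyM p q : adj_poly (p * q) = adj_poly p * adj_poly q.
Proof. by apply: val_inj; rewrite /= pevalM. Qed.
Lemma adj_poly0 : adj_poly 0 = 0.
Proof. by apply: val_inj; rewrite /= peval0. Qed.
Lemma adj_poly_eq0 p : (adj_poly p == 0) = (peval p == 0).
Proof. by rewrite -(inj_eq val_inj). Qed.

Lemma adj_frac (x : L') : exists p q, peval q != 0 /\ x = adj_poly p / adj_poly q.
Proof.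
have /adjoinedP[p [q [q0 e]]] := valP x.
by exists p, q; split=> //; apply: val_inj.
Qed.

(** For y transcendental put D y = eps y, and let the residue of p / q be the residue
of the coefficient of y^0 in its expansion at infinity, that is, of the constant
coefficient of the polynomial part of p / q. As D p has at most the degree of p,
the polynomial part of D p / p is the constant dlog (lead_coef p) + eps deg p,
and its residue is an integer. The residue of dlog y is eps times that of 1. *)
Lemma transcendental_step (eps : nat) :
  (forall p, peval p = 0 -> p = 0) ->
  (exists z : int, res 1 *+ eps = z%:~R) ->
  exists2 L1 : logres c, lr_extends L L1 & exists2 y' : L1, lr_in L1 y' = y &
    lr_res (dlog (lr_D (l:=L1)) y') = res 1 *+ eps.
Proof.
move=> tr [z0 z0E].
have pN0 p : p != 0 -> peval p != 0 by apply: contra_neq; exact: tr.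
have aN0 p : p != 0 -> adj_poly p != 0 by rewrite adj_poly_eq0; exact: pN0.
have nz q : peval q != 0 -> q != 0 by apply: contra_neq => ->; rewrite peval0.
have w_adj : y *+ eps \in adjoined i y.
  by rewrite rpredMn// -[y in y \in _](pevalX i) peval_adj.
have [|D' dD' D'E] := derivation_extension HD w_adj.
  by move=> p /tr ->; rewrite /dpeval map_poly0 linear0 peval0 mul0r addr0.
pose pd p : {poly L} := map_poly D p + ('X * p^`()) *+ eps.
have D'of p : D' (adj_poly p) = adj_poly (pd p).
  apply: val_inj; rewrite (D'E _ p 1) /= ?peval1 ?oner_eq0 ?divr1//.
  rewrite -[X in _ * dpeval _ _ _ _ X]polyC1 dpevalC// (drv1 HD) rmorph0 mulr0 subr0.
  rewrite /dpeval /pd pevalD; congr (_ + _).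
  by rewrite pevalMn pevalM pevalX [y * _]mulrC mulrnAr.
have [res' res'E] : exists res' : L' -> k, forall p q, peval q != 0 ->
    res' (adj_poly p / adj_poly q) = res (p %/ q)`_0.
  suff /choice[r rE] : forall x : L', exists r, forall p q, peval q != 0 ->
      x = adj_poly p / adj_poly q -> r = res (p %/ q)`_0.
    by exists r => p q q0; exact: rE q0 erefl.
  move=> x; have [p [q [q0 ->]]] := adj_frac x.
  exists (res (p %/ q)`_0) => p1 q1 q10 /eqP.
  rewrite eqr_div ?adj_poly_eq0// -!adj_polyM => /eqP/(congr1 val)/= /eqP.
  rewrite -subr_eq0 -pevalB => /eqP/tr/eqP; rewrite subr_eq0 => /eqP e.
  rewrite -(@divp_pmul2r _ q1 q p) ?nz// e.
  by rewrite (mulrC q) divp_pmul2r ?nz.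
have res'D : {morph res' : x y / x + y}.
  move=> x1 x2; have [p1 [q1 [q10 ->]]] := adj_frac x1.
  have [p2 [q2 [q20 ->]]] := adj_frac x2.
  rewrite !res'E// addf_div ?adj_poly_eq0// -!adj_polyM -adj_polyD res'E; last first.
    by rewrite pevalM mulf_neq0.
  rewrite divpD coefD lr_resD divp_pmul2r ?nz//.
  by rewrite [q1 * q2]mulrC divp_pmul2r ?nz.
have res'int p : p != 0 -> exists z : int, res' (dlog D' (adj_poly p)) = z%:~R.
  move=> p0; rewrite /dlog D'of res'E ?pN0//.
  set l := lead_coef p; have l0 : l != 0 by rewrite lead_coef_eq0.
  set n := (size p).-1; have sp : size p = n.+1 by rewrite /n polySpred.
  pose e : L := dlog D l + (n * eps)%:R.
  (* the leading terms of pd p and of e p agree *)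
  have szpd : (size (pd p - e *: p)%R < size p)%N.
    rewrite sp ltnS; apply/leq_sizeP => j; rewrite leq_eqVlt => /orP[/eqP<-|nj].
      rewrite coefB coefZ coefD coef_mapD// coefMn coefXM coef_deriv.
      rewrite -[p`_n]/l /e /dlog mulrDl divfK// mulr_natl mulrnA.
      have -> : (if n == 0 then 0 else p`_n.-1.+1 *+ n.-1.+1) = l *+ n.
        by rewrite /l lead_coefE -/n; case: (n).
      by rewrite subrr.
    rewrite coefB coefZ coefD coef_mapD// coefMn coefXM coef_deriv.
    have pj0 m : (n < m)%N -> p`_m = 0 by move=> nm; rewrite nth_default// sp.
    rewrite pj0// (drv0 HD) mulr0 subr0 add0r.
    by case: (j) nj => [|j'] //= nj; rewrite ?pj0// !mul0rn.
  have -> : pd p = e%:P * p + (pd p - e *: p).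
    by rewrite mul_polyC addrC subrK.
  rewrite divp_addl_mul_small// coefC /= lr_resD lr_res_natr.
  have [z1 ->] := lr_res_int l0.
  by exists (z1 + z0 *+ n); rewrite mulnC mulrnA z0E rmorphD rmorphMn.
have [||||L1 ext1 [y' y'E resy']] := @adjoin_data D' res' dD' _ res'D.
- move=> a; rewrite [D' _]D'of; apply: val_inj; rewrite /= /pd derivC mulr0 mul0rn addr0.
  have -> : map_poly D (lr_cst L a)%:P = 0; last by rewrite peval0.
  apply/polyP=> j; rewrite coef_mapD// coefC coef0.
  by case: ifP; rewrite ?lr_Dcst// (drv0 HD).
- move=> a x; have [p [q [q0 ->]]] := adj_frac x.
  by rewrite mulrA -[adj_const _ * _]adj_polyM !res'E// mul_polyC divpZl coefZ lr_resZ.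
- move=> x; have [p [q [q0 ->]]] := adj_frac x => x0.
  have p0 : p != 0 by apply: contra_neq x0 => ->; rewrite adj_poly0 mul0r.
  have qN0 := nz _ q0.
  rewrite (dlogM dD') ?invr_eq0 ?aN0// (dlogV dD') ?aN0// res'D.
  have [z1 z1E] := res'int _ p0; have [z2 z2E] := res'int _ (nz _ q0).
  exists (z1 - z2); rewrite z1E intrD rmorphN /= -z2E; congr (_ + _).
  apply/eqP; rewrite -addr_eq0 -res'D addNr; apply/eqP.
  by apply: (addrI (res' 0)); rewrite -res'D !addr0.
- move=> x; exists 1%N => // x0; have xP0 : x%:P != 0 by rewrite polyC_eq0.
  rewrite mulr1n /dlog [D' _]D'of [LHS]res'E ?pN0//.
  have -> : pd x%:P = (D x / x)%:P * x%:P.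
    rewrite -polyCM divfK// /pd derivC mulr0 mul0rn addr0; apply/polyP=> j.
    by rewrite coef_mapD// !coefC; case: ifP; rewrite // (drv0 HD).
  by rewrite mulpK// coefC.
exists L1 => //; exists y' => //; rewrite resy' /dlog D'of.
have -> : pd 'X = eps%:R%:P * 'X.
  rewrite /pd derivX mulr1 polyCMn mulr_natl; apply/polyP=> j.
  rewrite coefD coef_mapD// coefX; case: (j == 1%N).
    by rewrite (drv1 HD) add0r.
  by rewrite (drv0 HD) add0r.
by rewrite res'E ?pN0 ?polyX_eq0// mulpK ?polyX_eq0// coefC lr_res_natr.
Qed.

Lemma minimal_poly p0 : p0 != 0 -> peval p0 = 0 -> exists P : {poly L},
  [/\ (1 < size P)%N, peval P = 0 & forall p, peval p = 0 -> P %| p].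
Proof.
move=> p0N p0y.
have ex : exists n, `[< exists p : {poly L}, [/\ p != 0, peval p = 0 & size p = n] >].
  by exists (size p0); apply/asboolP; exists p0.
case: (ex_minnP ex) => _ /asboolP[P [P0 Py <-]] Pmin; exists P.
have Pdiv p : peval p = 0 -> P %| p.
  move=> py; rewrite /dvdp; apply/negPn/negP => r0.
  have /Pmin : `[< exists q : {poly L}, [/\ q != 0, peval q = 0 & size q = size (p %% P)] >].
    apply/asboolP; exists (p %% P); split=> //.
    by move: py; rewrite {1}(divp_eq p P) pevalD pevalM Py mulr0 add0r.
  by rewrite leqNgt ltn_modp P0.
split=> //; rewrite ltnNge; apply/negP => /size1_polyC Pc.
move: Py P0; rewrite Pc pevalC => /eqP; rewrite fmorph_eq0 => /eqP ->.
by rewrite polyC0 eqxx.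
Qed.

(** For y algebraic the derivation extends by D y = - P^D(y) / P'(y), where P is the
minimal polynomial of y and P^D is obtained by differentiating its coefficients;
P'(y) is nonzero in characteristic zero. The residue is composed with the
trace. *)
Lemma algebraic_step p0 : (forall n, n.+1%:R != 0 :> k) ->
  p0 != 0 -> peval p0 = 0 ->
  exists2 L1 : logres c, lr_extends L L1 & exists y' : L1, lr_in L1 y' = y.
Proof.
move=> char0 p0N p0y; have [P [szP Py Pdiv]] := minimal_poly p0N p0y.
have P0 : P != 0 by rewrite -size_poly_gt0 ltnW.
have small p : peval p = 0 -> (size p < size P)%N -> p = 0.
  move=> /Pdiv Pp sp; apply/eqP/negPn/negP => pN.
  by have := dvdp_leq pN Pp; rewrite leqNgt sp.
have P'y : peval P^`() != 0.
  apply/eqP => /small -/(_ (lt_size_deriv P0)) /polyP /(_ (size P).-2).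
  rewrite coef_deriv coef0; have := szP; case sz: (size P) => [|[|s]] // _ /=.
  have -> : P`_s.+1 = lead_coef P by rewrite lead_coefE sz.
  move/eqP; rewrite -mulr_natr mulf_eq0 lead_coef_eq0 (negbTE P0) /=.
  by rewrite -(rmorph_nat (lr_cst L)) fmorph_eq0 (negbTE (char0 _)).
pose w : F := - peval (map_poly D P) / peval P^`().
have w_adj : w \in adjoined i y by rewrite rpred_div ?rpredN ?peval_adj.
have [|D' dD' D'E] := derivation_extension HD w_adj.
  move=> p /Pdiv; rewrite dvdp_eq => /eqP ->; rewrite dpevalM// Py mulr0 add0r.
  by rewrite /dpeval /w [_ * (_ / _)]mulrC divfK// addrN mulr0.
have D'inl a : D' (adj_const a) = adj_const (D a).
  apply: val_inj; rewrite (D'E _ a%:P 1) /= ?peval1 ?oner_eq0 ?divr1//.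
  rewrite -[X in _ * dpeval _ _ _ _ X]polyC1 !dpevalC// (drv1 HD) rmorph0.
  by rewrite mulr0 subr0 pevalC.
set m := (size P).-1; have szPm : size P = m.+1 by rewrite /m polySpred.
have m0 : m != 0 by rewrite /m -lt0n -ltnS prednK // ltnW.
pose Y : 'cV[L']_m := \col_(j < m) adj_poly 'X^j.
have smallE (s : {poly L}) : (size s <= m)%N -> adj_poly s = \sum_(j < m) adj_const s`_j * adj_poly 'X^j.
  move=> ss; have {1}-> : s = \poly_(j < m) s`_j.
    by apply/polyP=> j; rewrite coef_poly; case: ltnP => // mj; rewrite nth_default// (leq_trans ss).
  rewrite poly_def (big_morph adj_poly adj_polyD adj_poly0); apply: eq_bigr => j _.
  by rewrite -mul_polyC adj_polyM.
(* the powers of y below the degree of P span: q(y) is inverted by a Bezout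
   relation between q and P *)
have span (x : L') : exists r : 'rV[L]_m, x = (map_mx adj_const r *m Y) 0 0.
  suff [s ->] : exists s, x = adj_poly s.
    exists (\row_j (s %% P)`_j); rewrite mxE.
    have -> : adj_poly s = adj_poly (s %% P).
      by apply: val_inj; rewrite /= {1}(divp_eq s P) pevalD pevalM Py mulr0 add0r.
    rewrite smallE; last by rewrite -ltnS -szPm ltn_modp.
    by apply: eq_bigr => j _; rewrite !mxE.
  have [p [q [q0 ->]]] := adj_frac x.
  have [[u v] /= uvE] := Bezoutp q P; set g := gcdp q P in uvE.
  have gy0 : peval g != 0.
    apply: contra_neq q0 => gy; have := dvdp_gcdl q P; rewrite -/g dvdp_eq => /eqP ->.
    by rewrite pevalM gy mulr0.
  have /eqpP[[a b] /= /andP[a0 b0] abE] := uvE.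
  have gsz : size g = 1%N.
    have Pg := dvdp_gcdr q P; rewrite -/g in Pg.
    have e : P = P %/ g * g by rewrite divpK.
    have hy : peval (P %/ g) = 0.
      by have := Py; rewrite {1}e pevalM => /eqP; rewrite mulf_eq0 (negbTE gy0) orbF => /eqP.
    have h0 : P %/ g != 0 by apply: contra_neq P0 => h0; rewrite e h0 mul0r.
    have g0 : g != 0 by apply: contra_neq gy0 => ->; rewrite peval0.
    have := dvdp_leq h0 (Pdiv _ hy); rewrite size_divp//.
    move: g0 szP; rewrite -size_poly_gt0; move: (size g) (size P) => [|[|sg]] // sP _ sP1.
    by rewrite leqNgt ltn_subrL (ltnW sP1).
  have /size_poly1P[t t0 gE] : size g == 1%N by rewrite gsz.
  have qinv : peval u * peval q = i (a^-1 * b * t).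
    move/(congr1 (fun s => peval (a^-1 *: s))): abE.
    rewrite !scalerA mulVf// scale1r pevalD !pevalM Py mulr0 addr0 => ->.
    by rewrite gE -mul_polyC -polyCM pevalC.
  set tt := a^-1 * b * t in qinv.
  have tt0 : tt != 0 by rewrite !mulf_neq0 ?invr_eq0.
  exists (p * u * tt^-1%:P); apply: (mulIf (x := adj_poly q)); rewrite ?adj_poly_eq0//.
  rewrite divfK ?adj_poly_eq0//; apply: val_inj; rewrite /= !pevalM pevalC.
  rewrite -!mulrA [_ * peval q]mulrC [peval u * _]mulrA qinv -rmorphM mulfV//.
  by rewrite rmorph1 mulr1.
have inj a (A B : 'M[L]_(a, m)) :
    map_mx adj_const A *m Y = map_mx adj_const B *m Y -> A = B.
  move=> AB; apply/eqP; rewrite -subr_eq0; apply/eqP/matrixP => r j.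
  have szr : (size (rVpoly (row r (A - B))) <= m)%N by exact: size_poly.
  have : adj_poly (rVpoly (row r (A - B))) = 0.
    rewrite smallE//; transitivity ((map_mx adj_const (A - B) *m Y) r 0).
      by rewrite mxE; apply: eq_bigr => l _; rewrite coef_rVpoly_ord !mxE.
    by rewrite map_mxB mulmxBl AB subrr mxE.
  move/(congr1 val)/small; rewrite szPm ltnS => /(_ szr)/polyP/(_ j).
  by rewrite coef_rVpoly_ord mxE coef0 => ->; rewrite mxE.
have [M [MD MZ Mdlog MC]] := trace_form (HD : derivation D) dD' D'inl span inj.
have [|||||L1 ext1 [y' y'E _]] := @adjoin_data D' (fun x => res (\tr (M x))) dD'.
- by move=> a; rewrite D'inl lr_Dcst rmorph0.
- by move=> x z; rewrite MD mxtraceD lr_resD.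
- by move=> a x; rewrite MZ mxtraceZ lr_resZ.
- by move=> x /Mdlog[e e0 ->]; exact: lr_res_int.
- move=> x; exists m => // x0; rewrite /dlog D'inl.
  by rewrite -fmorphV -rmorphM MC mxtrace_scalar lr_res_natr.
by exists L1 => //; exists y'.
Qed.

End Adjoin.
End LogRes.

Section Tower.
Variables (k F : fieldType) (c : {rmorphism k -> F}).
Hypothesis char0 : forall n, n.+1%:R != 0 :> k.

Definition base_logres : logres c.
Proof.
unshelve eapply (@LogRes _ _ c k c idfun (fun _ => 0) id) => //.
- by split=> [x y|x y]; rewrite ?mul0r ?mulr0 addr0.
- by move=> x _; exists 0; rewrite /dlog mul0r.
Defined.

Lemma adjoin_step (L : logres c) (y : F) :
  exists2 L1 : logres c, lr_extends L L1 & exists y' : L1, lr_in L1 y' = y.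
Proof.
case: (pselect (exists p : {poly L}, p != 0 /\ peval (lr_in L) y p = 0)).
  by move=> [p [p0 py]]; exact: algebraic_step py.
move=> tr; have [||L1 ext [y' y'E _]] := @transcendental_step _ _ _ L y 0.
- by move=> p py; apply/eqP/negPn/negP => p0; apply: tr; exists p.
- by exists 0; rewrite mulr0n.
by exists L1 => //; exists y'.
Qed.

(** The tower starts with the zero derivation on k itself, to which u is adjoined
with D u = u, so that dlog u = 1. *)
Theorem residue_tower (u : F) (ys : seq F) :
  (forall p, peval c u p = 0 -> p = 0) ->
  exists2 L : logres c,
    (exists u' : L, lr_in L u' = u /\ lr_res (dlog (@lr_D _ _ _ L) u') != 0)
  & forall y, y \in ys -> exists x : L, lr_in L x = y.
Proof.
move=> utr; elim: ys => [|y ys [L [u' [u'E u'0]] IH]].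
  have [|L1 _ [y' y'E ry']] := @transcendental_step _ _ _ base_logres u 1 utr.
    by exists 1; rewrite mulr1n.
  exists L1 => //; exists y'; split=> //.
  by rewrite ry' oner_eq0.
have [L1 ext [y' y'E]] := adjoin_step L y; exists L1.
  have [u1 u1E [m m0 ru1]] := ext u'; exists u1.
  rewrite u1E; split=> //.
  rewrite ru1.
    by rewrite -mulr_natr mulf_neq0//; case: (m) m0.
  by apply: contra_neq u'0 => ->; rewrite /dlog invr0 mulr0 lr_res0.
move=> z; rewrite inE => /orP[/eqP->|/IH[x <-]]; first by exists y'.
by have [x1 x1E _] := ext x; exists x1.
Qed.
End Tower.

(** * Ultrapowers of a field *)

Section Ultrapower.
Variables (T : pointedType) (k : fieldType) (G : set_system T).
Context {GU : UltraFilter G}.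

Definition negligible_fun : {pred (T -> k)} := fun f => `[< G [set t | f t = 0] >].

Lemma negligible_funP (f : T -> k) :
  reflect (G [set t | f t = 0]) (f \in negligible_fun).
Proof. exact: asboolP. Qed.

Fact negligible_zmod_closed : zmod_closed negligible_fun.
Proof.
split; first by apply/negligible_funP; apply: filterE.
move=> f g /negligible_funP f0 /negligible_funP g0; apply/negligible_funP.
by apply: filterS2 f0 g0 => t /= f0 g0; rewrite !fctE f0 g0 subrr.
Qed.

Fact negligible_proper_ideal : 1 \notin negligible_fun /\
  forall f, {in negligible_fun, forall g, f * g \in negligible_fun}.
Proof.
split=> [|f g /negligible_funP g0].
  apply/negligible_funP => G0; have [t] := filter_ex G0.
  by move=> /eqP; rewrite oner_eq0.
by apply/negligible_funP; apply: filterS g0 => t /= g0; rewrite !fctE g0 mulr0.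
Qed.

HB.instance Definition _ :=
  GRing.isZmodClosed.Build (T -> k) negligible_fun negligible_zmod_closed.
HB.instance Definition _ :=
  isProperIdeal.Build (T -> k) negligible_fun negligible_proper_ideal.

(** The functions on T modulo equality on some set of G. This is a field: G contains
the zero set of f or its complement, so the pointwise inverse of f inverts the
class of f unless this class is zero. *)
Definition ultrapower := {ideal_quot negligible_fun}.
HB.instance Definition _ := GRing.ComNzRing.on ultrapower.
HB.instance Definition _ := Quotient.on ultrapower.
Definition to_ultra (f : T -> k) : ultrapower := \pi f.

Lemma to_ultraE f g : (to_ultra f = to_ultra g) <-> G [set t | f t = g t].
Proof.
rewrite (rwP eqP) -[to_ultra f == _]Quotient.idealrBE -(rwP (negligible_funP _)).
split; apply: filterS => t /=; rewrite !fctE => e; last by rewrite e subrr.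
by apply/eqP; rewrite -subr_eq0 e.
Qed.

Lemma to_ultra_zmod_morphism : {morph to_ultra : f g / f - g}.
Proof. by move=> f g; rewrite /to_ultra rmorphB. Qed.
Lemma to_ultra_monoid_morphism :
  (to_ultra 1 = 1) * {morph to_ultra : f g / f * g}.
Proof. by split=> [|f g]; rewrite /to_ultra ?rmorph1 ?rmorphM. Qed.
HB.instance Definition _ :=
  GRing.isZmodMorphism.Build _ _ to_ultra to_ultra_zmod_morphism.
HB.instance Definition _ :=
  GRing.isMonoidMorphism.Build _ _ to_ultra to_ultra_monoid_morphism.

Definition ultra_inv (x : ultrapower) := to_ultra (fun t => (repr x t)^-1).

Lemma ultra_mulVf : forall x, x != 0 -> ultra_inv x * x = 1.
Proof.
move=> x x0; rewrite -[X in _ * X]reprK -[\pi _]/(to_ultra _) -rmorphM.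
rewrite -(rmorph1 to_ultra) to_ultraE.
have [x0'|] := in_ultra_setVsetC [set t | repr x t = 0] GU.
  case/eqP: x0; rewrite -[x]reprK -[\pi _]/(to_ultra _) -(rmorph0 to_ultra).
  exact/to_ultraE.
by apply: filterS => t /= /eqP xt; rewrite /GRing.mul/= mulVf.
Qed.
Lemma ultra_inv0 : ultra_inv 0 = 0.
Proof.
rewrite -[RHS](rmorph0 to_ultra) to_ultraE.
have /to_ultraE : to_ultra (repr (0 : ultrapower)) = to_ultra 0.
  by rewrite /to_ultra reprK rmorph0.
by apply: filterS => t /= ->; rewrite invr0.
Qed.
HB.instance Definition _ :=
  GRing.ComNzRing_isField.Build ultrapower ultra_mulVf ultra_inv0.

End Ultrapower.

(** As U takes infinitely many values on S, the sets of points of S where U avoids a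
given finite set of values generate a proper filter. In the ultrapower along an
ultrafilter that contains it, the class of U is not a root of any nonzero
polynomial p over k, since U avoids the finitely many roots of p on a set of the
ultrafilter. *)
Lemma transcendental_limit (T : pointedType) (k : fieldType) (S : set T)
    (U : T -> k) : infinite_set (U @` S) ->
  exists (F : fieldType) (q : {rmorphism (T -> k) -> F}) (c : {rmorphism k -> F}),
  [/\ forall f g : T -> k, (forall t, S t -> f t = g t) -> q f = q g,
      forall a, c a = q (cst a)
    & forall p, peval c (q U) p = 0 -> p = 0].
Proof.
move=> Uinf.
pose F0 := filter_from [set B : set k | finite_set B]
             (fun B => [set t | S t /\ ~ B (U t)]).
have F0P : ProperFilter F0.
  apply: filter_from_proper.
    apply: filter_from_filter; first by exists set0; exact: finite_set0.
    move=> A B fA fB; exists (A `|` B); first by rewrite /= finite_setU.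
    by move=> t /= [St nAB]; split; split=> // h; apply: nAB; [left|right].
  move=> B fB; apply: contrapT => nB; apply: Uinf.
  apply: sub_finite_set fB => _ [t St <-]; apply: contrapT => h.
  by apply: nB; exists t.
have [G [GU F0G]] := ultraFilterLemma F0P.
pose q : {rmorphism (T -> k) -> @ultrapower T k G GU} := @to_ultra T k G GU.
have cstB : {morph (fun a => q (cst a)) : x y / x - y}.
  by move=> x y; rewrite -[RHS]rmorphB; congr (q _); apply/funext.
have cstM : (q (cst 1) = 1) * {morph (fun a => q (cst a)) : x y / x * y}.
  split=> [|x y]; first by rewrite -(rmorph1 q).
  by rewrite -[RHS]rmorphM; congr (q _); apply/funext.
pose cadd := GRing.isZmodMorphism.Build _ _ (fun a => q (cst a)) cstB.
pose cmul := GRing.isMonoidMorphism.Build _ _ (fun a => q (cst a)) cstM.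
pose c : {rmorphism k -> @ultrapower T k G GU} := HB.pack (fun a => q (cst a)) cadd cmul.
exists (@ultrapower T k G GU), q, c; split=> //.
  move=> f g fg; apply/to_ultraE; apply: F0G; exists set0; first exact: finite_set0.
  by move=> t [/fg].
move=> p; have -> : peval c (q U) p = q (fun t => p.[U t]).
  elim/poly_ind: p => [|p a IH].
    by rewrite peval0 -(rmorph0 q); congr (q _); apply/funext => t; rewrite horner0.
  rewrite pevalD pevalM pevalX pevalC IH /= -rmorphM -rmorphD; congr (q _).
  by apply/funext => t; rewrite !fctE hornerMXaddC.
rewrite -(rmorph0 q) => /to_ultraE pU; apply/eqP/negPn/negP => p0.
have fin : finite_set [set x | root p x].
  apply: contrapT => inf; have [B BP szB] := infinite_set_fset (size p) inf.
  case/eqP: p0; apply: (@roots_geq_poly_eq0 _ p (finmap.enum_fset B)) => //; last exact: finmap.fset_uniq.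
  by apply/allP => x xB; exact: BP.
have GN : G [set t | S t /\ ~ root p (U t)] by apply: F0G; exists [set x | root p x].
have [t [pUt [_ []]]] := filter_ex (filterI pU GN).
exact/rootP.
Qed.

(** * Schlaefli's formula *)

Section Dot.
Variables (R : comNzRingType) (N : nat).
Implicit Types u v w : 'rV[R]_N.
(** The scalar product [dotp] over an arbitrary commutative ring, as it is applied
to vectors over the function fields of the previous parts. *)
Definition rdot u v : R := \sum_j u 0 j * v 0 j.
Lemma rdotC u v : rdot u v = rdot v u.
Proof. by apply: eq_bigr => j _; rewrite mulrC. Qed.
Lemma rdotDl u v w : rdot (u + v) w = rdot u w + rdot v w.
Proof. by rewrite -big_split; apply: eq_bigr => j _; rewrite mxE mulrDl. Qed.
Lemma rdotZl a u w : rdot (a *: u) w = a * rdot u w.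
Proof. by rewrite mulr_sumr; apply: eq_bigr => j _; rewrite mxE mulrA. Qed.
Lemma rdotNl u w : rdot (- u) w = - rdot u w.
Proof. by rewrite -scaleN1r rdotZl mulN1r. Qed.
Lemma rdotBl u v w : rdot (u - v) w = rdot u w - rdot v w.
Proof. by rewrite rdotDl rdotNl. Qed.
Lemma rdotDr u v w : rdot u (v + w) = rdot u v + rdot u w.
Proof. by rewrite rdotC rdotDl !(rdotC u). Qed.
Lemma rdotZr a u w : rdot u (a *: w) = a * rdot u w.
Proof. by rewrite rdotC rdotZl rdotC. Qed.
Lemma rdotNr u w : rdot u (- w) = - rdot u w.
Proof. by rewrite rdotC rdotNl rdotC. Qed.
Lemma rdotBr u v w : rdot u (v - w) = rdot u v - rdot u w.
Proof. by rewrite rdotDr rdotNr. Qed.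
Lemma rdot0l u : rdot 0 u = 0.
Proof. by rewrite /rdot big1// => j _; rewrite mxE mul0r. Qed.
Lemma rdot0r u : rdot u 0 = 0. Proof. by rewrite rdotC rdot0l. Qed.
Lemma rdot_suml (I : Type) (r : seq I) (P : pred I) (f : I -> 'rV[R]_N) w :
  rdot (\sum_(i <- r | P i) f i) w = \sum_(i <- r | P i) rdot (f i) w.
Proof. by apply: (big_morph (rdot^~ w)) => [u v|]; rewrite ?rdotDl ?rdot0l. Qed.
Lemma rdot_sumr (I : Type) (r : seq I) (P : pred I) (f : I -> 'rV[R]_N) w :
  rdot w (\sum_(i <- r | P i) f i) = \sum_(i <- r | P i) rdot w (f i).
Proof. by rewrite rdotC rdot_suml; apply: eq_bigr => i _; rewrite rdotC. Qed.
End Dot.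

Section Schlafli.
Variables (E : fieldType) (D : E -> E) (HD : derivation D) (N : nat).
Hypothesis two_neq0 : 2%:R != 0 :> E.
Implicit Types u v w : 'rV[E]_N.

Lemma drv_rdot u v : D (rdot u v) = rdot (map_mx D u) v + rdot u (map_mx D v).
Proof.
rewrite (drv_sum HD) -big_split; apply: eq_bigr => j _.
by rewrite (drvM HD) !mxE.
Qed.

(** The vectors n1, m1 and n2, m2 are the frames of two facets at their common ridge,
and c, s are the cosine and the sine of the angle between them, so that
c D s - s D c is the derivative of this angle. Differentiating
n2 = c n1 - s m1 expresses it by the speeds at which the two frames rotate. *)
Lemma angle_derivative (n1 m1 n2 m2 : 'rV[E]_N) (c s : E) :
  n2 = c *: n1 - s *: m1 -> m2 = - (c *: m1) - s *: n1 ->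
  rdot n1 n1 = 1 -> rdot m1 m1 = 1 -> rdot n1 m1 = 0 -> c ^+ 2 + s ^+ 2 = 1 ->
  rdot (map_mx D n1) m1 + rdot (map_mx D n2) m2 = c * D s - s * D c.
Proof.
move=> -> -> n11 m11 nm cs.
have half (x : E) : x + x = 0 -> x = 0.
  move=> xx; apply/eqP; have : 2%:R * x == 0 by rewrite mulr_natl mulr2n xx.
  by rewrite mulf_eq0 (negbTE two_neq0).
have Dn : rdot (map_mx D n1) n1 = 0.
  by apply: half; have := drv_rdot n1 n1; rewrite n11 (drv1 HD) (rdotC n1) => <-.
have Dm : rdot (map_mx D m1) m1 = 0.
  by apply: half; have := drv_rdot m1 m1; rewrite m11 (drv1 HD) (rdotC m1) => <-.
have Dmn : rdot (map_mx D m1) n1 = - rdot (map_mx D n1) m1.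
  apply/eqP; rewrite -addr_eq0 addrC; apply/eqP.
  by have := drv_rdot n1 m1; rewrite nm (drv0 HD) (rdotC n1) => <-.
have -> : map_mx D (c *: n1 - s *: m1) =
    D c *: n1 + c *: map_mx D n1 - D s *: m1 - s *: map_mx D m1.
  by apply/rowP => j; rewrite !mxE (drvB HD) !(drvM HD); ring.
rewrite !(rdotDl, rdotNl, rdotZl, rdotDr, rdotNr, rdotZr) n11 m11 nm (rdotC m1) nm Dn Dm Dmn.
set X := rdot _ _; apply/eqP; rewrite -subr_eq0; apply/eqP.
transitivity ((1 - (c ^+ 2 + s ^+ 2)) * X); last by rewrite cs subrr mul0r.
ring.
Qed.

(** The sum is rearranged into a sum over the facets j: each contributes the product
of m j with the derivative of the sum of the v i n i j, which is zero. *)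
Lemma schlafli (I J : finType) (A : pred I) (B : pred J) (inc : I -> J -> bool)
    (v : I -> E) (n : I -> J -> 'rV[E]_N) (m : J -> 'rV[E]_N)
    (f1 f2 : I -> J) (c s : I -> E) :
  (forall i, A i -> D (v i) = 0) ->
  (forall j, B j -> \sum_(i | A i && inc i j) v i *: n i j = 0) ->
  (forall i, A i -> f1 i != f2 i) ->
  (forall i j, A i -> (B j && inc i j) = (j == f1 i) || (j == f2 i)) ->
  (forall i, A i -> c i * D (s i) - s i * D (c i) =
     rdot (map_mx D (n i (f1 i))) (m (f1 i)) +
     rdot (map_mx D (n i (f2 i))) (m (f2 i))) ->
  \sum_(i | A i) v i * (c i * D (s i) - s i * D (c i)) = 0.
Proof.
move=> Dv bal f12 incE cs.
transitivity (\sum_(i | A i) \sum_(j | B j && inc i j)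
    rdot (map_mx D (v i *: n i j)) (m j)).
  apply: eq_bigr => i Ai; rewrite cs//.
  rewrite (eq_bigl (fun j => (j == f1 i) || (j == f2 i))); last first.
    by move=> j; exact: incE.
  rewrite (bigD1 (f1 i)) ?eqxx//= (big_pred1 (f2 i)); last first.
    move=> j /=; rewrite andb_orl andbN /= andbC.
    by case: eqVneq => [->|] /=; rewrite ?(negbTE (f12 _ Ai)) ?andbT.
  have e j : map_mx D (v i *: n i j) = v i *: map_mx D (n i j).
    by apply/rowP => l; rewrite !mxE (drvM HD) Dv// mul0r add0r.
  by rewrite !e !rdotZl mulrDr.
rewrite (exchange_big_dep (fun j => B j)) /=; last by move=> i j _ /andP[].
apply: big1 => j Bj; rewrite -rdot_suml.
have -> : \sum_(i | A i && (B j && inc i j)) map_mx D (v i *: n i j) =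
    map_mx D (\sum_(i | A i && inc i j) v i *: n i j).
  apply/rowP => l; rewrite summxE mxE summxE (drv_sum HD) Bj /=.
  by apply: eq_bigr => i _; rewrite mxE.
rewrite bal//; have -> : map_mx D (0 : 'rV[E]_N) = 0.
  by apply/rowP => l; rewrite !mxE (drv0 HD).
by rewrite rdot0l.
Qed.
End Schlafli.

Section FiniteValues.
Variables (R : realType) (S : set R).
Variables (I J : finType) (A : pred I) (B : pred J) (inc : I -> J -> bool) (N : nat).
Variables (v : I -> R) (n : I -> J -> R -> 'rV[R]_N) (m : J -> R -> 'rV[R]_N).
Variables (f1 f2 : I -> J) (c s : I -> R -> R) (e : I -> int).
Hypothesis balanced : forall t j, S t -> B j ->
  \sum_(i | A i && inc i j) v i *: n i j t = 0.
Hypothesis f12 : forall i, A i -> f1 i != f2 i.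
Hypothesis incE : forall i j, A i -> (B j && inc i j) = (j == f1 i) || (j == f2 i).
Hypothesis nn : forall t i, S t -> A i -> rdot (n i (f1 i) t) (n i (f1 i) t) = 1.
Hypothesis mm : forall t i, S t -> A i -> rdot (m (f1 i) t) (m (f1 i) t) = 1.
Hypothesis nm : forall t i, S t -> A i -> rdot (n i (f1 i) t) (m (f1 i) t) = 0.
Hypothesis n2E : forall t i, S t -> A i ->
  n i (f2 i) t = c i t *: n i (f1 i) t - s i t *: m (f1 i) t.
Hypothesis m2E : forall t i, S t -> A i ->
  m (f2 i) t = - (c i t *: m (f1 i) t) - s i t *: n i (f1 i) t.
Hypothesis cs1 : forall t i, S t -> A i -> c i t ^+ 2 + s i t ^+ 2 = 1.
Hypothesis rels : forall w : I -> int,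
  \sum_(i | A i) v i * (w i)%:~R = 0 -> \sum_(i | A i) w i * e i = 0.

Definition cis i t : R[i] := (c i t +i* s i t)%C.

(** Were there infinitely many values, the product would have a transcendental class
in an ultrapower of the complex numbers, and its logarithmic derivative would
have a nonzero residue for a suitable derivation. Schlaefli's formula and the
hypothesis rels force this residue to vanish. *)
Theorem finite_values :
  finite_set ((fun t => \prod_(i | A i) cis i t ^ e i) @` S).
Proof.
apply: contrapT => inf; set U := (fun t : R => _) in inf.
have [F [Q [cc [Qeq ccE Utr]]]] := @transcendental_limit (R : pointedType) (R[i] : fieldType) S U inf.
have char0 : forall k, k.+1%:R != 0 :> R[i] by move=> k; rewrite pnatr_eq0.
pose X : finType := (I * J * 'I_N + J * 'I_N + I + I)%type.
pose g (x : X) : R -> R := match x with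
  | inl (inl (inl (i, j, l))) => fun t => n i j t 0 l
  | inl (inl (inr (j, l))) => fun t => m j t 0 l
  | inl (inr i) => c i
  | inr i => s i end.
pose rho (h : R -> R) : F := Q (fun t => (h t)%:C%C).
have [L [u' [u'E ru']] Lys] := residue_tower char0 [seq rho (g x) | x : X] Utr.
have /choice[h hE] : forall x : X, exists y : L, lr_in L y = rho (g x).
  by move=> x; apply: Lys; apply/mapP; exists x; rewrite ?mem_enum.
pose D := @lr_D _ _ _ L; have HD : derivation D := @lr_derivation _ _ _ L.
pose io := lr_in L.
have rhoD a b : rho (fun t => a t + b t) = rho a + rho b.
  by rewrite -rmorphD; congr (Q _); apply/funext => t; rewrite !fctE rmorphD.
have rhoM a b : rho (fun t => a t * b t) = rho a * rho b.
  by rewrite -rmorphM; congr (Q _); apply/funext => t; rewrite !fctE rmorphM.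
have rhoN a : rho (fun t => - a t) = - rho a.
  by rewrite -rmorphN; congr (Q _); apply/funext => t; rewrite !fctE rmorphN.
have rhoC a : rho (fun=> a) = io (lr_cst L a%:C%C) by rewrite /io lr_in_cst ccE.
have rho_eq a b : (forall t, S t -> a t = b t) -> rho a = rho b.
  by move=> ab; apply: Qeq => t St; rewrite ab.
have rho_sum (K : finType) (P : pred K) (a : K -> R -> R) :
    rho (fun t => \sum_(k | P k) a k t) = \sum_(k | P k) rho (a k).
  rewrite -rmorph_sum; congr (Q _); apply/funext => t.
  by rewrite fct_sumE rmorph_sum.
pose n' i j : 'rV[L]_N := \row_l h (inl (inl (inl (i, j, l)))).
pose m' j : 'rV[L]_N := \row_l h (inl (inl (inr (j, l)))).
pose c' i : L := h (inl (inr i)); pose s' i : L := h (inr i).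
pose v' i : L := lr_cst L (v i)%:C%C.
have io_inj : injective io by exact: fmorph_inj.
have nE i j l : io (n' i j 0 l) = rho (fun t => n i j t 0 l) by rewrite mxE /io hE.
have mE j l : io (m' j 0 l) = rho (fun t => m j t 0 l) by rewrite mxE /io hE.
have cE i : io (c' i) = rho (c i) by rewrite /io hE.
have sE i : io (s' i) = rho (s i) by rewrite /io hE.
have vE i : io (v' i) = rho (fun=> v i) by rewrite rhoC.
have rho_dot (x y : 'rV[L]_N) (x0 y0 : R -> 'rV[R]_N) :
    (forall l, io (x 0 l) = rho (fun t => x0 t 0 l)) ->
    (forall l, io (y 0 l) = rho (fun t => y0 t 0 l)) ->
    io (rdot x y) = rho (fun t => rdot (x0 t) (y0 t)).
  move=> xX yY; rewrite rho_sum rmorph_sum; apply: eq_bigr => l _.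
  by rewrite rmorphM xX yY rhoM.
have nn' i : A i -> rdot (n' i (f1 i)) (n' i (f1 i)) = 1.
  move=> Ai; apply: io_inj; rewrite (rho_dot _ _ _ _ (nE _ _) (nE _ _)).
  by rewrite rmorph1 (rho_eq _ (fun=> 1)) ?rhoC ?rmorph1// => t St; rewrite nn.
have mm' i : A i -> rdot (m' (f1 i)) (m' (f1 i)) = 1.
  move=> Ai; apply: io_inj; rewrite (rho_dot _ _ _ _ (mE _) (mE _)).
  by rewrite rmorph1 (rho_eq _ (fun=> 1)) ?rhoC ?rmorph1// => t St; rewrite mm.
have nm' i : A i -> rdot (n' i (f1 i)) (m' (f1 i)) = 0.
  move=> Ai; apply: io_inj; rewrite (rho_dot _ _ _ _ (nE _ _) (mE _)).
  by rewrite rmorph0 (rho_eq _ (fun=> 0)) ?rhoC ?rmorph0// => t St; rewrite nm.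
have n2' i : A i -> n' i (f2 i) = c' i *: n' i (f1 i) - s' i *: m' (f1 i).
  move=> Ai; apply/rowP => l; apply: io_inj; rewrite nE !mxE rmorphB !rmorphM.
  rewrite cE sE /io !hE -!rhoM -rhoN -rhoD; apply: rho_eq => t St.
  by rewrite n2E// !mxE.
have m2' i : A i -> m' (f2 i) = - (c' i *: m' (f1 i)) - s' i *: n' i (f1 i).
  move=> Ai; apply/rowP => l; apply: io_inj; rewrite mE !mxE rmorphB rmorphN !rmorphM.
  rewrite cE sE /io !hE -!rhoM -!rhoN -rhoD; apply: rho_eq => t St.
  by rewrite m2E// !mxE.
have cs' i : A i -> c' i ^+ 2 + s' i ^+ 2 = 1.
  move=> Ai; apply: io_inj; rewrite !expr2 rmorphD !rmorphM cE sE -!rhoM -rhoD.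
  by rewrite rmorph1 (rho_eq _ (fun=> 1)) ?rhoC ?rmorph1// => t St; rewrite -!expr2 cs1.
have bal' j : B j -> \sum_(i | A i && inc i j) v' i *: n' i j = 0.
  move=> Bj; apply/rowP => l; apply: io_inj; rewrite mxE rmorph0.
  rewrite summxE rmorph_sum.
  rewrite (eq_bigr (fun i => rho (fun t => v i * n i j t 0 l))); last first.
    by move=> i _; rewrite mxE rmorphM vE nE rhoM.
  rewrite -rho_sum (rho_eq _ (fun=> 0)) ?rhoC ?rmorph0// => t St.
  transitivity ((\sum_(i | A i && inc i j) v i *: n i j t) 0 l).
    by rewrite summxE; apply: eq_bigr => i _; rewrite mxE.
  by rewrite balanced// mxE.
have Dv' i : D (v' i) = 0 by exact: lr_Dcst.
have two : 2%:R != 0 :> L by rewrite -(rmorph_nat (lr_cst L)) fmorph_eq0 char0.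
have schl : \sum_(i | A i) v' i * (c' i * D (s' i) - s' i * D (c' i)) = 0.
  apply: (schlafli HD (B := B) (inc := inc) (n := n') (m := m') (f1 := f1) (f2 := f2)) => //.
  move=> i Ai; symmetry; apply: (angle_derivative HD two) => //.
  - exact: n2'.
  - exact: m2'.
  - exact: nn'.
  - exact: mm'.
  - exact: nm'.
  - exact: cs'.
pose im : L := lr_cst L ('i)%C.
have im2 : im * im = -1.
  by rewrite -rmorphM -expr2 sqr_i rmorphN rmorph1.
pose z i := c' i + im * s' i.
(* c' - i s' is the inverse of z, whence dlog z is i times the derivative of the
   angle *)
have zz i : A i -> z i * (c' i - im * s' i) = 1.
  move=> Ai; rewrite -(cs' _ Ai) /z.
  transitivity (c' i ^+ 2 - (im * im) * s' i ^+ 2); first by ring.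
  by rewrite im2 mulN1r opprK.
have z0 i : A i -> z i != 0.
  by move=> Ai; apply: contra_eq_neq (zz _ Ai) => ->; rewrite mul0r eq_sym oner_eq0.
have zV i : A i -> (z i)^-1 = c' i - im * s' i.
  by move=> Ai; apply: (mulfI (z0 _ Ai)); rewrite mulfV ?z0// zz.
have Dim : D im = 0 by exact: lr_Dcst.
have dz i : A i -> dlog D (z i) = im * (c' i * D (s' i) - s' i * D (c' i)).
  move=> Ai; rewrite /dlog zV// /z (drvD HD) (drvM HD) Dim mul0r add0r.
  have := congr1 D (cs' _ Ai); rewrite !expr2 (drvD HD) !(drvM HD) (drv1 HD) => cs0.
  have cs2 : c' i * D (c' i) + s' i * D (s' i) = 0.
    apply/eqP; have : 2%:R * (c' i * D (c' i) + s' i * D (s' i)) == 0.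
      by rewrite -cs0; apply/eqP; ring.
    by rewrite mulf_eq0 (negbTE two).
  transitivity (c' i * D (c' i) - im * im * (s' i * D (s' i))
    + im * (c' i * D (s' i) - s' i * D (c' i))); first by ring.
  by rewrite im2 mulN1r opprK cs2 add0r.
have iz i : io (z i) = Q (cis i).
  rewrite rmorphD rmorphM cE sE /io lr_in_cst ccE -rmorphM -rmorphD; congr (Q _).
  by apply/funext => t; rewrite !fctE [RHS]complexE.
have cis0 i t : S t -> A i -> cis i t != 0.
  move=> St Ai; apply/eqP => -[ct st]; have := cs1 St Ai.
  by rewrite ct st expr0n addr0 => /eqP; rewrite eq_sym oner_eq0.
have QX i : A i -> Q (fun t => cis i t ^ e i) = Q (cis i) ^ e i.
  move=> Ai; case: (e i) => k.
    rewrite -[RHS]/(Q (cis i) ^+ k) -rmorphXn; congr (Q _).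
    by apply/funext=> t; rewrite fctE.
  rewrite -[RHS]/((Q (cis i) ^+ k.+1)^-1) -rmorphXn.
  have Qk0 : Q (cis i ^+ k.+1) != 0.
    by rewrite rmorphXn expf_neq0// -iz fmorph_eq0 z0.
  apply: (mulIf Qk0); rewrite mulVf// -rmorphM -(rmorph1 Q); apply: Qeq => t St.
  by rewrite /GRing.mul /= fctE mulVf// expf_neq0// cis0.
have u'z : u' = \prod_(i | A i) z i ^ e i.
  apply: io_inj; rewrite /io u'E rmorph_prod.
  rewrite (eq_bigr (fun i => Q (fun t => cis i t ^ e i))); last first.
    by move=> i Ai; rewrite rmorphXz ?unitfE ?z0//= iz QX.
  by rewrite -rmorph_prod; congr (Q _); apply/funext => t; rewrite fct_prodE.
have /choice[w wE] : forall i, exists w : int, A i -> lr_res (dlog D (z i)) = w%:~R.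
  move=> i; case: (boolP (A i)) => [Ai|_]; last by exists 0.
  by have [w wE] := lr_res_int (z0 _ Ai); exists w.
have : lr_res (dlog D u') = (\sum_(i | A i) w i * e i)%:~R.
  rewrite u'z dlog_prod// (big_morph _ (@lr_resD _ _ _ L) (lr_res0 L)) rmorph_sum.
  by apply: eq_bigr => i Ai; rewrite lr_res_intr wE// -mulrzA.
rewrite rels ?(negbTE ru')//; first by move/eqP; rewrite (negbTE ru').
have : lr_res (im * \sum_(i | A i) v' i * (c' i * D (s' i) - s' i * D (c' i))) = 0.
  by rewrite schl mulr0 lr_res0.
rewrite mulr_sumr (big_morph _ (@lr_resD _ _ _ L) (lr_res0 L)).
rewrite (eq_bigr (fun i => (v i * (w i)%:~R)%:C%C)).
  by rewrite -rmorph_sum => -[].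
by move=> i Ai; rewrite mulrCA -dz// lr_resZ wE// rmorphM /= rmorph_int.
Qed.
End FiniteValues.

(** * Gram determinants *)

Section Gram.
Variables (R : realType).

Lemma rdotE N (u v : 'rV[R]_N) : rdot u v = (u *m v^T) 0 0.
Proof. by rewrite mxE; apply: eq_bigr => j _; rewrite mxE. Qed.

Lemma rdot_ge0 N (u : 'rV[R]_N) : 0 <= rdot u u.
Proof. by apply: sumr_ge0 => j _; rewrite -expr2 sqr_ge0. Qed.

Lemma rdot_eq0 N (u : 'rV[R]_N) : rdot u u = 0 -> u = 0.
Proof.
move=> /eqP; rewrite psumr_eq0 => [/allP u0|j _]; last by rewrite -expr2 sqr_ge0.
apply/rowP => j; have := u0 j (mem_index_enum j).
by rewrite /= mulf_eq0 orbb mxE => /eqP.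
Qed.

Lemma mulmx_rdot0 N a (A : 'M[R]_(a, N)) (x : 'rV[R]_N) :
  (forall i, rdot x (row i A) = 0) -> x *m A^T = 0.
Proof.
move=> x0; apply/rowP => i; rewrite [RHS]mxE -(x0 i) mxE.
by apply: eq_bigr => j _; rewrite !mxE.
Qed.

Lemma mulmx_tr_rdot N a (A : 'M[R]_(a, N)) (x : 'rV[R]_N) i :
  (x *m A^T) 0 i = rdot x (row i A).
Proof. by rewrite mxE; apply: eq_bigr => j _; rewrite !mxE. Qed.

Lemma exists_normal d (A : 'M[R]_(d, d.+1)) :
  exists2 x : 'rV[R]_d.+1, rdot x x = 1 & forall i, rdot x (row i A) = 0.
Proof.
have [x /sub_kermxP xA x0] : exists2 x : 'rV[R]_d.+1, (x <= kermx A^T)%MS & x != 0.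
  apply/rowV0Pn; rewrite -mxrank_eq0 mxrank_ker -lt0n subn_gt0.
  by rewrite (leq_ltn_trans (rank_leq_col _)).
have xx : 0 < rdot x x.
  by rewrite lt_def rdot_ge0 andbT; apply: contra_neq x0; exact: rdot_eq0.
exists ((Num.sqrt (rdot x x))^-1 *: x).
  rewrite rdotZl rdotZr mulrA -invfM -expr2 sqr_sqrtr ?rdot_ge0// mulVf//.
  by rewrite gt_eqF.
by move=> i; rewrite rdotZl -mulmx_tr_rdot xA mxE mulr0.
Qed.

Lemma mx11_rdot N (u v : 'rV[R]_N) : \det (u *m v^T) = rdot u v.
Proof. by rewrite det_mx11 rdotE. Qed.

Lemma col_mx_ord0 d N (u : 'rV[R]_N) (A : 'M[R]_(d, N)) j :
  (col_mx u A : 'M[R]_(d.+1, N)) ord0 j = u 0 j.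
Proof.
transitivity (col_mx u A (lshift d 0) j); last exact: col_mxEu.
by congr (col_mx u A _ j); exact: val_inj.
Qed.

Lemma col_mx_lift d N (u : 'rV[R]_N) (A : 'M[R]_(d, N)) i j :
  (col_mx u A : 'M[R]_(d.+1, N)) (lift ord0 i) j = A i j.
Proof.
transitivity (col_mx u A (rshift 1 i) j); last exact: col_mxEd.
by congr (col_mx u A _ j); exact: val_inj.
Qed.

Lemma row_col_mx_ord0 d N (u : 'rV[R]_N) (A : 'M[R]_(d, N)) :
  row ord0 (col_mx u A : 'M[R]_(d.+1, N)) = u.
Proof. by apply/rowP => j; rewrite mxE col_mx_ord0. Qed.

Lemma row_col_mx_lift d N (u : 'rV[R]_N) (A : 'M[R]_(d, N)) i :
  row (lift ord0 i) (col_mx u A : 'M[R]_(d.+1, N)) = row i A.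
Proof. by apply/rowP => j; rewrite [LHS]mxE col_mx_lift mxE. Qed.

(** The product of the first matrix with the transpose of the second one is block
triangular, because m is orthogonal to the rows of A. *)
Lemma gram1 d (x m : 'rV[R]_d.+1) (A : 'M[R]_(d, d.+1)) :
  (forall i, rdot m (row i A) = 0) ->
  \det (col_mx x A : 'M[R]_d.+1) * \det (col_mx m A : 'M[R]_d.+1) = rdot x m * \det (A *m A^T).
Proof.
move=> mA; rewrite -[\det (col_mx m A)]det_tr -det_mulmx.
rewrite tr_col_mx (_ : (col_mx x A : 'M[R]_d.+1) *m (row_mx m^T A^T : 'M[R]_d.+1) =
  block_mx (x *m m^T) (x *m A^T) (A *m m^T) (A *m A^T) :> 'M[R]_(1 + d)); last first.
  exact: mul_col_row.
have -> : A *m m^T = 0.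
  by apply: trmx_inj; rewrite trmx_mul trmxK trmx0; exact: mulmx_rdot0.
by rewrite (@det_ublock _ 1 d) mx11_rdot.
Qed.

Lemma det_mx2 (M : 'M[R]_2) : \det M = M 0 0 * M 1 1 - M 0 1 * M 1 0.
Proof.
rewrite (expand_det_row _ 0) !big_ord_recl big_ord0 addr0 /cofactor !det_mx11 !mxE.
have -> : lift 0 0 = 1 :> 'I_2 by apply: val_inj.
have -> : lift 1 0 = 0 :> 'I_2 by apply: val_inj.
by rewrite /= !expr0 expr1 mul1r mulN1r mulrN.
Qed.

Definition det2 d (x y : 'rV[R]_d.+2) (A : 'M[R]_(d, d.+2)) : R :=
  \det (col_mx x (col_mx y A) : 'M[R]_d.+2).

(** As for [gram1], with a block of size two in the corner. *)
Lemma gram2 d (x y m n : 'rV[R]_d.+2) (A : 'M[R]_(d, d.+2)) :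
  (forall i, rdot m (row i A) = 0) -> (forall i, rdot n (row i A) = 0) ->
  det2 x y A * det2 m n A =
  (rdot x m * rdot y n - rdot x n * rdot y m) * \det (A *m A^T).
Proof.
move=> mA nA; rewrite /det2.
have cE (u v : 'rV[R]_d.+2) : (col_mx u (col_mx v A) : 'M[R]_d.+2) = col_mx (col_mx u v) A.
  by rewrite col_mxA castmx_id.
rewrite !cE -[\det (col_mx (col_mx m n) A)]det_tr -det_mulmx.
rewrite tr_col_mx (_ : (col_mx (col_mx x y) A : 'M[R]_d.+2) *m
    (row_mx (col_mx m n)^T A^T : 'M[R]_d.+2) =
  block_mx (col_mx x y *m (col_mx m n)^T) (col_mx x y *m A^T)
    (A *m (col_mx m n)^T) (A *m A^T) :> 'M[R]_(2 + d)); last first.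
  exact: mul_col_row.
have -> : A *m (col_mx m n)^T = 0.
  apply: trmx_inj; rewrite trmx_mul trmxK trmx0 mul_col_mx !mulmx_rdot0//.
  by rewrite col_mx0.
rewrite (@det_ublock _ 2 d) tr_col_mx mul_col_row; congr (_ * _).
set M := block_mx _ _ _ _; rewrite det_mx2.
have M00 : M 0 0 = rdot x m.
  transitivity (M (lshift 1 0) (lshift 1 0)); first by congr (M _ _); exact: val_inj.
  by rewrite block_mxEul rdotE.
have M01 : M 0 1 = rdot x n.
  transitivity (M (lshift 1 0) (rshift 1 0)); first by congr (M _ _); exact: val_inj.
  by rewrite block_mxEur rdotE.
have M10 : M 1 0 = rdot y m.
  transitivity (M (rshift 1 0) (lshift 1 0)); first by congr (M _ _); exact: val_inj.
  by rewrite block_mxEdl rdotE.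
have M11 : M 1 1 = rdot y n.
  transitivity (M (rshift 1 0) (rshift 1 0)); first by congr (M _ _); exact: val_inj.
  by rewrite block_mxEdr rdotE.
by rewrite M00 M01 M10 M11.
Qed.
End Gram.

(** * Normal vectors of a facet *)

Section Tuples.
Variables (V : finType) (k : nat).
Implicit Types w : k.-tuple V.

Lemma card_tuple_uniq w (t : {set V}) : [set v in w] = t -> #|t| = k -> uniq w.
Proof. by move=> <- wk; apply/card_uniqP; rewrite size_tuple -[RHS]wk cardsE. Qed.

Lemma sum_tuple (M : nmodType) w (F : V -> M) : uniq w ->
  \sum_(v in [set v in w]) F v = \sum_(i < k) F (tnth w i).
Proof.
move=> uw; rewrite -(big_tuple _ _ w xpredT F) big_uniq//=.
by apply: eq_bigl => v; rewrite inE.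
Qed.

Lemma exists_tuple (t : {set V}) : #|t| = k -> exists w, [set v in w] = t.
Proof.
move=> tk; have st : size (enum t) == k by rewrite -cardE tk.
by exists (Tuple st); apply/setP => v; rewrite inE mem_enum.
Qed.

Lemma set_tuple_perm w (s : 'S_k) :
  [set v in [tuple tnth w (s i) | i < k]] = [set v in w].
Proof.
apply/setP => v; rewrite !inE; apply/tnthP/tnthP => -[i ->].
  by exists (s i); rewrite tnth_mktuple.
by exists (s^-1 i)%g; rewrite tnth_mktuple permKV.
Qed.

Lemma same_set_perm w w' : [set u in w] = [set u in w'] -> #|[set u in w]| = k ->
  exists s : 'S_k, w' = [tuple tnth w (s i) | i < k].
Proof.
move=> ww' wd; have uw := card_tuple_uniq erefl wd.
have uw' : uniq w' by apply: card_tuple_uniq erefl _; rewrite -ww'.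
have pm : perm_eq w' w.
  by apply: uniq_perm => // v; have /setP/(_ v) := ww'; rewrite !inE.
by have /tuple_permP[s sE] := pm; exists s; apply: val_inj.
Qed.
End Tuples.

Section Simplex.
Variables (R : realType) (V : finType) (d N : nat) (p : V -> 'rV[R]_N).
Implicit Types (w : d.+1.-tuple V) (t : {set V}) (x m : 'rV[R]_N).

Definition edge_mx w : 'M[R]_(d, N) :=
  \matrix_(i < d) (p (tnth w (lift ord0 i)) - p (tnth w ord0)).

Lemma row_edge_mx w i : row i (edge_mx w) = p (tnth w (lift ord0 i)) - p (tnth w ord0).
Proof. by rewrite rowK. Qed.

Lemma edge_comb w (y : 'rV[R]_d) : uniq w -> exists c : V -> R,
  [/\ \sum_(v in [set v in w]) c v = 0,
      \sum_(v in [set v in w]) c v *: p v = y *m edge_mx w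
    & forall i, c (tnth w (lift ord0 i)) = y 0 i].
Proof.
move=> uw; pose k (i : 'I_d.+1) := oapp (y 0) (- \sum_i y 0 i) (unlift ord0 i).
pose c u := \sum_(i < d.+1) if tnth w i == u then k i else 0.
have cE j : c (tnth w j) = k j.
  rewrite /c (bigD1 j)//= eqxx big1 ?addr0// => i ij.
  by case: eqP => // /(tuple_uniqP _ uw)/eqP; rewrite (negbTE ij).
have k0 : k ord0 = - \sum_i y 0 i by rewrite /k unlift_none.
have kS i : k (lift ord0 i) = y 0 i by rewrite /k liftK.
exists c; split=> [||i]; last by rewrite cE kS.
  rewrite sum_tuple// big_ord_recl cE k0.
  by rewrite [X in _ + X](eq_bigr (y 0)) ?addNr// => i _; rewrite cE kS.
rewrite sum_tuple// big_ord_recl cE k0 mulmx_sum_row scaleNr scaler_suml -sumrN.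
rewrite -big_split; apply: eq_bigr => i _ /=.
by rewrite cE kS row_edge_mx scalerBr addrC.
Qed.

Definition aff_indep t := forall c : V -> R,
  \sum_(v in t) c v = 0 -> \sum_(v in t) c v *: p v = 0 ->
  forall v, v \in t -> c v = 0.

(** This is [orthogonal_to], referring to the positions p of the vertices only. *)
Definition perp t x := forall u v, u \in t -> v \in t -> rdot x (p u - p v) = 0.

Lemma perp_edge_mx w t x : [set v in w] = t ->
  perp t x <-> forall i, rdot x (row i (edge_mx w)) = 0.
Proof.
move=> <-; split=> [xt i|xe].
  by rewrite row_edge_mx xt// inE mem_tnth.
have x0 i : rdot x (p (tnth w i)) = rdot x (p (tnth w ord0)).
  case: (unliftP ord0 i) => [j ->|->//]; apply/eqP; rewrite -subr_eq0 -rdotBr.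
  by rewrite -row_edge_mx xe.
move=> u v; rewrite !inE => /tnthP[i ->] /tnthP[j ->].
by rewrite rdotBr !x0 subrr.
Qed.

Lemma perp_sum t x c : perp t x -> \sum_(v in t) c v = 0 ->
  rdot x (\sum_(v in t) c v *: p v) = 0.
Proof.
move=> xt c0; have [->|[u ut]] := set_0Vmem t; first by rewrite big_set0 rdot0r.
rewrite rdot_sumr (eq_bigr (fun v => c v * rdot x (p u))) => [|v vt].
  by rewrite -mulr_suml c0 mul0r.
rewrite rdotZr; congr (_ * _); apply/eqP; rewrite -subr_eq0 -rdotBr.
by rewrite xt.
Qed.

End Simplex.

Section Facet.
Variables (R : realType) (V : finType) (d : nat) (p : V -> 'rV[R]_d.+1).
Implicit Types (w : d.+1.-tuple V) (x : 'rV[R]_d.+1).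
Local Notation edge_mx := (edge_mx p).
Local Notation perp := (perp p).
Local Notation aff_indep := (aff_indep p).
Variables (t : {set V}) (m : 'rV[R]_d.+1).
Hypotheses (td : #|t| = d.+1) (tai : aff_indep t) (mm : rdot m m = 1) (mt : perp t m).

Lemma normal_edge_unit w : [set v in w] = t -> (col_mx m (edge_mx w) : 'M[R]_d.+1) \in unitmx.
Proof.
move=> wt; rewrite -row_free_unit; apply: inj_row_free => v.
pose a : 'rV[R]_1 := lsubmx (v : 'rV[R]_(1 + d)).
pose b : 'rV[R]_d := rsubmx (v : 'rV[R]_(1 + d)).
have -> : v = row_mx a b by rewrite hsubmxK.
rewrite [_ *m _](@mul_row_col R 1 1 d d.+1 a b m (edge_mx w)) => ab0.
have uw := card_tuple_uniq wt td.
have [c [c0 cp cE]] := edge_comb p b uw; rewrite wt in c0 cp.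
have am : a *m m = a 0 0 *: m by rewrite {1}[a]mx11_scalar mul_scalar_mx.
have a0 : a 0 0 = 0.
  have := congr1 (rdot m) ab0; rewrite rdotDr rdot0r am rdotZr mm mulr1.
  by rewrite -cp (perp_sum mt c0) addr0.
have b0 : b = 0.
  apply/rowP => i; rewrite -cE mxE; apply: tai => //.
    by move: ab0; rewrite am a0 scale0r add0r cp.
  by rewrite -wt inE mem_tnth.
by rewrite b0 [a]mx11_scalar a0 raddf0 row_mx0.
Qed.

(** The normal of a facet and its edges span the whole space. *)
Lemma facet_full x : perp t x -> rdot x m = 0 -> x = 0.
Proof.
move=> xt xm; have [w wt] := exists_tuple td.
have Bu := normal_edge_unit wt; apply: trmx_inj; rewrite trmx0 -[x^T](mulKmx Bu).
have -> : (col_mx m (edge_mx w) : 'M[R]_d.+1) *m x^T = 0; last by rewrite mulmx0.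
transitivity (col_mx (m *m x^T) (edge_mx w *m x^T)).
  exact: (@mul_col_mx R 1 d d.+1 1 m (edge_mx w) x^T).
have -> : edge_mx w *m x^T = 0.
  by apply: trmx_inj; rewrite trmx_mul trmxK trmx0 mulmx_rdot0//; exact/(perp_edge_mx p x wt).
by rewrite [m *m _]mx11_scalar -rdotE rdotC xm raddf0 col_mx0.
Qed.

Lemma tangent_comb x : rdot x m = 0 -> exists c : V -> R,
  \sum_(v in t) c v = 0 /\ x = \sum_(v in t) c v *: p v.
Proof.
move=> xm; have [w wt] := exists_tuple td; have uw := card_tuple_uniq wt td.
have xE : x = x *m invmx (col_mx m (edge_mx w) : 'M[R]_d.+1) *m (col_mx m (edge_mx w) : 'M[R]_d.+1).
  by rewrite mulmxKV// normal_edge_unit.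
set y := x *m invmx _ in xE.
pose a : 'rV[R]_1 := lsubmx (y : 'rV[R]_(1 + d)).
pose b : 'rV[R]_d := rsubmx (y : 'rV[R]_(1 + d)).
have {}xE : x = a 0 0 *: m + b *m edge_mx w.
  rewrite {1}xE (_ : y = row_mx a b); last by rewrite hsubmxK.
  transitivity (a *m m + b *m edge_mx w).
    exact: (@mul_row_col R 1 1 d d.+1 a b m (edge_mx w)).
  by rewrite {1}[a]mx11_scalar mul_scalar_mx.
have [c [c0 cp _]] := edge_comb p b uw; rewrite wt in c0 cp.
exists c; split=> //; rewrite cp {1}xE.
suff -> : a 0 0 = 0 by rewrite scale0r add0r.
move: xm; rewrite xE -cp rdotDl rdotZl mm mulr1.
by rewrite (rdotC _ m) (perp_sum mt c0) addr0.
Qed.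

(** Let q v = p v + a m, with a such that all q v have scalar product 1 with m. By
[gram1] the determinant of the rows q v is that of m and the edges, and a
permutation of the vertices permutes its rows. *)
Lemma facet_det_perm w (s : 'S_d.+1) : [set v in w] = t ->
  \det (col_mx m (edge_mx [tuple tnth w (s i) | i < d.+1]) : 'M[R]_d.+1) =
  (-1) ^+ s * \det (col_mx m (edge_mx w) : 'M[R]_d.+1).
Proof.
move=> wt; set w' := [tuple _ | _ < _].
have w't : [set v in w'] = t by rewrite set_tuple_perm.
pose q v := p v + (1 - rdot m (p (tnth w ord0))) *: m.
have qm v : v \in t -> rdot (q v) m = 1.
  move=> vt; rewrite /q rdotDl rdotZl mm mulr1.
  have := mt vt (_ : tnth w ord0 \in t); rewrite rdotBr => /(_ _)/eqP.
  rewrite -wt inE mem_tnth => /(_ isT); rewrite subr_eq0 => /eqP <-.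
  by rewrite rdotC addrC subrK.
have detQ u : [set v in u] = t ->
    \det (\matrix_i q (tnth u i)) = \det (col_mx m (edge_mx u) : 'M[R]_d.+1).
  move=> ut; have emu := normal_edge_unit ut.
  transitivity (\det (col_mx (q (tnth u ord0)) (edge_mx u) : 'M[R]_d.+1)).
    have -> : \matrix_i q (tnth u i) =
       (block_mx 1%:M 0 (const_mx 1) 1%:M : 'M[R]_(1 + d)) *m
       (col_mx (q (tnth u ord0)) (edge_mx u) : 'M[R]_d.+1).
      rewrite (_ : _ *m _ = col_mx (1%:M *m q (tnth u ord0) + 0 *m edge_mx u)
         (const_mx 1 *m q (tnth u ord0) + 1%:M *m edge_mx u)); last exact: mul_block_col.
      rewrite !mul1mx mul0mx addr0; apply/matrixP => i j; rewrite mxE.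
      case: (unliftP ord0 i) => [l|] ->.
        by rewrite col_mx_lift !mxE big_ord1 !mxE; ring.
      by rewrite col_mx_ord0.
    by rewrite det_mulmx (@det_lblock _ 1 d) !det1 !mul1r.
  have pe : forall i, rdot m (row i (edge_mx u)) = 0 by apply/(perp_edge_mx p m ut).
  have := gram1 (q (tnth u ord0)) pe; have := gram1 m pe.
  rewrite mm qm ?mul1r => [<-|]; last by rewrite -ut inE mem_tnth.
  by apply: mulIf; rewrite -unitfE -unitmxE.
rewrite -!detQ// -det_perm -det_mulmx -row_permE; congr (\det _).
by apply/matrixP => i j; rewrite !mxE tnth_mktuple.
Qed.

Definition facet_det w (x : 'rV[R]_d.+1) := \det (col_mx x (edge_mx w) : 'M[R]_d.+1).

Lemma facet_det_neq0 w : [set v in w] = t -> facet_det w m != 0.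
Proof. by move=> /normal_edge_unit; rewrite unitmxE unitfE. Qed.
End Facet.

Section Oriented.
Variables (R : realType) (V : finType) (d : nat) (p : V -> 'rV[R]_d.+2).
Implicit Types (w : d.+2.-tuple V) (x : 'rV[R]_d.+2).
Variables (o : pred (d.+2.-tuple V)) (t : {set V}).
Hypotheses (td : #|t| = d.+2) (tai : aff_indep p t).
Hypothesis ot : forall w (s : 'S_d.+2), [set v in w] = t ->
  o [tuple tnth w (s i) | i < d.+2] = o w (+) odd_perm s.

(** This is [positive_normal], referring to the positions of the vertices only. *)
Definition pos_normal (m : 'rV[R]_d.+2) := [/\ rdot m m = 1, perp p t m
  & forall w, [set v in w] = t -> o w -> 0 < facet_det p w m].

Definition swap01 : 'S_d.+2 := tperm ord0 (lift ord0 ord0).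
Lemma odd_swap01 : odd_perm swap01 = true.
Proof. by rewrite odd_tperm. Qed.

Lemma pos_normal_sign m w : pos_normal m -> [set v in w] = t ->
  if o w then 0 < facet_det p w m else facet_det p w m < 0.
Proof.
move=> [mm mt mpos] wt; case: ifP => ow; first exact: mpos.
have := mpos [tuple tnth w (swap01 i) | i < d.+2].
rewrite set_tuple_perm wt ot// ow odd_swap01 => /(_ erefl isT).
by rewrite /facet_det (facet_det_perm td tai mm mt _ wt) odd_swap01 expr1 mulN1r oppr_gt0.
Qed.

Lemma oriented_tuple : exists2 w, [set v in w] = t & o w.
Proof.
have [w wt] := exists_tuple td; case ow: (o w); first by exists w.
exists [tuple tnth w (swap01 i) | i < d.+2]; first by rewrite set_tuple_perm.
by rewrite ot// ow odd_swap01.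
Qed.

Lemma perp_opp (x : 'rV[R]_d.+2) : perp p t x -> perp p t (- x).
Proof. by move=> xt u v ut vt; rewrite rdotNl xt// oppr0. Qed.

Lemma facet_detN w x : facet_det p w (- x) = - facet_det p w x.
Proof.
pose L : 'M[R]_d.+2 := block_mx ((-1)%:M : 'M[R]_1) 0 0 (1%:M : 'M[R]_d.+1).
have -> : facet_det p w (- x) = \det (L *m (col_mx x (edge_mx p w) : 'M[R]_d.+2)).
  rewrite (_ : L *m _ = col_mx ((-1)%:M *m x + 0 *m edge_mx p w)
    (0 *m x + 1%:M *m edge_mx p w)); last first.
    exact: (@mul_block_col R 1 d.+1 1 d.+1 d.+2 (-1)%:M 0 0 1%:M x (edge_mx p w)).
  by rewrite !mul0mx mul1mx addr0 add0r mul_scalar_mx scaleN1r.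
by rewrite det_mulmx (@det_ublock _ 1 d.+1) det_mx11 mxE eqxx det1 mulr1 mulN1r.
Qed.

Lemma pos_normal_exists : exists m, pos_normal m.
Proof.
have [w wt ow] := oriented_tuple.
have [x xx xw] := exists_normal (edge_mx p w).
have xt : perp p t x by apply/(perp_edge_mx p x wt).
wlog x0 : x xx xw xt / 0 < facet_det p w x.
  move=> H; have := facet_det_neq0 td tai xx xt wt; rewrite neq_lt => /orP[xneg|]; last exact: H.
  apply: (H (- x)); first by rewrite rdotNl rdotNr opprK.
  - by move=> i; rewrite rdotNl xw oppr0.
  - exact: perp_opp.
  - by rewrite facet_detN oppr_gt0.
exists x; split=> // w' w't ow'.
have [s sE] : exists s : 'S_d.+2, w' = [tuple tnth w (s i) | i < d.+2].
  by apply: same_set_perm; rewrite wt.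
move: ow'; rewrite sE ot// ow /= => /negbTE odd.
by rewrite /facet_det (facet_det_perm td tai xx xt _ wt) odd expr0 mul1r.
Qed.

Lemma pos_normal_unique m m' : pos_normal m -> pos_normal m' -> m' = m.
Proof.
move=> mpos m'pos; have [mm mt mP] := mpos; have [mm' mt' mP'] := m'pos.
have [w wt ow] := oriented_tuple.
set k := rdot m' m.
have m'E : m' = k *: m.
  apply/eqP; rewrite -subr_eq0; apply/eqP.
  apply: (facet_full td tai mm mt); last by rewrite rdotBl rdotZl mm mulr1 subrr.
  by move=> u v ut vt; rewrite rdotBl rdotZl mt// mt'// mulr0 subrr.
have kk : k * k = 1 by rewrite -mm' m'E rdotZl rdotZr mm mulr1.
have /orP[/eqP k1|/eqP k1] : (k == 1) || (k == -1).
  by rewrite -eqf_sqr expr2 kk expr1n.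
  by rewrite m'E k1 scale1r.
have := mP' w wt ow; rewrite m'E k1 scaleN1r facet_detN oppr_gt0 => h.
by have := lt_trans h (mP w wt ow); rewrite ltxx.
Qed.
End Oriented.

(** * A ridge in a facet *)

Section Flag.
Variables (R : realType) (V : finType) (d : nat) (p : V -> 'rV[R]_d.+2).
Variables (s : {set V}) (v : V).
Local Notation t := (v |: s).
Hypotheses (sd : #|s| = d.+1) (vs : v \notin s).
Implicit Types (x z n : 'rV[R]_d.+2) (q : d.+1.-tuple V).

(** The unit inner normal of the facet v |: s at its ridge s. It is tangent to the
facet, hence a combination of the vertices with weights a of sum zero, and it
points to the side of v when a v is positive. *)
Definition inner_unit (n : 'rV[R]_d.+2) := [/\ rdot n n = 1, perp p s n
  & exists a : V -> R,
    [/\ \sum_(u in t) a u = 0, n = \sum_(u in t) a u *: p u & 0 < a v]].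

Lemma card_flag : #|t| = d.+2. Proof. by rewrite cardsU1 vs sd. Qed.

Lemma ridge_vertex : exists u, u \in s.
Proof. by apply/set0Pn; rewrite -card_gt0 sd. Qed.

(** Since x is orthogonal to s, only the vertex off s contributes. *)
Lemma dot_comb x a u0 : perp p s x -> u0 \in s -> \sum_(u in t) a u = 0 ->
  rdot x (\sum_(u in t) a u *: p u) = a v * rdot x (p v - p u0).
Proof.
move=> xs u0s a0; transitivity (\sum_(u in t) a u * rdot x (p u - p u0)).
  rewrite rdot_sumr (eq_bigr (fun u => a u * rdot x (p u - p u0) + a u * rdot x (p u0))).
    by rewrite big_split /= -mulr_suml a0 mul0r addr0.
  by move=> u _; rewrite rdotZr rdotBr -mulrDr subrK.
rewrite big_setU1//= big1 ?addr0// => u us.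
by rewrite xs// mulr0.
Qed.

Lemma inner_height n u : inner_unit n -> u \in s -> 0 < rdot n (p v - p u).
Proof.
move=> [nn ns [a [a0 nE av]]] us; have := dot_comb ns us a0; rewrite -nE nn => e.
by rewrite -(pmulr_rgt0 _ av) -e ltr01.
Qed.

Section Normal.
Variable m : 'rV[R]_d.+2.
Hypotheses (tai : aff_indep p t) (mm : rdot m m = 1) (mt : perp p t m).

Lemma perp_ridge x : perp p t x -> perp p s x.
Proof. by move=> xt u w us ws; apply: xt; rewrite setU1r. Qed.

Lemma inner_perp n : inner_unit n -> rdot n m = 0.
Proof. by move=> [_ _ [a [a0 -> _]]]; rewrite rdotC perp_sum. Qed.

(** The normal m, the inner normal n and the edges of the ridge span the space. *)
Lemma flag_full n z : inner_unit n -> perp p s z -> rdot z m = 0 -> rdot z n = 0 -> z = 0.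
Proof.
move=> [nn ns [a [a0 nE av]]] zs zm zn; apply: (facet_full card_flag tai mm mt) => //.
have [u0 u0s] := ridge_vertex.
have zv : rdot z (p v - p u0) = 0.
  have := dot_comb zs u0s a0; rewrite -nE zn => /esym/eqP.
  by rewrite mulf_eq0 gt_eqF//= => /eqP.
have zu u : u \in t -> rdot z (p u) = rdot z (p u0).
  rewrite !inE => /orP[/eqP->|us]; apply/eqP; rewrite -subr_eq0 -rdotBr ?zv//.
  by rewrite zs.
by move=> u w ut wt; rewrite rdotBr !zu// subrr.
Qed.

Lemma plane_decomp n x : inner_unit n -> perp p s x -> x = rdot x n *: n + rdot x m *: m.
Proof.
move=> nI xs; have nm := inner_perp nI; have [nn ns _] := nI.
apply/eqP; rewrite -subr_eq0; apply/eqP; apply: (flag_full nI).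
- move=> u w us ws; rewrite rdotBl rdotDl !rdotZl xs// ns//.
  by rewrite (perp_ridge mt)// !mulr0 addr0 subrr.
- by rewrite rdotBl rdotDl !rdotZl nm mm mulr0 mulr1 add0r subrr.
- by rewrite rdotBl rdotDl !rdotZl nn (rdotC m) nm mulr0 mulr1 addr0 subrr.
Qed.

Lemma inner_exists : exists n, inner_unit n.
Proof.
have [q qs] := exists_tuple sd.
have [x xx xD] := exists_normal (col_mx m (edge_mx p q) : 'M[R]_(d.+1, d.+2)).
have xm : rdot x m = 0.
  by rewrite -(xD ord0) row_col_mx_ord0.
have xs : perp p s x.
  by apply/(perp_edge_mx p x qs) => i; rewrite -(xD (lift ord0 i)) row_col_mx_lift.
have [a [a0 xE]] := tangent_comb card_flag tai mm mt xm.
have [u0 u0s] := ridge_vertex.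
have av : a v != 0.
  have := dot_comb xs u0s a0; rewrite -xE xx => e; apply: contra_eq_neq e => ->.
  by rewrite mul0r oner_eq0.
have [av_gt|av_lt] := ltP 0 (a v); first by exists x; split=> //; exists a.
exists (- x); split; first by rewrite rdotNl rdotNr opprK.
  by move=> u w us ws; rewrite rdotNl xs// oppr0.
exists (fun u => - a u); split; first by rewrite sumrN a0 oppr0.
  by rewrite xE -sumrN; apply: eq_bigr => u _; rewrite scaleNr.
by rewrite oppr_gt0 lt_neqAle av.
Qed.

Lemma inner_unique n n' : inner_unit n -> inner_unit n' -> n' = n.
Proof.
move=> nI n'I; have [nn' ns' [a [a0 n'E av]]] := n'I; have [nn ns _] := nI.
have [u0 u0s] := ridge_vertex.
have e := plane_decomp nI ns'; rewrite (inner_perp n'I) scale0r addr0 in e.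
set k := rdot n' n in e.
have k0 : 0 < k.
  by rewrite /k {1}n'E rdotC (dot_comb ns u0s a0) mulr_gt0// inner_height.
have kk : k ^+ 2 = 1 ^+ 2 by rewrite expr1n -nn' e rdotZl rdotZr nn mulr1 expr2.
have k1 : k = 1.
  by apply/eqP; rewrite -(@eqrXn2 _ 2)// ?ltW// kk.
by rewrite e k1 scale1r.
Qed.

Lemma det2_neq0 n q : inner_unit n -> [set u in q] = s -> det2 m n (edge_mx p q) != 0.
Proof.
move=> nI qs; rewrite /det2 -det_tr -unitfE -unitmxE -row_free_unit.
apply: inj_row_free => z z0.
have zr i : rdot z (row i (col_mx m (col_mx n (edge_mx p q)) : 'M[R]_d.+2)) = 0.
  by rewrite -mulmx_tr_rdot z0 mxE.
apply: (flag_full nI).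
- apply/(perp_edge_mx p z qs) => i.
  by have := zr (lift ord0 (lift ord0 i)); rewrite !row_col_mx_lift.
- by have := zr ord0; rewrite row_col_mx_ord0.
by have := zr (lift ord0 ord0); rewrite row_col_mx_lift row_col_mx_ord0.
Qed.

(** Base times height: subtracting rows replaces the edges from v by one of them and
the edges of the ridge, and of the former only the component along n, minus the
height of v above the ridge, contributes to the determinant. *)
Lemma det_flag n q : inner_unit n -> [set u in q] = s ->
  facet_det p [tuple of v :: q] m =
  - (rdot n (p v - p (tnth q ord0)) * det2 m n (edge_mx p q)).
Proof.
move=> nI qs; have [nn ns _] := nI; have nm := inner_perp nI.
set y := p (tnth q ord0) - p v.
have -> : facet_det p [tuple of v :: q] m = det2 m y (edge_mx p q).
  pose L : 'M[R]_d.+1 := block_mx (1%:M : 'M[R]_1) 0 (const_mx 1) (1%:M : 'M[R]_d).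
  pose L' : 'M[R]_d.+2 := block_mx (1%:M : 'M[R]_1) 0 0 L.
  have emE : edge_mx p [tuple of v :: q] = L *m (col_mx y (edge_mx p q) : 'M[R]_(d.+1, d.+2)).
    transitivity (col_mx (1%:M *m y + 0 *m edge_mx p q) (const_mx 1 *m y + 1%:M *m edge_mx p q)
      : 'M[R]_(d.+1, d.+2)); last first.
      by symmetry; exact: (@mul_block_col R 1 d 1 d d.+2 1%:M 0 (const_mx 1) 1%:M y (edge_mx p q)).
    apply/row_matrixP => i; rewrite row_edge_mx !tnthS tnth0.
    case: (unliftP ord0 i) => [l|] ->.
      rewrite row_col_mx_lift; apply/rowP => j; rewrite !mxE big_ord1 !mxE mul1r.
      rewrite (eq_bigr (fun l0 => (l == l0)%:R * edge_mx p q l0 j)) => [|l0 _]; last by rewrite !mxE.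
      rewrite (bigD1 l)//= big1 ?addr0 => [|l0 ll0]; last by rewrite eq_sym (negbTE ll0) mul0r.
      by rewrite eqxx mul1r !mxE; ring.
    by rewrite row_col_mx_ord0 mul1mx mul0mx addr0.
  rewrite /facet_det emE /det2.
  have -> : (col_mx m (L *m (col_mx y (edge_mx p q) : 'M[R]_(d.+1, d.+2))) : 'M[R]_d.+2) =
     L' *m (col_mx m (col_mx y (edge_mx p q)) : 'M[R]_d.+2).
    transitivity (col_mx (1%:M *m m + 0 *m (col_mx y (edge_mx p q) : 'M[R]_(d.+1, d.+2)))
      (0 *m m + L *m (col_mx y (edge_mx p q) : 'M[R]_(d.+1, d.+2))) : 'M[R]_d.+2).
      by rewrite mul1mx !mul0mx addr0 add0r.
    by symmetry; exact: (@mul_block_col R 1 d.+1 1 d.+1 d.+2 1%:M 0 0 L m (col_mx y (edge_mx p q))).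
  by rewrite det_mulmx (@det_ublock _ 1 d.+1) (@det_lblock _ 1 d) !det1 !mul1r.
have mD : forall i, rdot m (row i (edge_mx p q)) = 0.
  by apply/(perp_edge_mx p m qs); exact: perp_ridge.
have nD : forall i, rdot n (row i (edge_mx p q)) = 0 by apply/(perp_edge_mx p n qs).
apply: (mulIf (det2_neq0 nI qs)); rewrite mulNr -mulrA !gram2//.
rewrite mm nn (rdotC m n) nm !mul1r mul0r subr0.
rewrite /y (rdotC _ n) !rdotBr; ring.
Qed.

Lemma det2_sqr n q : inner_unit n -> [set u in q] = s ->
  det2 m n (edge_mx p q) ^+ 2 = \det (edge_mx p q *m (edge_mx p q)^T).
Proof.
move=> nI qs; have [nn ns _] := nI; have nm := inner_perp nI.
have mD : forall i, rdot m (row i (edge_mx p q)) = 0.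
  by apply/(perp_edge_mx p m qs); exact: perp_ridge.
have nD : forall i, rdot n (row i (edge_mx p q)) = 0 by apply/(perp_edge_mx p n qs).
by rewrite expr2 gram2// mm nn (rdotC m n) nm !mul1r mul0r subr0 mul1r.
Qed.
End Normal.
End Flag.

(** * Volumes and the balance of a facet *)

Section Volume.
Variables (R : realType) (V : finType) (d : nat) (p : V -> 'rV[R]_d.+2).
Implicit Types (s t : {set V}) (v u : V) (q : d.+1.-tuple V) (w : d.+2.-tuple V).

Definition vol s : R := simplex_vol [seq p u | u <- enum s].

Lemma simplex_vol_nth N (e : seq 'rV[R]_N) k : size e = k.+1 ->
  simplex_vol e = Num.sqrt (\det ((\matrix_(i < k) (e`_i.+1 - e`_0)) *m
     (\matrix_(i < k) (e`_i.+1 - e`_0))^T)) / (k`!)%:R.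
Proof. by case: e => // x e [<-]. Qed.

Lemma vol_gram s q : [set u in q] = s -> #|s| = d.+1 -> val q = enum s ->
  vol s = Num.sqrt (\det (edge_mx p q *m (edge_mx p q)^T)) / (d`!)%:R.
Proof.
move=> qs sd qE; rewrite /vol (@simplex_vol_nth _ _ d); last by rewrite size_map -cardE.
have -> : \matrix_(i < d) ([seq p u | u <- enum s]`_i.+1 - [seq p u | u <- enum s]`_0)
    = edge_mx p q; last by [].
apply/row_matrixP => i; rewrite row_edge_mx rowK.
have [x0 _] : exists x0 : V, True by exists (tnth q ord0).
by rewrite !(tnth_nth x0) /= -qE !(nth_map x0) ?size_tuple ?ltnS.
Qed.

Lemma exists_enum_tuple s : #|s| = d.+1 -> exists2 q : d.+1.-tuple V, [set u in q] = s & val q = enum s.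
Proof.
move=> sd; have st : size (enum s) == d.+1 by rewrite -cardE sd.
by exists (Tuple st) => //; apply/setP => v; rewrite inE mem_enum.
Qed.

Section FacetVolume.
Variables (t : {set V}) (m : 'rV[R]_d.+2).
Hypotheses (td : #|t| = d.+2) (tai : aff_indep p t) (mm : rdot m m = 1) (mt : perp p t m).

Lemma abs_facet_det w w' : [set u in w] = t -> [set u in w'] = t ->
  `|facet_det p w m| = `|facet_det p w' m|.
Proof.
move=> wt w't; have [s ->] : exists s : 'S_d.+2, w' = [tuple tnth w (s i) | i < d.+2].
  by apply: same_set_perm; rewrite wt.
rewrite /facet_det (facet_det_perm td tai mm mt _ wt) normrM.
by case: (odd_perm s); rewrite ?expr0 ?expr1 ?normrN normr1 mul1r.
Qed.

(** Base times height is the same for all vertices v of the facet: it is the volume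
of the facet up to a constant factor. *)
Lemma vol_height v u n w : v \in t -> inner_unit p (t :\ v) v n -> u \in t :\ v ->
  [set u in w] = t ->
  vol (t :\ v) * rdot n (p v - p u) = `|facet_det p w m| / (d`!)%:R.
Proof.
move=> vt nI us wt.
have sd : #|t :\ v| = d.+1 by have := cardsD1 v t; rewrite vt td => -[].
have vs : v \notin t :\ v by rewrite finset.setD11.
have tE : v |: (t :\ v) = t by rewrite finset.setD1K.
have [q qs qE] := exists_enum_tuple sd.
have tai' : aff_indep p (v |: (t :\ v)) by rewrite tE.
have mt' : perp p (v |: (t :\ v)) m by rewrite tE.
have qt : [set x in [tuple of v :: q]] = t.
  by rewrite -tE -qs; apply/setP => x; rewrite !inE.
rewrite (abs_facet_det wt qt) (vol_gram qs)// (det_flag sd vs tai' mm mt' nI qs).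
rewrite normrN normrM -(det2_sqr mm mt' nI qs) sqrtr_sqr.
have q0s : tnth q ord0 \in t :\ v by rewrite -qs inE mem_tnth.
have -> : rdot n (p v - p u) = rdot n (p v - p (tnth q ord0)).
  have [_ ns _] := nI; have := ns _ _ us q0s.
  by rewrite !rdotBr => /eqP; rewrite subr_eq0 => /eqP ->.
rewrite (gtr0_norm (inner_height vs nI q0s)); ring.
Qed.

(** The sum is orthogonal to m, and it is orthogonal to the edge from b to a since
only the terms of a and of b contribute there: they are plus and minus base times
height. By [facet_full] it vanishes. *)
Lemma minkowski (n : V -> 'rV[R]_d.+2) :
  (forall v, v \in t -> inner_unit p (t :\ v) v (n v)) ->
  \sum_(v in t) vol (t :\ v) *: n v = 0.
Proof.
move=> nI; set X := \sum_(v in t) _; apply: (facet_full td tai mm mt); last first.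
  rewrite rdot_suml big1// => v vt; rewrite rdotZl.
  have tE : v |: (t :\ v) = t by rewrite finset.setD1K.
  by rewrite (@inner_perp _ _ _ p (t :\ v) v) ?tE ?mulr0//; exact: nI.
have [w wt] := exists_tuple td.
move=> a b at_ bt; have [->|ab] := eqVneq a b; first by rewrite subrr rdot0r.
rewrite rdot_suml (bigD1 a)//= (bigD1 b) ?bt//=; last by rewrite eq_sym.
rewrite big1 ?addr0 => [|c /andP[/andP[ct ca] cb]]; last first.
  have [_ ns _] := nI c ct; rewrite rdotZl ns ?mulr0// !inE ?at_ ?bt.
    by rewrite eq_sym ca.
  by rewrite eq_sym cb.
rewrite !rdotZl (vol_height at_ (nI a at_) _ wt); last by rewrite !inE eq_sym ab bt.
rewrite -opprB rdotNr mulrN (vol_height bt (nI b bt) _ wt); last by rewrite !inE ab at_.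
by rewrite subrr.
Qed.
End FacetVolume.
End Volume.

(** * Two facets at a common ridge *)

Section Hinge.
Variables (R : realType) (V : finType) (d : nat) (p : V -> 'rV[R]_d.+2).
Variables (o : pred (d.+2.-tuple V)) (s : {set V}).
Hypothesis (sd : #|s| = d.+1).
Implicit Types (v : V) (q : d.+1.-tuple V) (m n : 'rV[R]_d.+2).

Definition orient_sym (t : {set V}) := forall (w : d.+2.-tuple V) (s : 'S_d.+2),
  [set v in w] = t -> o [tuple tnth w (s i) | i < d.+2] = o w (+) odd_perm s.

(** The orientation of the facet decides whether m, n and the edges of the ridge form
a positive basis. *)
Lemma det2_sign v m n q : v \notin s -> aff_indep p (v |: s) ->
  orient_sym (v |: s) -> pos_normal p o (v |: s) m ->
  inner_unit p s v n -> [set u in q] = s ->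
  det2 m n (edge_mx p q) = (-1) ^+ o [tuple of v :: q] *
     Num.sqrt (\det (edge_mx p q *m (edge_mx p q)^T)).
Proof.
move=> vs tai ot mpos nI qs; have [mm mt _] := mpos.
have tdd := card_flag sd vs.
rewrite -(det2_sqr mm mt nI qs) sqrtr_sqr.
have qt : [set x in [tuple of v :: q]] = v |: s.
  by rewrite -qs; apply/setP => x; rewrite !inE.
have q0s : tnth q ord0 \in s by rewrite -qs inE mem_tnth.
have := pos_normal_sign tdd tai ot mpos qt.
rewrite (det_flag sd vs tai mm mt nI qs); have h := inner_height vs nI q0s.
case: ifP => _; rewrite ?oppr_gt0 ?oppr_lt0 ?pmulr_rlt0 ?pmulr_rgt0// => D0.
  by rewrite (ltr0_norm D0) expr1 mulN1r opprK.
by rewrite (gtr0_norm D0) expr0 mul1r.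
Qed.

Variables (v1 v2 : V) (m1 m2 n1 n2 : 'rV[R]_d.+2).
Hypotheses (vs1 : v1 \notin s) (vs2 : v2 \notin s).
Hypotheses (tai1 : aff_indep p (v1 |: s)) (tai2 : aff_indep p (v2 |: s)).
Hypotheses (ot1 : orient_sym (v1 |: s)) (ot2 : orient_sym (v2 |: s)).
Hypotheses (m1P : pos_normal p o (v1 |: s) m1) (m2P : pos_normal p o (v2 |: s) m2).
Hypotheses (n1I : inner_unit p s v1 n1) (n2I : inner_unit p s v2 n2).
Hypothesis o12 : forall q, [set u in q] = s ->
  o [tuple of v1 :: q] = ~~ o [tuple of v2 :: q].

Local Notation c := (rdot n1 n2).
Local Notation sn := (- rdot n2 m1).

Lemma hinge_n2 : n2 = c *: n1 - sn *: m1.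
Proof.
have [mm1 mt1 _] := m1P; have [_ ns2 _] := n2I.
by rewrite {1}(plane_decomp sd vs1 tai1 mm1 mt1 n1I ns2) (rdotC n2) scaleNr opprK.
Qed.

Lemma hinge_cs : c ^+ 2 + sn ^+ 2 = 1.
Proof.
have [mm1 mt1 _] := m1P; have [nn1 _ _] := n1I; have [nn2 _ _] := n2I.
have nm1 := inner_perp mt1 n1I.
rewrite -[RHS]nn2; transitivity (rdot (c *: n1 - sn *: m1) (c *: n1 - sn *: m1)).
  by rewrite !(rdotBl, rdotBr, rdotZl, rdotZr) nn1 mm1 (rdotC m1) nm1; ring.
by rewrite -hinge_n2.
Qed.

(** In the plane orthogonal to the ridge, m2 is a unit vector orthogonal to n2, hence
m2 is c m1 + sn n1 up to sign. Adjacent facets induce opposite orientations on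
the ridge, so that (m1, n1) and (m2, n2) have opposite orientations, and the
sign is negative. *)
Lemma hinge_m2 : m2 = - (c *: m1) - sn *: n1.
Proof.
have [mm1 mt1 _] := m1P; have [nn1 _ _] := n1I; have [nn2 ns2 _] := n2I.
have [mm2 mt2 _] := m2P.
have nm1 := inner_perp mt1 n1I; have nm2 := inner_perp mt2 n2I.
have [q qs] := exists_tuple sd.
have D1 := det2_sign vs1 tai1 ot1 m1P n1I qs.
have D2 := det2_sign vs2 tai2 ot2 m2P n2I qs.
have D12 : det2 m2 n2 (edge_mx p q) = - det2 m1 n1 (edge_mx p q).
  by rewrite D1 D2 (o12 qs); case: (o _); rewrite ?expr0 ?expr1 mulN1r mul1r ?opprK.
have mD1 : forall i, rdot m1 (row i (edge_mx p q)) = 0.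
  by apply/(perp_edge_mx p m1 qs) => u w us ws; apply: mt1; rewrite setU1r.
have nD1 : forall i, rdot n1 (row i (edge_mx p q)) = 0.
  by apply/(perp_edge_mx p n1 qs); case: n1I.
have G := gram2 m2 n2 mD1 nD1.
rewrite D12 mulNr -expr2 -[\det (_ *m _)](det2_sqr mm1 mt1 n1I qs) in G.
have D0 : det2 m1 n1 (edge_mx p q) ^+ 2 != 0.
  by rewrite expf_neq0// (det2_neq0 sd vs1 tai1 mm1 mt1 n1I qs).
have {}G : rdot m2 m1 * c + rdot m2 n1 * sn = -1.
  by apply: (mulIf D0); rewrite mulN1r G (rdotC n2 n1); ring.
have ms2 : perp p s m2 by move=> u w us ws; apply: mt2; rewrite setU1r.
have m2E := plane_decomp sd vs1 tai1 mm1 mt1 n1I ms2.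
set al := rdot m2 m1 in G m2E *; set be := rdot m2 n1 in G m2E *.
have ab : be * c - al * sn = 0.
  transitivity (rdot (c *: n1 - sn *: m1) (be *: n1 + al *: m1)).
    by rewrite !(rdotBl, rdotDr, rdotZl, rdotZr) nn1 mm1 (rdotC m1) nm1; ring.
  by rewrite -hinge_n2 -m2E nm2.
have cs := hinge_cs.
rewrite m2E; have -> : al = - c.
  transitivity (al * (c ^+ 2 + sn ^+ 2)); first by rewrite cs mulr1.
  transitivity ((al * c + be * sn) * c - sn * (be * c - al * sn)); first by ring.
  by rewrite G ab mulr0 subr0 mulN1r.
have -> : be = - sn.
  transitivity (be * (c ^+ 2 + sn ^+ 2)); first by rewrite cs mulr1.
  transitivity ((al * c + be * sn) * sn + c * (be * c - al * sn)); first by ring.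
  by rewrite G ab mulr0 addr0 mulN1r.
by rewrite !scaleNr addrC.
Qed.

(** The sine in terms of n1, n2 and the edges of the ridge alone; the other factor on
the left is, up to sign, determined by the lengths of these edges. This makes the sine a
continuous function of the positions of the vertices. *)
Lemma hinge_sin q : [set u in q] = s ->
  sn * ((-1) ^+ o [tuple of v1 :: q] * Num.sqrt (\det (edge_mx p q *m (edge_mx p q)^T))) =
  - det2 n2 n1 (edge_mx p q).
Proof.
move=> qs; have [mm1 mt1 _] := m1P; have [nn1 ns1 _] := n1I.
have nm1 := inner_perp mt1 n1I.
have mD1 : forall i, rdot m1 (row i (edge_mx p q)) = 0.
  by apply/(perp_edge_mx p m1 qs) => u w us ws; apply: mt1; rewrite setU1r.
have nD1 : forall i, rdot n1 (row i (edge_mx p q)) = 0 by apply/(perp_edge_mx p n1 qs).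
rewrite -(det2_sign vs1 tai1 ot1 m1P n1I qs).
apply: (mulIf (det2_neq0 sd vs1 tai1 mm1 mt1 n1I qs)).
rewrite [RHS]mulNr gram2// -mulrA -expr2 (det2_sqr mm1 mt1 n1I qs) nm1 nn1.
ring.
Qed.
End Hinge.

(** * Polyhedral maps in barycentric coordinates *)

Section Barycentric.
Variables (R : realType) (V : finType).
Implicit Types (s t : {set V}) (x : {ptws V -> R}).

Lemma geom_vertex s v : v \in s -> geom_simplex s (vertex R v).
Proof.
move=> vs; split=> [w||w ws].
- by rewrite /vertex ler0n.
- rewrite (bigD1 v)//= /vertex eqxx big1 ?addr0// => w wv.
  by rewrite (negbTE wv).
by rewrite /vertex; case: eqP => // e; rewrite e vs in ws.
Qed.

Lemma geom_sum s x : geom_simplex s x -> \sum_(v in s) x v = 1.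
Proof.
move=> [_ <- x0]; rewrite [RHS](bigID (mem s)) /= [X in _ = _ + X]big1 ?addr0//.
Qed.

(** By induction on the number of nonzero barycentric coordinates of x, splitting off
one vertex at a time, since [polyhedron] concerns convex combinations of two
points. *)
Lemma polyhedron_affine n (K : {set {set V}}) (P : {ptws V -> R} -> 'rV[R]_n) s x :
  polyhedron K P -> s \in K -> geom_simplex s x ->
  P x = \sum_(v in s) x v *: P (vertex R v).
Proof.
move=> HP sK; have [k] := ubnP #|[set v | (x v != 0)%R]%SET|; elim: k x => // k IH x.
rewrite ltnS => xk gx; have [x0 x1 xs] := gx.
have [v xv] : exists v, x v != 0.
  apply: contrapT => nx; have : \sum_v x v == 0.
    by rewrite big1// => v _; apply/eqP/negPn/negP => xv; apply: nx; exists v.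
  by rewrite x1 oner_eq0.
have vs : v \in s by apply: contraT => /xs e; rewrite e eqxx in xv.
have x1E : x v + \sum_(w | w != v) x w = 1 by rewrite -x1 [RHS](bigD1 v).
have rest0 : 0 <= \sum_(w | w != v) x w by rewrite sumr_ge0.
have [xv1|xv1] := eqVneq (x v) 1.
  have xw w : w != v -> x w = 0.
    move=> wv; have /eqP : \sum_(w | w != v) x w = 0.
      by apply: (addrI (x v)); rewrite x1E addr0 xv1.
    by rewrite psumr_eq0// => /allP/(_ w (mem_index_enum w)); rewrite wv => /eqP.
  rewrite (bigD1 v)//= xv1 scale1r big1 ?addr0 => [|w /andP[_ wv]]; last by rewrite xw ?scale0r.
  congr P; apply/funext => w; rewrite /vertex.
  by have [->|wv] := eqVneq w v; rewrite ?xv1// xw.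
have xvl : x v < 1 by rewrite lt_neqAle xv1 -x1E lerDl.
pose r := 1 - x v; have r0 : 0 < r by rewrite subr_gt0.
pose y : {ptws V -> R} := fun w => if w == v then 0 else x w / r.
have gy : geom_simplex s y.
  split=> [w||w ws].
  - by rewrite /y; case: ifP => // _; rewrite divr_ge0// ltW.
  - rewrite (bigD1 v)//= {1}/y eqxx add0r.
    rewrite (eq_bigr (fun w => x w / r)) => [|w wv]; last by rewrite /y (negbTE wv).
    rewrite -mulr_suml; have -> : \sum_(w | w != v) x w = r by rewrite /r -x1E addrC addKr.
    by rewrite divff// gt_eqF.
  by rewrite /y; case: ifP => // _; rewrite xs// mul0r.
have yk : (#|[set w | (y w != 0)%R]%SET| < k)%N.
  apply: leq_trans xk; apply: proper_card; apply/properP; split.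
    apply/fintype.subsetP => w; rewrite !inE /y /=.
    have [_|_] := eqVneq w v; first by rewrite eqxx.
    by apply: contra_neq => ->; rewrite mul0r.
  by exists v; rewrite !inE// /y eqxx eqxx.
have xE : x = (fun w => x v * vertex R v w + (1 - x v) * y w).
  apply/funext => w; rewrite /vertex /y -/r; have [->|wv] := eqVneq w v.
    by rewrite mulr1 mulr0 addr0.
  by rewrite mulr0 add0r mulrC divfK// gt_eqF.
rewrite {1}xE (HP s sK _ _ (geom_vertex vs) gy); last by rewrite (x0 v) ltW.
rewrite (IH _ yk gy) -/r [RHS](bigD1 v)//=; congr (_ + _).
rewrite scaler_sumr (bigD1 v)//= {1}/y eqxx scale0r scaler0 add0r.
apply: eq_bigr => w /andP[_ wv]; rewrite scalerA /y (negbTE wv) mulrC divfK//.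
by rewrite gt_eqF.
Qed.
End Barycentric.

Section Bridge.
Variables (R : realType) (V : finType) (d : nat) (K : {set {set V}}).
Variables (P : {ptws V -> R} -> 'rV[R]_d.+2).
Hypotheses (HP : polyhedron K P) (Hnd : nondegenerate_faces K P).
Local Notation p := (fun v => P (vertex R v)).
Implicit Types (s t : {set V}) (u m : 'rV[R]_d.+2).

Lemma enorm1 (u : 'rV[R]_d.+2) : (enorm u = 1) <-> (rdot u u = 1).
Proof.
have e : dotp u u = rdot u u by [].
rewrite /enorm e; split=> [u1|->]; last exact: sqrtr1.
by rewrite -[LHS]sqr_sqrtr ?rdot_ge0// u1 expr1n.
Qed.

Lemma nondegenerate_aff s : s \in K -> aff_indep p s.
Proof. by move=> sK; exact: Hnd. Qed.

Lemma orthogonal_perp s u : s \in K -> orthogonal_to P s u <-> perp p s u.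
Proof.
move=> sK; split=> [us v w vs ws|us x y xs ys].
  by apply: us; exact: geom_vertex.
rewrite (polyhedron_affine HP sK xs) (polyhedron_affine HP sK ys) -sumrB.
under eq_bigr do rewrite -scalerBl.
by apply: perp_sum us _; rewrite sumrB !(geom_sum (R := R) (s := s))// subrr.
Qed.

Lemma positive_normalE (o : pred (d.+2.-tuple V)) t m : t \in K ->
  positive_normal o P t m <-> pos_normal p o t m.
Proof.
move=> tK; split=> -[/enorm1 mm /(orthogonal_perp _ tK) mt mw].
  by split.
by split.
Qed.

(** A vector from a point of the ridge to a point of the facet has a weight a v >= 0,
and a v = 0 is impossible, as u would then be tangent and orthogonal to the
ridge. *)
Lemma inner_normal_inner s v u : v |: s \in K -> s \in K -> v \notin s ->
  inner_normal P s (v |: s) u -> inner_unit p s v u.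
Proof.
move=> tK sK vs [/enorm1 uu /(orthogonal_perp _ sK) us [x [y [e [xs yt e0 xy]]]]].
have [y0 _ yz] := yt; have [x0 _ xz] := xs.
have xt : geom_simplex (v |: s) x.
  by case: xs => ? ? ?; split=> // w wt; apply: xz; apply: contra wt; exact: setU1r.
pose a w := (y w - x w) / e.
have a0 : \sum_(w in v |: s) a w = 0.
  by rewrite -mulr_suml sumrB (geom_sum xt) (geom_sum yt) subrr mul0r.
have uE : u = \sum_(w in v |: s) a w *: p w.
  have -> : u = e^-1 *: (P y - P x).
    by rewrite -xy addrC addKr scalerA mulVf ?scale1r// gt_eqF.
  rewrite (polyhedron_affine HP tK xt) (polyhedron_affine HP tK yt) -sumrB scaler_sumr.
  by apply: eq_bigr => w _; rewrite -scalerBl scalerA mulrC.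
split=> //; exists a; split=> //.
have av : 0 <= a v by rewrite /a xz// subr0 divr_ge0// ltW.
rewrite lt_def av andbT; apply/eqP => av0.
have [s0|[w ws]] := set_0Vmem s.
  have := uE; rewrite s0 finset.setU0 big_set1 av0 scale0r => u0.
  by move/eqP: uu; rewrite u0 rdot0l eq_sym oner_eq0.
have := dot_comb (p := p) vs us ws a0; rewrite -uE uu av0 mul0r => /eqP.
by rewrite oner_eq0.
Qed.

(** From the barycentre of the ridge a short step along u stays in the facet, because
all barycentric coordinates on the ridge are positive there. *)
Lemma inner_inner_normal s v u : v |: s \in K -> s \in K -> v \notin s ->
  (0 < #|s|)%N -> inner_unit p s v u -> inner_normal P s (v |: s) u.
Proof.
move=> tK sK vs s0 [uu us [a [a0 uE av]]]; split; first exact/enorm1.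
  exact/orthogonal_perp.
pose b : R := (#|s|%:R)^-1; have b0 : 0 < b by rewrite invr_gt0 ltr0n.
pose A : R := 1 + \sum_(w in v |: s) `|a w|.
have A0 : 0 < A by rewrite ltr_pwDl// sumr_ge0.
pose e := b / A; have e0 : 0 < e by rewrite divr_gt0.
pose x : {ptws V -> R} := fun w => if w \in s then b else 0.
pose y : {ptws V -> R} := fun w => x w + (if w \in v |: s then e * a w else 0).
have xs : geom_simplex s x.
  split=> [w||w /negbTE ws]; rewrite /x ?ws//; first by case: ifP => // _; exact: ltW.
  by rewrite -big_mkcond /= sumr_const -mulr_natr mulVf// pnatr_eq0 -lt0n.
have eaw w : w \in v |: s -> `|e * a w| <= b.
  move=> wt; rewrite normrM (gtr0_norm e0) /e mulrAC ler_pdivrMr// ler_pM2l//.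
  by rewrite /A (bigD1 w)//= addrCA lerDl addr_ge0// sumr_ge0.
have yt : geom_simplex (v |: s) y.
  split=> [w||w wt].
  - rewrite /y /x; case: ifP => ws.
      rewrite setU1r//; have := eaw w (setU1r _ ws); rewrite ler_norml => /andP[h _].
      by rewrite -lerBlDl sub0r.
    rewrite add0r !inE ws orbF; case: eqP => // ->.
    by rewrite mulr_ge0// ltW.
  - rewrite big_split /= -[X in _ + X]big_mkcond /= -mulr_sumr a0 mulr0 addr0.
    by case: xs.
  by rewrite /y /x (negbTE wt) addr0 ifN//; apply: contra wt; exact: setU1r.
exists x, y, e; split=> //.
have xt : geom_simplex (v |: s) x.
  by case: xs => ? ? xz; split=> // w wt; apply: xz; apply: contra wt; exact: setU1r.
rewrite (polyhedron_affine HP tK xt) (polyhedron_affine HP tK yt) uE scaler_sumr.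
rewrite -big_split; apply: eq_bigr => w wt /=.
by rewrite /y wt scalerDl scalerA.
Qed.
End Bridge.

(** * Ridges of a pseudo-manifold and their dihedral angles *)

Lemma cos_sin_exists (R : realType) (c s : R) : c ^+ 2 + s ^+ 2 = 1 ->
  exists theta, cos theta = c /\ sin theta = s.
Proof.
move=> cs; have c1 : -1 <= c <= 1.
  by rewrite -ler_norml -(@expr_le1 _ 2)// real_normK ?num_real// -cs lerDl sqr_ge0.
have s2 : Num.sqrt (1 - c ^+ 2) = `|s| by rewrite -cs addrC addKr sqrtr_sqr.
have [s0|s0] := leP 0 s.
  exists (acos c); rewrite acosK ?in_itv//= sin_acos// s2.
  by rewrite ger0_norm.
exists (- acos c); rewrite cosN sinN acosK ?in_itv//= sin_acos// s2.
by rewrite ltr0_norm// opprK.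
Qed.

Section Ridges.
Variables (R : realType) (V : finType) (d : nat) (K : {set {set V}}).
Variables (o : pred (d.+2.-tuple V)).
Hypotheses (HK : pseudo_manifold R d.+1 K) (Ho : orientation K o).
Implicit Types (s t : {set V}) (v : V).

(** The facets at the ridge s are v1 |: s and v2 |: s. *)
Definition hinge s v1 v2 := [/\ v1 != v2, v1 \notin s, v2 \notin s,
  v1 |: s \in faces d.+1 K /\ v2 |: s \in faces d.+1 K
  & forall t, t \in faces d.+1 K -> s \subset t -> t = v1 |: s \/ t = v2 |: s].

Lemma ridge_in s : s \in faces d K -> s \in K /\ #|s| = d.+1.
Proof. by rewrite inE => /andP[sK /eqP]. Qed.
Lemma facet_in t : t \in faces d.+1 K -> t \in K /\ #|t| = d.+2.
Proof. by rewrite inE => /andP[tK /eqP]. Qed.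

Lemma facet_over_ridge s t : #|s| = d.+1 -> t \in faces d.+1 K -> s \subset t ->
  exists2 v, v \notin s & t = v |: s.
Proof.
move=> sd /facet_in[_ td] st.
have : #|t :\: s| = 1%N by rewrite cardsD (finset.setIidPr st) td sd subSnn.
move/eqP/cards1P => [v vE]; exists v.
  have : v \in t :\: s by rewrite vE finset.set11.
  by rewrite !inE => /andP[].
by rewrite -[t](finset.setID _ s) (finset.setIidPr st) vE finset.setUC.
Qed.

Lemma ridge_hinge s : s \in faces d K -> exists v1 v2, hinge s v1 v2.
Proof.
move=> /ridge_in[sK sd]; have [_ _ /(_ s sK sd)/eqP/cards2P[t1 [t2 [t12 tE]]] _] := HK.
have inE' t : (t \in faces d.+1 K) && (s \subset t) = (t == t1) || (t == t2).
  by move/finset.setP/(_ t): tE; rewrite !inE.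
have /andP[t1K st1] : (t1 \in faces d.+1 K) && (s \subset t1) by rewrite inE' eqxx.
have /andP[t2K st2] : (t2 \in faces d.+1 K) && (s \subset t2) by rewrite inE' eqxx orbT.
have [v1 v1s t1E] := facet_over_ridge sd t1K st1.
have [v2 v2s t2E] := facet_over_ridge sd t2K st2.
exists v1, v2; split=> //.
- by apply: contra_neq t12 => e; rewrite t1E t2E e.
- by rewrite -t1E -t2E.
move=> t tK st; have : (t \in faces d.+1 K) && (s \subset t) by rewrite tK.
by rewrite inE' -t1E -t2E => /orP[/eqP|/eqP]; [left|right].
Qed.

Lemma facet_orient t : t \in faces d.+1 K -> orient_sym o t.
Proof. by move=> tK w p wt; apply: Ho.1; rewrite wt. Qed.

Lemma hinge_orient s v1 v2 (q : d.+1.-tuple V) : hinge s v1 v2 -> [set u in q] = s ->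
  o [tuple of v1 :: q] = ~~ o [tuple of v2 :: q].
Proof.
move=> [v12 _ _ [t1K t2K] _] qs.
have qE v : [set u in v :: q] = v |: s.
  by rewrite -qs; apply/finset.setP => u; rewrite !inE.
by apply: Ho.2; rewrite ?qE.
Qed.

Section AtTime.
Variable P : {ptws V -> R} -> 'rV[R]_d.+2.
Hypotheses (HP : polyhedron K P) (Hnd : nondegenerate_faces K P).
Local Notation p := (fun v => P (vertex R v)).

Definition facet_normal t : 'rV[R]_d.+2 := xget 0 [set m | pos_normal p o t m].
Definition flag_normal s t : 'rV[R]_d.+2 :=
  xget 0 [set n | exists v, [/\ v \notin s, t = v |: s & inner_unit p s v n]].

Lemma facet_normalP t : t \in faces d.+1 K -> pos_normal p o t (facet_normal t).
Proof.
move=> tF; have [tK td] := facet_in tF.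
have [m mP] := pos_normal_exists td (nondegenerate_aff Hnd tK) (facet_orient tF).
exact: (@xgetPex _ 0 [set m | pos_normal p o t m] (ex_intro _ m mP)).
Qed.

Lemma setU1_inj s v v' : v \notin s -> v' \notin s -> v |: s = v' |: s -> v = v'.
Proof.
move=> vs v's e; have : v \in v' |: s by rewrite -e setU11.
by rewrite !inE (negbTE vs) orbF => /eqP.
Qed.

Lemma flag_normalP s v : #|s| = d.+1 -> v \notin s -> v |: s \in faces d.+1 K ->
  inner_unit p s v (flag_normal s (v |: s)).
Proof.
move=> sd vs tF; have [tK td] := facet_in tF.
have [mm mt _] := facet_normalP tF.
have [n nI] := inner_exists sd vs (nondegenerate_aff Hnd tK) mm mt.
have ex : exists n, [set n | exists v', [/\ v' \notin s, v |: s = v' |: s & inner_unit p s v' n]] n.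
  by exists n, v.
have [v' [v's /(setU1_inj vs v's) -> //]] := xgetPex 0 ex.
Qed.

Lemma inner_normalE s v n : s \in faces d K -> v \notin s -> v |: s \in faces d.+1 K ->
  inner_normal P s (v |: s) n -> n = flag_normal s (v |: s).
Proof.
move=> /ridge_in[sK sd] vs tF nI; have [tK td] := facet_in tF.
have [mm mt _] := facet_normalP tF.
have nI' := inner_normal_inner HP tK sK vs nI.
exact: (inner_unique sd vs (nondegenerate_aff Hnd tK) mm mt (flag_normalP sd vs tF) nI').
Qed.

Lemma positive_normal_unique t m : t \in faces d.+1 K -> positive_normal o P t m ->
  m = facet_normal t.
Proof.
move=> tF; have [tK td] := facet_in tF; move/(positive_normalE HP o _ tK) => mP.
exact: (pos_normal_unique td (nondegenerate_aff Hnd tK) (facet_orient tF) (facet_normalP tF) mP).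
Qed.

Section AtHinge.
Variables (s : {set V}) (v1 v2 : V).
Hypotheses (sF : s \in faces d K) (sh : hinge s v1 v2).
Local Notation n1 := (flag_normal s (v1 |: s)).
Local Notation n2 := (flag_normal s (v2 |: s)).
Local Notation m1 := (facet_normal (v1 |: s)).
Local Notation m2 := (facet_normal (v2 |: s)).

Lemma at_hinge_n2 : n2 = rdot n1 n2 *: n1 - (- rdot n2 m1) *: m1.
Proof.
have [sK sd] := ridge_in sF; have [v12 vs1 vs2 [t1 t2] _] := sh.
exact: (hinge_n2 sd vs1 (nondegenerate_aff Hnd (facet_in t1).1)
  (facet_normalP t1) (flag_normalP sd vs1 t1) (flag_normalP sd vs2 t2)).
Qed.

Lemma at_hinge_cs : rdot n1 n2 ^+ 2 + (- rdot n2 m1) ^+ 2 = 1.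
Proof.
have [sK sd] := ridge_in sF; have [v12 vs1 vs2 [t1 t2] _] := sh.
exact: (hinge_cs sd vs1 (nondegenerate_aff Hnd (facet_in t1).1)
  (facet_normalP t1) (flag_normalP sd vs1 t1) (flag_normalP sd vs2 t2)).
Qed.

Lemma at_hinge_m2 : m2 = - (rdot n1 n2 *: m1) - (- rdot n2 m1) *: n1.
Proof.
have [sK sd] := ridge_in sF; have [v12 vs1 vs2 [t1 t2] _] := sh.
apply: (hinge_m2 sd vs1 vs2 (nondegenerate_aff Hnd (facet_in t1).1)
  (nondegenerate_aff Hnd (facet_in t2).1) (facet_orient t1) (facet_orient t2)
  (facet_normalP t1) (facet_normalP t2) (flag_normalP sd vs1 t1) (flag_normalP sd vs2 t2)).
by move=> q; exact: hinge_orient.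
Qed.

(** The definition of the angle leaves the order of the two facets free; by
[at_hinge_m2] neither the cosine nor the sine changes under an exchange. *)
Lemma at_hinge_angle : exists theta,
  [/\ dihedral_angle K o P s = to_circle (2 * pi) theta,
      cos theta = rdot n1 n2 & sin theta = - rdot n2 m1].
Proof.
have [sK sd] := ridge_in sF; have [v12 vs1 vs2 [t1 t2] tE] := sh.
have [t1K t1d] := facet_in t1; have [t2K t2d] := facet_in t2.
have [nn1 ns1 _] := flag_normalP sd vs1 t1; have [nn2 ns2 _] := flag_normalP sd vs2 t2.
have [mm1 mt1 _] := facet_normalP t1.
have nm1 := inner_perp mt1 (flag_normalP sd vs1 t1).
have ex : exists phi, [set to_circle (2 * pi) theta |
    theta in dihedral_angle_spec K o P s] phi.
  have [theta [ct st]] := cos_sin_exists at_hinge_cs.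
  exists (to_circle (2 * pi) theta), theta => //.
  exists (v1 |: s), (v2 |: s), n1, n2, m1; split.
  - split=> //; rewrite ?finset.subsetUr//.
    by apply: contra_neq v12; exact: setU1_inj.
  - by apply: (inner_inner_normal HP) => //; [rewrite sd | exact: flag_normalP].
  - by apply: (inner_inner_normal HP) => //; [rewrite sd | exact: flag_normalP].
  - by apply/(positive_normalE HP o _ t1K); exact: facet_normalP.
  - by rewrite ct st {1}at_hinge_n2.
have [theta sp thE] := xgetPex 0 ex.
have [cE sE] : cos theta = rdot n1 n2 /\ sin theta = - rdot n2 m1; last first.
  by exists theta; rewrite thE.
have read (x y z : 'rV[R]_d.+2) : rdot x x = 1 -> rdot z z = 1 -> rdot x z = 0 ->
    y = cos theta *: x - sin theta *: z ->
    cos theta = rdot x y /\ sin theta = - rdot y z.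
  move=> xx zz xz ->; rewrite !(rdotBl, rdotBr, rdotZl, rdotZr) xx zz xz.
  by split; ring.
move: sp => [t1' [t2' [n1' [n2' [m1' [[t1'F t2'F t12' st1' st2'] n1'I n2'I m1'P e]]]]]].
case: (tE _ t1'F st1') (tE _ t2'F st2') => t1'E [] t2'E.
- by move: t12'; rewrite t1'E t2'E eqxx.
- rewrite t1'E in n1'I m1'P; rewrite t2'E in n2'I.
  move: e; rewrite (inner_normalE sF vs1 t1 n1'I) (inner_normalE sF vs2 t2 n2'I).
  by rewrite (positive_normal_unique t1 m1'P); exact: read.
- rewrite t1'E in n1'I m1'P; rewrite t2'E in n2'I.
  move: e; rewrite (inner_normalE sF vs2 t2 n1'I) (inner_normalE sF vs1 t1 n2'I).
  rewrite (positive_normal_unique t2 m1'P) => e.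
  have [mm2 mt2 _] := facet_normalP t2.
  have [] := read _ _ _ nn2 mm2 (inner_perp mt2 (flag_normalP sd vs2 t2)) e.
  rewrite (rdotC n2) => -> ->; split=> //.
  by rewrite {1}at_hinge_m2 rdotBr rdotNr !rdotZr nm1 nn1; ring.
- by move: t12'; rewrite t1'E t2'E eqxx.
Qed.

End AtHinge.

Lemma facet_balanced t : t \in faces d.+1 K ->
  \sum_(s | (s \in faces d K) && (s \subset t)) vol p s *: flag_normal s t = 0.
Proof.
move=> tF; have [tK td] := facet_in tF.
have [mm mt _] := facet_normalP tF.
have ridge v : v \in t -> (t :\ v \in faces d K) && (t :\ v \subset t).
  move=> vt; rewrite subD1set andbT inE.
  have cd : #|t :\ v| = d.+1 by have := cardsD1 v t; rewrite vt td => -[].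
  rewrite cd eqxx andbT; have [[_ sub] _ _ _] := HK.
  by apply: (sub _ _ tK); rewrite ?subD1set// cd.
rewrite -[RHS](@minkowski _ _ _ p t (facet_normal t) td (nondegenerate_aff Hnd tK) mm mt
   (fun v => flag_normal (t :\ v) t)); last first.
  move=> v vt; have vs : v \notin t :\ v by rewrite finset.setD11.
  have /andP[sF _] := ridge v vt; have [_ sd] := ridge_in sF.
  by have := @flag_normalP (t :\ v) v sd vs; rewrite finset.setD1K//; apply.
rewrite -(@big_imset _ _ _ _ _ (fun v => t :\ v) t (fun s => vol p s *: flag_normal s t)) /=.
  apply: eq_bigl => s; apply/andP/imsetP => [[sF st]|[v vt ->]]; last first.
    by apply/andP; exact: ridge.
  have [sK sd] := ridge_in sF; have [v vs tE] := facet_over_ridge sd tF st.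
  by exists v; rewrite tE ?setU11// setU1K.
move=> v w vt wt /finset.setP/(_ v); rewrite !inE eqxx vt andbT /= => h.
by apply/eqP; move: h; case: (v == w).
Qed.
End AtTime.
End Ridges.

(** * Motion with congruent faces *)

Section Congruence.
Variables (R : realType) (V : finType) (N : nat) (p p' : V -> 'rV[R]_N).
Implicit Types (s t : {set V}).

(** The metric of the simplex t is the same for both positions of its vertices. *)
Definition same_dots t := forall u v u' v', u \in t -> v \in t -> u' \in t -> v' \in t ->
  rdot (p u - p v) (p u' - p v') = rdot (p' u - p' v) (p' u' - p' v').

(** Polarization. *)
Lemma same_dists_dots t :
  {in t &, forall u v, rdot (p u - p v) (p u - p v) = rdot (p' u - p' v) (p' u - p' v)} ->
  same_dots t.
Proof.
move=> H u v u' v' ut vt ut' vt'.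
have pol (q : V -> 'rV[R]_N) : 2%:R * rdot (q u - q v) (q u' - q v') =
    rdot (q u - q v') (q u - q v') + rdot (q v - q u') (q v - q u')
    - rdot (q u - q u') (q u - q u') - rdot (q v - q v') (q v - q v').
  rewrite !(rdotBl, rdotBr) (rdotC (q v') (q u)) (rdotC (q u') (q v)).
  by rewrite (rdotC (q u') (q u)) (rdotC (q v') (q v)); ring.
have two : 2%:R != 0 :> R by rewrite pnatr_eq0.
by apply: (mulfI two); rewrite !pol !H.
Qed.

Lemma comb_diff (q : V -> 'rV[R]_N) t a w : \sum_(u in t) a u = 0 ->
  \sum_(u in t) a u *: q u = \sum_(u in t) a u *: (q u - q w).
Proof.
move=> a0; under [RHS]eq_bigr do rewrite scalerBr.
by rewrite sumrB -scaler_suml a0 scale0r subr0.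
Qed.

Lemma comb_dots t a b : same_dots t -> \sum_(u in t) a u = 0 -> \sum_(u in t) b u = 0 ->
  rdot (\sum_(u in t) a u *: p u) (\sum_(u in t) b u *: p u) =
  rdot (\sum_(u in t) a u *: p' u) (\sum_(u in t) b u *: p' u).
Proof.
move=> H a0 b0; have [->|[w wt]] := set_0Vmem t; first by rewrite !big_set0 !rdot0l.
rewrite (comb_diff p w a0) (comb_diff p w b0) (comb_diff p' w a0) (comb_diff p' w b0) !rdot_suml; apply: eq_bigr => u ut.
rewrite !rdot_sumr; apply: eq_bigr => u' ut'.
by rewrite !rdotZl !rdotZr H.
Qed.

Lemma comb_perp t s a : s \subset t -> same_dots t -> \sum_(u in t) a u = 0 ->
  perp p s (\sum_(u in t) a u *: p u) -> perp p' s (\sum_(u in t) a u *: p' u).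
Proof.
move=> /fintype.subsetP st H a0 ps u v us vs; rewrite -[RHS](ps u v us vs).
have ut := st u us; rewrite (comb_diff p u a0) (comb_diff p' u a0) !rdot_suml; apply: eq_bigr => w wt.
by rewrite !rdotZl H// st.
Qed.
End Congruence.

(** The weights that express an inner normal by the vertices depend only on the
lengths of the edges. *)
Lemma inner_congruent (R : realType) (V : finType) d (p p' : V -> 'rV[R]_d.+2)
    (s : {set V}) v (a : V -> R) : same_dots p p' (v |: s) ->
  \sum_(u in v |: s) a u = 0 -> 0 < a v ->
  inner_unit p s v (\sum_(u in v |: s) a u *: p u) ->
  inner_unit p' s v (\sum_(u in v |: s) a u *: p' u).
Proof.
move=> H a0 av [nn ns _]; split; last by exists a.
  by rewrite -(comb_dots H a0 a0).
exact: (comb_perp (finset.subsetUr _ _) H a0 ns).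
Qed.

Lemma gram_congruent (R : realType) (V : finType) d (p p' : V -> 'rV[R]_d.+2) (s : {set V})
    (q : d.+1.-tuple V) : [set u in q] = s -> same_dots p p' s ->
  \det (edge_mx p q *m (edge_mx p q)^T) = \det (edge_mx p' q *m (edge_mx p' q)^T).
Proof.
move=> qs H; congr (\det _).
apply/matrixP => i j; have e (r : V -> 'rV[R]_d.+2) :
    (edge_mx r q *m (edge_mx r q)^T) i j = rdot (row i (edge_mx r q)) (row j (edge_mx r q)).
  by rewrite mxE; apply: eq_bigr => l _; rewrite !mxE.
by rewrite !e !row_edge_mx H// -qs inE mem_tnth.
Qed.

Lemma vol_congruent (R : realType) (V : finType) d (p p' : V -> 'rV[R]_d.+2) (s : {set V}) :
  #|s| = d.+1 -> same_dots p p' s -> vol p s = vol p' s.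
Proof.
move=> sd H; have [q qs qE] := exists_enum_tuple sd.
by rewrite !(vol_gram _ qs sd qE) (gram_congruent qs H).
Qed.

Lemma congruent_same_dots (R : realType) (V : finType) n (K : {set {set V}})
    (P Q : {ptws V -> R} -> 'rV[R]_n) s : congruent_faces K P Q -> s \in K ->
  same_dots (fun v => P (vertex R v)) (fun v => Q (vertex R v)) s.
Proof.
move=> PQ sK; have [g gi PgQ] := PQ s sK; apply: same_dists_dots => u v us vs.
rewrite !PgQ; try exact: geom_vertex.
have sq (x : 'rV[R]_n) : rdot x x = enorm x ^+ 2.
  by rewrite /enorm sqr_sqrtr// rdot_ge0.
by rewrite !sq gi.
Qed.

Section ContinuousFunctions.
Variables (R : realType) (a b : R).
Definition cont (f : R -> R) := {in `]a, b[, continuous f}.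

Lemma cont_cst x : cont (fun=> x). Proof. by move=> t _; exact: cvg_cst. Qed.
Lemma cont_eq f g : f =1 g -> cont g -> cont f.
Proof. by move=> /funext ->. Qed.
Lemma contD f g : cont f -> cont g -> cont (fun t => f t + g t).
Proof. by move=> cf cg t ti; apply: cvgD; [exact: cf|exact: cg]. Qed.
Lemma contM f g : cont f -> cont g -> cont (fun t => f t * g t).
Proof. by move=> cf cg t ti; apply: cvgM; [exact: cf|exact: cg]. Qed.
Lemma contN f : cont f -> cont (fun t => - f t).
Proof. by move=> cf t ti; apply: cvgN; exact: cf. Qed.
Lemma cont_sum (I : Type) (r : seq I) (Q : pred I) (f : I -> R -> R) :
  (forall i, Q i -> cont (f i)) -> cont (fun t => \sum_(i <- r | Q i) f i t).
Proof.
move=> cf; elim: r => [|i r IH].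
  by under eq_fun do rewrite big_nil; exact: cont_cst.
case Qi: (Q i); under eq_fun do rewrite big_cons Qi; last exact: IH.
by apply: contD => //; exact: cf.
Qed.
Lemma cont_prod (I : Type) (r : seq I) (Q : pred I) (f : I -> R -> R) :
  (forall i, Q i -> cont (f i)) -> cont (fun t => \prod_(i <- r | Q i) f i t).
Proof.
move=> cf; elim: r => [|i r IH].
  by under eq_fun do rewrite big_nil; exact: cont_cst.
case Qi: (Q i); under eq_fun do rewrite big_cons Qi; last exact: IH.
by apply: contM => //; exact: cf.
Qed.
Lemma cont_det n (M : R -> 'M[R]_n) : (forall i j, cont (fun t => M t i j)) ->
  cont (fun t => \det (M t)).
Proof.
move=> cM; apply: cont_sum => s _; apply: contM; first exact: cont_cst.
by apply: cont_prod => i _; exact: cM.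
Qed.
Lemma cont_rdot n (u v : R -> 'rV[R]_n) : (forall j, cont (fun t => u t 0 j)) ->
  (forall j, cont (fun t => v t 0 j)) -> cont (fun t => rdot (u t) (v t)).
Proof. by move=> cu cv; apply: cont_sum => j _; apply: contM. Qed.

(** By the intermediate value theorem a function with two values takes all values in
between. *)
Lemma finite_cont_constant f : cont f -> finite_set (f @` `]a, b[%classic) ->
  {in `]a, b[ &, forall x y, f x = f y}.
Proof.
move=> cf fin.
suff le x y : x \in `]a, b[ -> y \in `]a, b[ -> x <= y -> f x = f y.
  move=> x y xi yi; have [xy|yx] := leP x y; first exact: le.
  by rewrite (le y x)// ltW.
move=> xi yi xy; apply: contrapT => fxy.
have xyi z : z \in `[x, y] -> z \in `]a, b[.
  move: xi yi; rewrite !in_itv /= => /andP[ax _] /andP[_ yb] /andP[xz zy].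
  by rewrite (lt_le_trans ax xz) (le_lt_trans zy yb).
have cxy : {within `[x, y], continuous f}.
  apply: continuous_in_subspaceT => z; rewrite inE => zi; apply: cf.
  exact: xyi.
pose g (k : nat) := f x + (f y - f x) / k.+1%:R.
have gin k : (f @` `]a, b[%classic) (g k).
  have [] := @IVT _ f x y (g k) xy cxy.
    have k0 : 0 < k.+1%:R^-1 :> R by rewrite invr_gt0 ltr0n.
    have k1 : k.+1%:R^-1 <= 1 :> R by rewrite invf_le1 ?ltr0n// ler1n.
    rewrite /g; move: (k.+1%:R^-1) k0 k1 => l l0 l1.
    by rewrite ge_min le_max; have [h|h] := leP (f x) (f y); apply/andP; split; nra.
  by move=> z zi <-; exists z => //; exact: xyi.
have ginj : injective g.
  move=> k l; rewrite /g => /addrI; have d0 : f y - f x != 0.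
    by rewrite subr_eq0; apply/eqP => e; apply: fxy.
  by move/(mulfI d0)/invr_inj/eqP; rewrite eqr_nat eqSS => /eqP.
have fg : finite_set (g @^-1` (f @` `]a, b[%classic)).
  by apply: finite_preimage => // k l _ _; exact: ginj.
by apply: infinite_nat; apply: sub_finite_set fg => k _; exact: gin.
Qed.
End ContinuousFunctions.

Section ContinuousComplex.
Variables (R : realType) (a b : R).
Local Notation cont := (@cont R a b).

Definition contC (f : R -> R[i]) := cont (fun t => complex.Re (f t)) /\
  cont (fun t => complex.Im (f t)).

Lemma contC_cst z : contC (fun=> z). Proof. by split; exact: cont_cst. Qed.

Lemma contCM f g : contC f -> contC g -> contC (fun t => f t * g t).
Proof.
move=> [rf mf] [rg mg].
have e t : f t * g t =
   ((complex.Re (f t) * complex.Re (g t) - complex.Im (f t) * complex.Im (g t))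
   +i* (complex.Re (f t) * complex.Im (g t) + complex.Im (f t) * complex.Re (g t)))%C.
  by case: (f t) (g t) => [x y] [z w].
split; under eq_fun do rewrite e /=.
  by apply: contD; [exact: contM|apply: contN; exact: contM].
by apply: contD; exact: contM.
Qed.

Lemma contC_exp f n : contC f -> contC (fun t => f t ^+ n).
Proof.
move=> cf; elim: n => [|n IH]; first exact: contC_cst.
by under eq_fun do rewrite exprS; exact: contCM.
Qed.

Lemma contC_prod (I : Type) (r : seq I) (Q : pred I) (f : I -> R -> R[i]) :
  (forall i, Q i -> contC (f i)) -> contC (fun t => \prod_(i <- r | Q i) f i t).
Proof.
move=> cf; elim: r => [|i r IH].
  by under eq_fun do rewrite big_nil; exact: contC_cst.
case Qi: (Q i); under eq_fun do rewrite big_cons Qi; last exact: IH.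
by apply: contCM => //; exact: cf.
Qed.

Lemma finite_contC_constant f : contC f -> finite_set (f @` `]a, b[%classic) ->
  {in `]a, b[ &, forall x y, f x = f y}.
Proof.
move=> [rf mf] fin x y xi yi; apply/eqP; rewrite eq_complex; apply/andP; split.
  apply/eqP; apply: (finite_cont_constant rf) => //.
  by rewrite -(image_comp f (@complex.Re R)); exact: finite_image.
apply/eqP; apply: (finite_cont_constant mf) => //.
by rewrite -(image_comp f (@complex.Im R)); exact: finite_image.
Qed.
End ContinuousComplex.

Section Expi.
Variable R : realType.
Definition expi (x : R) : R[i] := (cos x +i* sin x)%C.
Lemma expiD x y : expi (x + y) = expi x * expi y.
Proof.
by rewrite /expi cosD sinD; apply/eqP; rewrite eq_complex /=; apply/andP; split; apply/eqP; ring.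
Qed.
Lemma expi0 : expi 0 = 1.
Proof. by rewrite /expi cos0 sin0. Qed.
Lemma expi_neq0 x : expi x != 0.
Proof.
apply/eqP => e; have := expiD x (- x); rewrite e mul0r subrr expi0 => /eqP.
by rewrite oner_eq0.
Qed.
Lemma expiN x : expi (- x) = (expi x)^-1.
Proof. by apply: (mulfI (expi_neq0 x)); rewrite mulfV ?expi_neq0// -expiD subrr expi0. Qed.
Lemma expiMz x (k : int) : expi (x *~ k) = expi x ^ k.
Proof.
have nat n : expi (x *+ n) = expi x ^+ n.
  by elim: n => [|n IH]; rewrite ?expi0// mulrS expiD IH exprS.
case: k => n; first exact: nat.
by rewrite NegzE mulrNz expiN -[_ *~ _]/(x *+ n.+1) nat.
Qed.
Lemma expi_sum (I : Type) (r : seq I) (Q : pred I) (f : I -> R) :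
  expi (\sum_(i <- r | Q i) f i) = \prod_(i <- r | Q i) expi (f i).
Proof. exact: (big_morph expi expiD expi0). Qed.

(** Reduced modulo pi, z lies in [0, pi[, where the sine vanishes only at 0. *)
Lemma sin_eq0 (z : R) : sin z = 0 -> exists k : int, z = pi *~ k.
Proof.
move=> sz; pose k := Num.floor (z / pi); exists k.
have pi0 : 0 < (pi : R) by exact: pi_gt0.
have snat n x : sin x = 0 -> sin (x + pi *+ n) = 0 :> R.
  move=> sx; elim: n => [|n IH]; first by rewrite addr0.
  by rewrite mulrSr addrA sinDpi IH oppr0.
have sint j : sin (z + pi *~ j) = 0.
  case: j => n; first exact: snat.
  rewrite NegzE mulrNz -[_ *~ _]/(pi *+ n.+1) -[z - _]opprK sinN opprB addrC.
  by rewrite snat ?oppr0// sinN sz oppr0.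
pose r := z - pi *~ k.
have sr : sin r = 0 by rewrite /r -mulrNz sint.
have zE : z = pi * (z / pi) by rewrite mulrC divfK// gt_eqF.
have r0 : 0 <= r.
  by rewrite subr_ge0 -mulrzr zE ler_pM2l// Num.Theory.floor_le.
have rpi : r < pi.
  rewrite ltrBlDr -mulrzr -[X in X + _]mulr1 -mulrDr zE ltr_pM2l// addrC.
  by have := Num.Theory.floorD1_gt (z / pi); rewrite intrD.
move: r0; rewrite le_eqVlt => /orP[/eqP r0|r0].
  by apply/eqP; rewrite -subr_eq0 -/r -r0.
have := @sin_gt0_pi _ r; rewrite r0 rpi => /(_ isT).
by rewrite sr ltxx.
Qed.
End Expi.

Section HingeFunctions.
Variables (R : realType) (V : finType) (d : nat) (K : {set {set V}}).
Variables (o : pred (d.+2.-tuple V)).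
Hypotheses (HK : pseudo_manifold R d.+1 K) (Ho : orientation K o).
Variables (a b : R) (P : R -> {ptws V -> R} -> 'rV[R]_d.+2).
Hypothesis HF : flexion K a b P.
Hypothesis Hnd : forall t, t \in `]a, b[ -> nondegenerate_faces K (P t).
Variable (t0 : R).
Hypothesis t0i : t0 \in `]a, b[.
Local Notation p t := (fun v => P t (vertex R v)).
Local Notation cont := (@cont R a b).
Implicit Types (s : {set V}) (v : V).

Lemma flex_polyhedron t : t \in `]a, b[ -> polyhedron K (P t).
Proof. by case: HF => HP _ _; exact: HP. Qed.

Lemma flex_dots t s : t \in `]a, b[ -> s \in K -> same_dots (p t0) (p t) s.
Proof.
by move=> ti sK; apply: congruent_same_dots sK; case: HF => _ _; apply.
Qed.

Lemma flex_vol t s : t \in `]a, b[ -> s \in faces d K -> vol (p t) s = vol (p t0) s.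
Proof.
by move=> ti /ridge_in[sK sd]; rewrite (vol_congruent sd (flex_dots ti sK)).
Qed.

Lemma flex_vertex_cont s v j : s \in K -> v \in s -> cont (fun t => P t (vertex R v) 0 j).
Proof.
move=> sK vs t ti; case: HF => _ /(_ (vertex R v)) cP _.
have /cP/(_ t ti) ct : realization K (vertex R v).
  by exists s => //; exact: geom_vertex.
exact: (continuous_comp ct (@coord_continuous _ _ _ 0 j _)).
Qed.

(** The weights al do not depend on t, so the normal is continuous in t. *)
Lemma flag_normal_comb s v : s \in faces d K -> v \notin s -> v |: s \in faces d.+1 K ->
  exists al : V -> R, forall t, t \in `]a, b[ ->
    flag_normal (P t) s (v |: s) = \sum_(u in v |: s) al u *: p t u.
Proof.
move=> sF vs tF; have [sK sd] := ridge_in sF; have [tK td] := facet_in tF.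
have nI := flag_normalP Ho (Hnd t0i) sd vs tF.
have [_ _ [al [al0 nE av]]] := nI; exists al => t ti.
rewrite nE in nI; have nI' := inner_congruent (flex_dots ti tK) al0 av nI.
have [mm mt _] := facet_normalP Ho (Hnd ti) tF.
exact: (inner_unique sd vs (nondegenerate_aff (Hnd ti) tK) mm mt nI' (flag_normalP Ho (Hnd ti) sd vs tF)).
Qed.

Lemma flag_comb_cont s v (al : V -> R) j : v |: s \in K ->
  cont (fun t => (\sum_(u in v |: s) al u *: p t u) 0 j).
Proof.
move=> tK; under eq_fun do rewrite summxE; apply: cont_sum => u ut.
under eq_fun do rewrite mxE; apply: contM; first exact: cont_cst.
exact: flex_vertex_cont tK ut.
Qed.

(** The cosine is continuous by [flag_normal_comb]; for the sine the normal of the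
facet is eliminated by [hinge_sin]. *)
Lemma hinge_continuous s v1 v2 : s \in faces d K -> hinge d K s v1 v2 ->
  exists c sn : R -> R, [/\ cont c, cont sn & forall t, t \in `]a, b[ ->
    c t = rdot (flag_normal (P t) s (v1 |: s)) (flag_normal (P t) s (v2 |: s)) /\
    sn t = - rdot (flag_normal (P t) s (v2 |: s)) (facet_normal o (P t) (v1 |: s))].
Proof.
move=> sF sh; have [sK sd] := ridge_in sF; have [v12 vs1 vs2 [t1F t2F] _] := sh.
have [t1K t1d] := facet_in t1F; have [t2K t2d] := facet_in t2F.
have [a1 n1E] := flag_normal_comb sF vs1 t1F.
have [a2 n2E] := flag_normal_comb sF vs2 t2F.
have [q qs] := exists_tuple sd.
pose n1 t := \sum_(u in v1 |: s) a1 u *: p t u.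
pose n2 t := \sum_(u in v2 |: s) a2 u *: p t u.
pose k := (-1) ^+ o [tuple of v1 :: q] *
   Num.sqrt (\det (edge_mx (p t0) q *m (edge_mx (p t0) q)^T)).
have kE t : t \in `]a, b[ -> (-1) ^+ o [tuple of v1 :: q] *
   Num.sqrt (\det (edge_mx (p t) q *m (edge_mx (p t) q)^T)) = k.
  by move=> ti; rewrite /k (gram_congruent qs (flex_dots ti sK)).
have k0 : k != 0.
  have [mm mt _] := facet_normalP Ho (Hnd t0i) t1F.
  rewrite /k -(det2_sign sd vs1 (nondegenerate_aff (Hnd t0i) t1K) (facet_orient Ho t1F)
    (facet_normalP Ho (Hnd t0i) t1F) (flag_normalP Ho (Hnd t0i) sd vs1 t1F) qs).
  exact: (det2_neq0 sd vs1 (nondegenerate_aff (Hnd t0i) t1K) mm mt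
    (flag_normalP Ho (Hnd t0i) sd vs1 t1F) qs).
exists (fun t => rdot (n1 t) (n2 t)).
exists (fun t => - det2 (n2 t) (n1 t) (edge_mx (p t) q) * k^-1); split.
- by apply: cont_rdot => j; exact: flag_comb_cont.
- apply: contM; last exact: cont_cst.
  apply: contN; apply: cont_det => i j.
  case: (unliftP ord0 i) => [i'|] ->; last first.
    apply: (@cont_eq _ _ _ _ (fun t => n2 t 0 j)) => [t|]; first by rewrite col_mx_ord0.
    exact: flag_comb_cont.
  case: (unliftP ord0 i') => [l|] ->; last first.
    apply: (@cont_eq _ _ _ _ (fun t => n1 t 0 j)) => [t|].
      by rewrite col_mx_lift col_mx_ord0.
    exact: flag_comb_cont.
  apply: (@cont_eq _ _ _ _ (fun t => p t (tnth q (fintype.lift ord0 l)) 0 j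
      - p t (tnth q ord0) 0 j)) => [t|]; first by rewrite !col_mx_lift !mxE.
  by apply: contD; [|apply: contN]; apply: flex_vertex_cont sK _; rewrite -qs inE mem_tnth.
move=> t ti; rewrite n1E// n2E//; split=> //.
apply: (mulIf k0); rewrite divfK// -/(n1 t) -/(n2 t) -(kE t ti).
have := hinge_sin sd (flag_normal (P t) s (v2 |: s)) vs1
   (nondegenerate_aff (Hnd ti) t1K) (facet_orient Ho t1F)
   (facet_normalP Ho (Hnd ti) t1F) (flag_normalP Ho (Hnd ti) sd vs1 t1F) qs.
by rewrite n1E// n2E// => ->.
Qed.
End HingeFunctions.

(** * The Dehn invariant *)

Section TensorTheory.
Variables A B : zmodType.
Implicit Types (x y : A) (u v : B).

Lemma tensDl x y u : tens (x + y) u = tens x u + tens y u.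
Proof.
rewrite /tens -raddfD; apply/eqP; rewrite -[_ == _]Quotient.idealrBE.
apply/asboolP => H _ relH; apply: relH; left.
by exists x, y, u.
Qed.

Lemma tensDr x u v : tens x (u + v) = tens x u + tens x v.
Proof.
rewrite /tens -raddfD; apply/eqP; rewrite -[_ == _]Quotient.idealrBE.
apply/asboolP => H _ relH; apply: relH; right.
by exists x, u, v.
Qed.
End TensorTheory.

Section CircleTheory.
Variable R : realType.

Lemma to_circleD (c : R) : {morph to_circle c : x y / x + y}.
Proof. by move=> x y; rewrite /to_circle raddfD. Qed.

Lemma to_circle_eq (c x y : R) : (exists k : int, x - y = c *~ k) ->
  to_circle c x = to_circle c y.
Proof.
move=> kE; apply/eqP; rewrite -[_ == _]Quotient.idealrBE.
exact/asboolP.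
Qed.

Lemma mod_pi_to_circle (x : R) : mod_pi (to_circle (2 * pi) x) = to_circle pi x.
Proof.
rewrite /mod_pi; apply: to_circle_eq.
have : \pi_(Quotient.quot (zmultiples (2 * pi : R))) (repr (to_circle (2 * pi) x
   : Quotient.quot (zmultiples (2 * pi)))) = to_circle (2 * pi) x by rewrite reprK.
move/eqP; rewrite -[_ == _]Quotient.idealrBE => /asboolP[k ->].
by exists (k + k); rewrite mulr_natl mulr2n mulrzDl mulrzDr.
Qed.
End CircleTheory.

(** The values of v are added to the basis one at a time. If some nonzero multiple
n v i is an integral combination of the present basis l, then l is replaced by
l / n; otherwise v i is a new basis element. *)
Lemma integral_basis (R : realType) (I : finType) (v : I -> R) :
  exists (r : nat) (l : 'I_r -> R) (c : I -> 'I_r -> int),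
    (forall z : 'I_r -> int, \sum_j l j *~ z j = 0 -> forall j, z j = 0) /\
    (forall i, v i = \sum_j l j *~ c i j).
Proof.
suff [r [l [c [ind vE]]]] : exists (r : nat) (l : 'I_r -> R) (c : I -> 'I_r -> int),
    (forall z : 'I_r -> int, \sum_j l j *~ z j = 0 -> forall j, z j = 0) /\
    (forall i, i \in enum I -> v i = \sum_j l j *~ c i j).
  by exists r, l, c; split=> // i; apply: vE; rewrite mem_enum.
elim: (enum I) => [|i s [r [l [c [ind vE]]]]].
  by exists 0%N, (fun=> 0), (fun _ _ => 0); split=> [z _ [] //|i].
have [[n [z [n0 nE]]]|indep] := pselect (exists (n : int) (z : 'I_r -> int),
    n != 0 /\ v i *~ n = \sum_j l j *~ z j).
  have nR : n%:~R != 0 :> R by rewrite intr_eq0.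
  exists r, (fun j => l j / n%:~R), (fun i' j => if i' == i then z j else n * c i' j).
  have lE (y : 'I_r -> int) : \sum_j (l j / n%:~R) *~ y j = (\sum_j l j *~ y j) / n%:~R.
    by rewrite mulr_suml; apply: eq_bigr => j _; rewrite mulrzAl.
  split=> [y|i']; first by rewrite lE => /eqP; rewrite mulf_eq0 invr_eq0 (negbTE nR) orbF => /eqP/ind.
  rewrite inE lE; have [->|i'i] /= := eqVneq i' i.
    by move=> _; rewrite -nE -mulrzr mulfK.
  move=> /vE {1}->; apply: (mulIf nR); rewrite divfK// mulr_suml; apply: eq_bigr => j _.
  by rewrite mulrzr -mulrzA mulrC.
exists r.+1, (fun j => oapp l (v i) (unlift ord0 j)),
  (fun i' j => oapp (fun j => if i' == i then 0 else c i' j)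
     (if i' == i then 1 else 0) (unlift ord0 j)).
split=> [z|i'].
  rewrite big_ord_recl unlift_none /= => zE.
  have {}zE : v i *~ z ord0 + \sum_j l j *~ z (fintype.lift ord0 j) = 0.
    by rewrite -[RHS]zE; congr (_ + _); apply: eq_bigr => j _; rewrite fintype.liftK.
  have z0 : z ord0 = 0.
    apply/eqP/negPn/negP => zN; apply: indep; exists (z ord0), (fun j => - z (fintype.lift ord0 j)).
    split=> //; move/eqP: zE; rewrite addr_eq0 => /eqP ->; rewrite -sumrN.
    by apply: eq_bigr => j _; rewrite mulrNz.
  rewrite z0 mulr0z add0r in zE.
  by move=> j; case: (unliftP ord0 j) => [j'|] -> //; exact: (ind _ zE).
rewrite inE big_ord_recl unlift_none /=.
under eq_bigr do rewrite fintype.liftK /=.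
have [->|i'i] /= := eqVneq i' i.
  by move=> _; rewrite big1 ?addr0// => j _; rewrite mulr0z.
by move=> /vE ->; rewrite mulr0z add0r.
Qed.

Section Products.
Variables (R : realType) (V : finType) (d : nat) (K : {set {set V}}).
Variables (o : pred (d.+2.-tuple V)).
Hypotheses (HK : pseudo_manifold R d.+1 K) (Ho : orientation K o).
Variables (a b : R) (P : R -> {ptws V -> R} -> 'rV[R]_d.+2).
Hypothesis HF : flexion K a b P.
Hypothesis Hnd : forall t, t \in `]a, b[ -> nondegenerate_faces K (P t).
Variable (t0 : R).
Hypothesis t0i : t0 \in `]a, b[.
Local Notation p t := (fun v => P t (vertex R v)).
Implicit Types (s : {set V}) (v : V).

Lemma hinge_data : exists (f1 f2 : {set V} -> {set V}) (c sn : {set V} -> R -> R),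
  forall s, s \in faces d K ->
  [/\ exists v1 v2, [/\ hinge d K s v1 v2, f1 s = v1 |: s & f2 s = v2 |: s],
      cont a b (c s), cont a b (sn s)
    & forall t, t \in `]a, b[ ->
      c s t = rdot (flag_normal (P t) s (f1 s)) (flag_normal (P t) s (f2 s)) /\
      sn s t = - rdot (flag_normal (P t) s (f2 s)) (facet_normal o (P t) (f1 s))].
Proof.
have /choice[F FP] : forall s, exists x : ({set V} * {set V}) * ((R -> R) * (R -> R)),
    s \in faces d K ->
  [/\ exists v1 v2, [/\ hinge d K s v1 v2, x.1.1 = v1 |: s & x.1.2 = v2 |: s],
      cont a b x.2.1, cont a b x.2.2
    & forall t, t \in `]a, b[ ->
      x.2.1 t = rdot (flag_normal (P t) s x.1.1) (flag_normal (P t) s x.1.2) /\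
      x.2.2 t = - rdot (flag_normal (P t) s x.1.2) (facet_normal o (P t) x.1.1)].
  move=> s; case: (boolP (s \in faces d K)) => [sF|_]; last first.
    by exists ((finset.set0, finset.set0), (fun=> 0, fun=> 0)).
  have [v1 [v2 sh]] := ridge_hinge HK sF.
  have [c [sn [cc cs csE]]] := hinge_continuous Ho HF Hnd t0i sF sh.
  exists ((v1 |: s, v2 |: s), (c, sn)) => _ /=; split=> //.
  by exists v1, v2.
by exists (fun s => (F s).1.1), (fun s => (F s).1.2), (fun s => (F s).2.1), (fun s => (F s).2.2).
Qed.

(** The exponential of i times the sum takes finitely many values and is continuous,
so it is constant, and it determines the sum modulo 2 pi. *)
Lemma angle_sum_constant (e : {set V} -> int) (theta : R -> {set V} -> R) :
  (forall w : {set V} -> int,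
    \sum_(s | s \in faces d K) vol (p t0) s * (w s)%:~R = 0 ->
    \sum_(s | s \in faces d K) w s * e s = 0) ->
  (forall t s, t \in `]a, b[ -> s \in faces d K -> forall v1 v2, hinge d K s v1 v2 ->
     cos (theta t s) = rdot (flag_normal (P t) s (v1 |: s)) (flag_normal (P t) s (v2 |: s)) /\
     sin (theta t s) = - rdot (flag_normal (P t) s (v2 |: s)) (facet_normal o (P t) (v1 |: s))) ->
  forall t1 t2, t1 \in `]a, b[ -> t2 \in `]a, b[ ->
  to_circle pi (\sum_(s in faces d K) theta t1 s *~ e s) =
  to_circle pi (\sum_(s in faces d K) theta t2 s *~ e s).
Proof.
move=> rels thE t1 t2 t1i t2i.
have [f1 [f2 [c [sn H]]]] := hinge_data.
pose U t := \prod_(s in faces d K) cis c sn s t ^ e s.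
have Ufin : finite_set (U @` `]a, b[%classic).
  apply: (@finite_values R `]a, b[%classic {set V} {set V} (mem (faces d K))
    (mem (faces d.+1 K)) (fun s t => s \subset t) d.+2 (vol (p t0))
    (fun s t x => flag_normal (P x) s t) (fun t x => facet_normal o (P x) t) f1 f2).
  - move=> t j ti jF; rewrite -[RHS](facet_balanced HK Ho (Hnd ti) jF).
    by apply: eq_bigr => s /andP[sF _]; rewrite (flex_vol HF t0i ti sF).
  - move=> s sF; have [[v1 [v2 [[v12 vs1 vs2 _ _] -> ->]]] _ _ _] := H s sF.
    by apply: contra_neq v12; exact: setU1_inj.
  - move=> s t sF; have [[v1 [v2 [[v12 vs1 vs2 [t1F t2F] tE] -> ->]]] _ _ _] := H s sF.
    apply/andP/orP => [[tF /(tE _ tF)[->|->]]|[/eqP->|/eqP->]]; rewrite ?eqxx; auto.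
      by split=> //; exact: finset.subsetUr.
    by split=> //; exact: finset.subsetUr.
  - move=> t s ti sF; have [[v1 [v2 [[v12 vs1 vs2 [t1F t2F] tE] -> _]]] _ _ _] := H s sF.
    by have [] := flag_normalP Ho (Hnd ti) (ridge_in sF).2 vs1 t1F.
  - move=> t s ti sF; have [[v1 [v2 [[v12 vs1 vs2 [t1F t2F] tE] -> _]]] _ _ _] := H s sF.
    by have [] := facet_normalP Ho (Hnd ti) t1F.
  - move=> t s ti sF; have [[v1 [v2 [[v12 vs1 vs2 [t1F t2F] tE] -> _]]] _ _ _] := H s sF.
    have [_ mt _] := facet_normalP Ho (Hnd ti) t1F.
    exact: (inner_perp mt (flag_normalP Ho (Hnd ti) (ridge_in sF).2 vs1 t1F)).
  - move=> t s ti sF; have [[v1 [v2 [sh e1 e2]]] _ _ /(_ t ti)[-> ->]] := H s sF.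
    by rewrite e1 e2; exact: (at_hinge_n2 Ho (Hnd ti) sF sh).
  - move=> t s ti sF; have [[v1 [v2 [sh e1 e2]]] _ _ /(_ t ti)[-> ->]] := H s sF.
    by rewrite e1 e2; exact: (at_hinge_m2 Ho (Hnd ti) sF sh).
  - move=> t s ti sF; have [[v1 [v2 [sh e1 e2]]] _ _ /(_ t ti)[-> ->]] := H s sF.
    by rewrite e1 e2; exact: (at_hinge_cs Ho (Hnd ti) sF sh).
  - exact: rels.
have cisE t s : t \in `]a, b[ -> s \in faces d K -> cis c sn s t = expi (theta t s).
  move=> ti sF; have [[v1 [v2 [sh e1 e2]]] _ _ /(_ t ti)[cE sE]] := H s sF.
  have [ct st] := thE t s ti sF v1 v2 sh.
  by rewrite /cis /expi cE sE ct st e1 e2.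
(* inverses of exp (i phi) are written as conjugates, so that W is a polynomial in
   the cosines and sines, continuous on the whole interval *)
pose W s t : R[i] := match e s with
  | Posz n => cis c sn s t ^+ n
  | Negz n => (c s t +i* - sn s t)%C ^+ n.+1 end.
have WE t s : t \in `]a, b[ -> s \in faces d K -> cis c sn s t ^ e s = W s t.
  move=> ti sF; rewrite /W; case: (e s) => n //.
  rewrite -[LHS]/((cis c sn s t ^+ n.+1)^-1) -exprVn; congr (_ ^+ _).
  rewrite cisE// -expiN /expi cosN sinN.
  by have := cisE t s ti sF; rewrite /cis /expi => -[-> ->].
have cU : contC a b (fun t => \prod_(s in faces d K) W s t).
  apply: contC_prod => s sF; have [_ cc cs _] := H s sF.
  rewrite /W; case: (e s) => n; apply: contC_exp; split=> //.
  exact: contN.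
have UW : {in `]a, b[, U =1 fun t => \prod_(s in faces d K) W s t}.
  by move=> t ti; apply: eq_bigr => s sF; exact: WE.
have Wfin : finite_set ((fun t => \prod_(s in faces d K) W s t) @` `]a, b[%classic).
  by apply: sub_finite_set Ufin => _ [t ti <-]; exists t => //; exact: UW.
have := finite_contC_constant cU Wfin t1i t2i.
rewrite -[LHS](UW _ t1i) -[RHS](UW _ t2i).
have UE t : t \in `]a, b[ -> U t = expi (\sum_(s in faces d K) theta t s *~ e s).
  by move=> ti; rewrite expi_sum; apply: eq_bigr => s sF; rewrite expiMz cisE.
rewrite !UE//; set x := \sum_(s in _) _; set y := \sum_(s in _) _ => -[cxy sxy].
apply: to_circle_eq; apply: sin_eq0.
by rewrite sinB cxy sxy mulrC subrr.
Qed.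

(** [at_hinge_angle] provides one representative of the angle, and the others differ
from it by multiples of 2 pi. *)
Lemma dihedral_representative t s v1 v2 x : t \in `]a, b[ -> s \in faces d K ->
  hinge d K s v1 v2 -> dihedral_angle K o (P t) s = to_circle (2 * pi) x ->
  cos x = rdot (flag_normal (P t) s (v1 |: s)) (flag_normal (P t) s (v2 |: s)) /\
  sin x = - rdot (flag_normal (P t) s (v2 |: s)) (facet_normal o (P t) (v1 |: s)).
Proof.
move=> ti sF sh; have HPt := flex_polyhedron HF ti.
have [y [-> <- <-]] := at_hinge_angle Ho HPt (Hnd ti) sF sh.
move/eqP; rewrite -[_ == _]Quotient.idealrBE => /asboolP[k yx].
have -> : y = x + (2 * pi) *~ k by rewrite -yx addrC subrK.
have [<- <-//] : expi x = expi (x + (2 * pi) *~ k).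
rewrite expiD expiMz (_ : expi (2 * pi) = 1) ?exp1rz ?mulr1//.
by rewrite mulr_natl /expi cos2pi sin2pi.
Qed.

Lemma dehn_invariant_basis r (l : 'I_r -> R) (c : {set V} -> 'I_r -> int)
    (x : {set V} -> R) t :
  t \in `]a, b[ ->
  (forall s, s \in faces d K -> vol (p t0) s = \sum_j l j *~ c s j) ->
  (forall s, s \in faces d K -> dihedral_angle K o (P t) s = to_circle (2 * pi) (x s)) ->
  dehn_invariant K o (P t) = \sum_j tens (l j : R)
    (to_circle pi (\sum_(s in faces d K) x s *~ c s j)).
Proof.
move=> ti volE xE; rewrite /dehn_invariant.
transitivity (\sum_(s in faces d K) \sum_j
    tens (l j : R) (to_circle pi (x s *~ c s j))).
  apply: eq_bigr => s sF; rewrite xE// mod_pi_to_circle -/(vol (p t) s).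
  rewrite (flex_vol HF t0i ti sF) volE//.
  rewrite (add_map_sum (f := fun z => tens z _)); last by move=> z z'; exact: tensDl.
  apply: eq_bigr => j _.
  rewrite (add_mapMz (f := fun z => tens z _)); last by move=> z z'; exact: tensDl.
  rewrite (add_mapMz (to_circleD pi)) (add_mapMz (f := tens (l j : R)))//.
  by move=> z z'; exact: tensDr.
rewrite exchange_big; apply: eq_bigr => j _ /=.
rewrite (add_map_sum (to_circleD pi)) (add_map_sum (f := tens (l j : R)))//.
by move=> z z'; exact: tensDr.
Qed.
End Products.

(** If an integral relation w between the volumes holds, then w annihilates each
column of the coefficients c, by the independence of l; hence
[angle_sum_constant] applies to each column. *)
Theorem dehn_invariant_flexion (R : realType) (d : nat) (V : finType)
    (K : {set {set V}}) (o : pred (d.+2.-tuple V))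
    (HK : pseudo_manifold R d.+1 K) (Ho : orientation K o)
    (a b : R) (P : R -> {ptws V -> R} -> 'rV[R]_d.+2) (HF : flexion K a b P)
    (Hnd : forall t : R, t \in `]a, b[ -> nondegenerate_faces K (P t)) :
  forall t1 t2 : R, t1 \in `]a, b[ -> t2 \in `]a, b[ ->
    dehn_invariant K o (P t1) = dehn_invariant K o (P t2).
Proof.
move=> t1 t2 t1i t2i.
have [r [l [c [ind volE]]]] := integral_basis (vol (fun v => P t1 (vertex R v))).
pose x t s : R := repr (dihedral_angle K o (P t) s : Quotient.quot (zmultiples (2 * pi))).
have xE t s : dihedral_angle K o (P t) s = to_circle (2 * pi) (x t s).
  by rewrite /to_circle /x reprK.
have DE t (ti : t \in `]a, b[) := @dehn_invariant_basis _ _ _ _ o _ _ _ HF t1 t1i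
  r l c (x t) t ti (fun s _ => volE s) (fun s _ => xE t s).
rewrite (DE _ t1i) (DE _ t2i).
apply: eq_bigr => j _.
apply: (f_equal (tens (l j : R))).
apply: (angle_sum_constant HK Ho HF Hnd t1i _ _ t1i t2i) => [w w0|t s ti sF v1 v2 sh].
  have : \sum_j l j *~ (\sum_(s in faces d K) c s j * w s) = 0.
    rewrite -[RHS]w0 (eq_bigr (fun j => \sum_(s in faces d K) l j *~ c s j *~ w s)).
      rewrite exchange_big; apply: eq_bigr => s sF /=.
      by rewrite volE mulrzr mulrz_suml.
    move=> j' _; rewrite mulrz_sumr; apply: eq_bigr => s _.
    by rewrite mulrzA.
  move/ind/(_ j) => e; rewrite -[RHS]e.
  by apply: eq_bigr => s _; exact: mulrC.
exact: (dihedral_representative Ho HF Hnd ti sF sh (xE t s)).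
Qed.

Theorem theorem1p1 (R : realType) (d : nat) (n_ge3 : (3 <= d.+1)%N)
    (V : finType) (K : {set {set V}}) (o : pred (d.+1.-tuple V))
    (HK : pseudo_manifold R d K) (Ho : orientation K o)
    (a b : R) (P : R -> {ptws V -> R} -> 'rV[R]_d.+1)
    (HP : nontrivial_flexion K a b P)
    (Hnd : forall t : R, t \in `]a, b[ -> nondegenerate_faces K (P t)) :
  forall t1 t2 : R, t1 \in `]a, b[ -> t2 \in `]a, b[ ->
    dehn_invariant K o (P t1) = dehn_invariant K o (P t2).
Proof.
destruct d as [|d]; first by exfalso; move: n_ge3.
by case: HP => HF _; exact: (dehn_invariant_flexion HK Ho HF Hnd).
Qed.
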